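(* Let $\sigma$ be a weakly irreducible Pisot substitution, and let $d+1$ be the degree of the Pisot number $\beta$ that is the Perron eigenvalue of its incidence matrix. Then one of the following is true: (1) the eigenvalues of the subshift $(\Omega_\sigma,S)$ are all roots of unity; (2) the subshift $(\Omega_\sigma,S)$ is a finite extension of a minimal translation of the torus $\mathbb{T}^d=\mathbb{R}^d/\mathbb{Z}^d$. Moreover, there is an algorithm which, given a weakly irreducible Pisot substitution $\sigma$, decides which of the two cases holds.
   Context: A substitution over a finite alphabet $A$ is a morphism $\sigma:A^*\to A^*$ of the free monoid with $|\sigma(a)|\ge 1$ for all $a\in A$. Its incidence matrix is $M_\sigma=(|\sigma(a)|_b)_{(b,a)\in A^2}$, where $|\sigma(a)|_b$ is the number of occurrences of $b$ in $\sigma(a)$ (row index $b$, column index $a$). $\sigma$ is primitive if some power $M_\sigma^n$, $n\ge1$, has all entries strictly positive; the Perron eigenvalue is then the simple real eigenvalue equal to the spectral radius. A Pisot number is an algebraic integer $\beta>1$ all of whose conjugates $\gamma\ne\beta$ satisfy $|\gamma|<1$; it is a unit if the constant term of its minimal polynomial is $\pm1$; its degree is the degree of its minimal polynomial over $\mathbb{Q}$. A substitution is weakly irreducible Pisot if it is primitive, its Perron eigenvalue $\beta$ is a unit Pisot number, and every other eigenvalue of its incidence matrix is a conjugate of $\beta$, a root of unity, or zero. $S:A^{\mathbb{Z}}\to A^{\mathbb{Z}}$ is the shift $(u_i)_i\mapsto(u_{i+1})_i$, and $\Omega_\sigma$ is the smallest non-empty compact subset of $A^{\mathbb{Z}}$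 invariant under $\sigma$ and $S$. A complex number $\eta$ of modulus one is an eigenvalue of $(\Omega_\sigma,S)$ if there is a continuous $f:\Omega_\sigma\to\{z\in\mathbb{C}:|z|=1\}$ with $f\circ S=\eta f$. $(\Omega_\sigma,S)$ is an extension of a translation on $\mathbb{T}^d$ if there are a continuous map $f:\Omega_\sigma\to\mathbb{T}^d$ and $\alpha\in\mathbb{T}^d$ with $f\circ S=f+\alpha$; the translation is $x\mapsto x+\alpha$, and it is minimal if all its orbits are dense. The extension is finite if $f^{-1}(x)$ is finite for Lebesgue-almost every $x\in\mathbb{T}^d$. *)

(* Defs.v *)
From HB Require Import structures.
From mathcomp Require Import all_boot all_order all_algebra.
From mathcomp Require Import all_classical all_reals all_analysis.
From mathcomp Require Import ring_quotient complex.

Set Implicit Arguments.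
Unset Strict Implicit.
Unset Printing Implicit Defensive.

Import Order.TTheory GRing.Theory Num.Theory.
Import numFieldNormedType.Exports.

Local Open Scope classical_set_scope.
Local Open Scope complex_scope.
Local Open Scope ring_scope.

(* A morphism of the free monoid [seq A] is given by its values on letters. *)
Record substitution (A : finType) := Substitution {
  subst_letter :> A -> seq A;
  subst_letter_gt0 : forall a, (0 < size (subst_letter a))%N }.

Definition subst_word (A : finType) (sigma : substitution A) (w : seq A) :
  seq A := flatten [seq sigma a | a <- w].

Definition incidence (A : finType) (sigma : substitution A) : 'M[nat]_#|A| :=
  \matrix_(b < #|A|, a < #|A|)
    count_mem (enum_val b) (sigma (enum_val a)).

Definition primitive_substitution (A : finType) (sigma : substitution A) :
    Prop :=
  exists2 n, (0 < n)%N & forall b a, (0 < (incidence sigma ^+ n) b a)%N.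

(* Declared as a [numClosedFieldType] so that the topology of the modulus is
   the canonical one. *)
Definition Cplx (R : realType) : numClosedFieldType := R[i].

Definition incidenceC (R : realType) (A : finType) (sigma : substitution A) :
  'M[Cplx R]_#|A| := map_mx (fun k : nat => k%:R) (incidence sigma).

Definition perron_eigenvalue (R : realType) (A : finType)
    (sigma : substitution A) (beta : R) : Prop :=
  [/\ eigenvalue (incidenceC R sigma) (beta%:C : Cplx R),
      mup (beta%:C : Cplx R) (char_poly (incidenceC R sigma)) = 1%N &
      forall l : Cplx R, eigenvalue (incidenceC R sigma) l ->
        `|l| <= (beta%:C : Cplx R)].

Definition minimal_polynomial (F : numFieldType) (p : {poly rat}) (z : F) :
    Prop :=
  [/\ p \is monic, irreducible_poly p & root (map_poly ratr p) z].

Definition rat_conjugate (F : numFieldType) (y z : F) : Prop :=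
  exists2 p, minimal_polynomial p y & root (map_poly ratr p) z.

Definition has_degree (F : numFieldType) (z : F) (n : nat) : Prop :=
  exists2 p, minimal_polynomial p z & (size p).-1 = n.

Definition pisot (R : realType) (beta : R) : Prop :=
  [/\ integralOver (intr : int -> R) beta, 1 < beta &
      forall g : Cplx R, rat_conjugate (beta%:C : Cplx R) g -> g != beta%:C ->
        `|g| < 1].

Definition algebraic_unit (R : realType) (beta : R) : Prop :=
  exists2 p, minimal_polynomial p beta & p`_0 = 1 \/ p`_0 = -1.

Definition root_of_unity (F : fieldType) (z : F) : Prop :=
  exists2 n, (0 < n)%N & n.-unity_root z.

Definition weakly_irreducible_pisot (R : realType) (A : finType)
    (sigma : substitution A) : Prop :=
  primitive_substitution sigma /\
  exists beta : R,
    [/\ perron_eigenvalue sigma beta, pisot beta, algebraic_unit beta &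
        forall l : Cplx R, eigenvalue (incidenceC R sigma) l -> l != beta%:C ->
          [\/ rat_conjugate (beta%:C : Cplx R) l, root_of_unity l | l = 0]].

Definition biseq (A : finType) := {ptws int -> discrete_topology A}.

Definition shiftZ (A : finType) (u : biseq A) : biseq A := fun i => u (i + 1).

(* [... sigma(u_-2) sigma(u_-1) . sigma(u_0) sigma(u_1) ...], the dot preceding
   the letter of index 0.  As images of letters are non-empty, the letter of
   index [k] (resp. [- k.+1], written [Negz k]) lies in the image of
   [u_0 ... u_k] (resp. [u_(- k.+1) ... u_-1]), and the default value of [nth]
   is never used. *)
Definition subst_biseq (A : finType) (sigma : substitution A) (u : biseq A) :
    biseq A := fun i =>
  match i with
  | Posz k =>
      nth (u 0) (subst_word sigma [seq u (Posz j) | j <- iota 0 k.+1]) k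
  | Negz k =>
      nth (u 0)
        (rev (subst_word sigma [seq u (Negz j) | j <- rev (iota 0 k.+1)])) k
  end.

(* [smallest C set0] is the intersection of all the sets satisfying C. *)
Definition Omega (A : finType) (sigma : substitution A) : set (biseq A) :=
  smallest (fun K : set (biseq A) =>
    [/\ K !=set0, compact K, subst_biseq sigma @` K `<=` K &
        @shiftZ A @` K `<=` K]) set0.

(* A function on Omega is represented by a function on all of A^Z of which only
   the restriction to Omega matters; likewise for maps to the torus below. *)
Definition subshift_eigenvalue (R : realType) (A : finType)
    (sigma : substitution A) (eta : Cplx R) : Prop :=
  `|eta| = 1 /\
  exists f : biseq A -> Cplx R,
    [/\ {within Omega sigma, continuous f},
        forall u, Omega sigma u -> `|f u| = 1 &
        forall u, Omega sigma u -> f (shiftZ u) = eta * f u].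

Definition integer_lattice (R : realType) (d : nat) : zmodClosed 'rV[R]_d :=
  GRing.ZmodClosed.clone 'rV[R]_d
    (mxOver_pred (Num.int_num_subdef : {pred R})) _.

Definition torus (R : realType) (d : nat) : Type :=
  quotient_topology (Quotient.quot (integer_lattice R d)).

HB.instance Definition _ (R : realType) (d : nat) :=
  Topological.on (torus R d).
HB.instance Definition _ (R : realType) (d : nat) :=
  GRing.Zmodule.copy (torus R d) (Quotient.quot (integer_lattice R d)).

Definition torus_proj (R : realType) (d : nat) (x : 'rV[R]_d) : torus R d :=
  (\pi_(torus R d) x)%qT.

Lemma torus_proj_eq (R : realType) (d : nat) (x y : 'rV[R]_d) :
  torus_proj x = torus_proj y <-> forall i, (x - y) 0 i \is a Num.int.
Proof.
split.
  move=> e.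
  have : (x == y %[mod Quotient.quot (integer_lattice R d)])%qT by apply/eqP.
  rewrite -Quotient.idealrBE => /mxOverP H i; exact: (H 0 i).
move=> H.
suff /eqP : (x == y %[mod Quotient.quot (integer_lattice R d)])%qT by [].
rewrite -Quotient.idealrBE; apply/mxOverP => i j; rewrite ord1.
exact: H.
Qed.

Lemma torus_projD (R : realType) (d : nat) (x y : 'rV[R]_d) :
  torus_proj (x + y) = torus_proj x + torus_proj y.
Proof. exact: (Quotient.pi_add (integer_lattice R d) x y). Qed.

(* Zero outer Lebesgue measure: coverings by countably many boxes of arbitrarily
   small total volume. *)
Definition lebesgue_null (R : realType) (d : nat) (N : set 'rV[R]_d) : Prop :=
  forall eps : R, 0 < eps ->
  exists a b : nat -> 'rV[R]_d,
    [/\ forall n i, a n 0 i <= b n 0 i,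
        N `<=` \bigcup_n
          [set x : 'rV[R]_d | forall i, a n 0 i <= x 0 i <= b n 0 i] &
        (\sum_(0 <= n <oo) (\prod_(i < d) (b n 0 i - a n 0 i))%:E
           <= eps%:E)%E].

(* The Lebesgue measure of the torus is the image of that of [0, 1[^d. *)
Definition torus_null (R : realType) (d : nat) (N : set (torus R d)) : Prop :=
  lebesgue_null [set x : 'rV[R]_d |
    (forall i, 0 <= x 0 i < 1) /\ N (torus_proj x)].

Definition minimal_translation (R : realType) (d : nat) (alpha : torus R d) :
    Prop :=
  forall x : torus R d, dense (range (fun n : int => x + alpha *~ n)).

Definition extension_of_translation (R : realType) (d : nat) (A : finType)
    (sigma : substitution A) (f : biseq A -> torus R d) (alpha : torus R d) :
    Prop :=
  {within Omega sigma, continuous f} /\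
  forall u, Omega sigma u -> f (shiftZ u) = f u + alpha.

Definition finite_fibers_ae (R : realType) (d : nat) (A : finType)
    (sigma : substitution A) (f : biseq A -> torus R d) : Prop :=
  torus_null [set x | ~ finite_set (Omega sigma `&` f @^-1` [set x])].

Definition only_root_of_unity_eigenvalues (R : realType) (A : finType)
    (sigma : substitution A) : Prop :=
  forall eta : Cplx R, subshift_eigenvalue sigma eta -> root_of_unity eta.

Definition finite_extension_of_minimal_translation (R : realType) (d : nat)
    (A : finType) (sigma : substitution A) : Prop :=
  exists (f : biseq A -> torus R d) (alpha : torus R d),
    [/\ extension_of_translation sigma f alpha, minimal_translation alpha &
        finite_fibers_ae sigma f].

(* Algorithms are partial recursive functions: [murec n] is Kleene's syntax for
   those of n arguments. *)
Inductive murec : nat -> Type :=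
| MuZero n : murec n
| MuSucc : murec 1
| MuProj n (i : 'I_n) : murec n
| MuComp m n (f : murec m) (g : 'I_m -> murec n) : murec n
| MuPrim n (f : murec n) (g : murec n.+2) : murec n.+1
| MuMin n (f : murec n.+1) : murec n.

(* [murec_eval p v y]: the computation of [p] on [v] halts with value [y]. *)
Fixpoint murec_eval n (p : murec n) : n.-tuple nat -> nat -> Prop :=
  match p in murec n return n.-tuple nat -> nat -> Prop with
  | MuZero _ => fun _ y => y = 0%N
  | MuSucc => fun v y => y = (thead v).+1
  | MuProj _ i => fun v y => y = tnth v i
  | MuComp m _ f g => fun v y =>
      exists w : m.-tuple nat,
        (forall i, murec_eval (g i) v (tnth w i)) /\ murec_eval f w y
  | MuPrim n f g => fun v =>
      (fix loop k y := match k with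
       | 0%N => murec_eval f [tuple of behead v] y
       | k'.+1 => exists z, loop k' z /\
           murec_eval g [tuple of k' :: z :: behead v] y
       end) (thead v)
  | MuMin _ f => fun v y =>
      murec_eval f [tuple of y :: v] 0%N /\
      forall k, (k < y)%N ->
        exists z, murec_eval f [tuple of k :: v] z.+1
  end.

Lemma murec_eval_functional n (p : murec n) v y z :
  murec_eval p v y -> murec_eval p v z -> y = z.
Proof.
elim: p v y z => /=.
- by move=> m v y z -> ->.
- by move=> v y z -> ->.
- by move=> m i v y z -> ->.
- move=> m n' f IHf g IHg v y z [w [gw fw]] [w' [gw' fw']].
  have ww : w = w' by apply: eq_from_tnth => i; exact: IHg (gw i) (gw' i).
  by rewrite -ww in fw'; exact: IHf fw fw'.
- move=> m f IHf g IHg v; elim: (thead v) => [|k IHk] y z; first exact: IHf.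
  move=> [a [/IHk ka ga]] [b [kb gb]].
  by rewrite -(ka _ kb) in gb; exact: IHg ga gb.
- move=> m f IHf v y z [y0 yP] [z0 zP]; case: (ltngtP y z) => // lt.
    by have [a /IHf /(_ y0)] := zP _ lt.
  by have [a /IHf /(_ z0)] := yP _ lt.
Qed.

(* The letters of A are numbered by their rank in [enum A]. *)
Definition subst_code (A : finType) (sigma : substitution A) : nat :=
  CodeSeq.code
    [seq CodeSeq.code [seq (enum_rank b : nat) | b <- sigma a] | a <- enum A].

(* Main.v *)
Require Import Defs.
From HB Require Import structures.
From mathcomp Require Import all_boot all_order all_algebra.
From mathcomp Require Import all_classical all_reals all_analysis.
From mathcomp Require Import ring_quotient complex.
From mathcomp Require Import zify ring lra.

Set Implicit Arguments.
Unset Strict Implicit.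
Unset Printing Implicit Defensive.

Import Order.TTheory GRing.Theory Num.Theory.
Import numFieldNormedType.Exports.

(** The proof rests on the lengths of the words [sigma^n(w)], for [w] in the
    language of the substitution.  A polynomial [p] is paired with a word [w] to the
    combination [sum p_i |sigma^i(w)|] of these lengths ([pairing]), and the
    decisive question is whether this pairing vanishes on all loops, that is on all
    words [w] such that [w] followed by its first letter is in the language
    ([cobounding]).  By the theorem of Cayley and Hamilton and the hypothesis on the
    eigenvalues, the product [P 'X^N ('X^q - 1)^N] pairs to zero with all words,
    where [P] is the minimal polynomial of [beta]
    ([weakly_irreducible_structure]).  Removing the factors ['X^q - 1] one at a time
    leaves two cases ([torsion_or_cobounding]).

    Either, at some step, [('X^q - 1) t] is cobounding and [t] is not
    ([torsion_case]): along some loop [h] the pairing of [t] with [sigma^n(h)] is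
    periodic in [n] and not zero.  If [eta] is an eigenvalue, continuity of the
    eigenfunction makes [eta^(|sigma^n(h)|)] tend to 1 ([eigenvalue_loop]); hence
    some non-zero power of [eta] is 1 ([eigenvalue_torsion]).

    Or [P 'X^N] is cobounding.  Since all other conjugates of [beta] lie in the open
    unit disk, desubstitution shows that the pairing with ['X - beta], hence with every
    ['X^i - beta^i], is bounded on the language ([cobounding_balance]).  By the
    theorem of Gottschalk and Hedlund the latter is the coboundary of a continuous
    function [F_i] on the subshift ([potential]).  Modulo 1, [F_i] increases by the
    constant [- beta^i] under the shift, so that [(F_1, ..., F_d)] is a map to the
    torus that intertwines the shift and a translation ([finite_extension]).  The
    translation is minimal because the companion matrix of [P] preserves the integer
    lattice and contracts all directions but the eigenline of [beta]
    ([companion_dense]).  Its fibres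
    are finite because the inverse of this matrix, integral as [beta] is a unit,
    brings the integer vectors that distinguish the points of a fibre into a bounded
    set ([no_infinite_fibre]).

    The two conclusions exclude each other: a minimal translation of a torus of
    positive dimension has an eigenvalue of infinite order
    ([finite_extension_irrational]).

    For the algorithm, both cases have certificates that a finite computation
    checks.  That a polynomial is cobounding can be read on any word that contains
    all pairs of consecutive letters of the language ([closed_word], [cob_on]),
    which gives certificates of the torsion case.  In the other case [P 'X^N] has a
    multiple with a coefficient larger than the sum of the moduli of all others
    ([dominated_multiple]), whereas a polynomial of this kind cannot annihilate a
    non-zero periodic sequence; such a cobounding multiple is thus a certificate
    against the torsion case ([dominated_not_torsion]).  The algorithm looks for the
    first certificate of either kind ([torsion_cert_decides]); it is written as a
    [murec] program by means of closure properties of the class [computable] and of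
    the coding of lists by natural numbers. *)

(** * Words of the language of a substitution *)

Lemma sum_widen (V : nmodType) (F : nat -> V) m n : m <= n -> (forall i, m <= i -> F i = 0%R) ->
  (\sum_(i < m) F i = \sum_(i < n) F i)%R.
Proof.
move=> mn h; rewrite -!(big_mkord xpredT F) [RHS](big_cat_nat (n := m)) //=.
rewrite [X in (_ + X)%R]big_nat_cond [X in (_ + X)%R]big1 ?addr0 // => i; rewrite andbT => /andP[mi _].
exact: h.
Qed.

Section Words.
Variables (A : finType) (sigma : substitution A).
Implicit Types (a b : A) (u v w : seq A).

Definition siter n w := iter n (subst_word sigma) w.

Definition lang w := exists m a, infix w (siter m [:: a]).

Lemma subst_word_cat u v :
  subst_word sigma (u ++ v) = subst_word sigma u ++ subst_word sigma v.
Proof. by rewrite /subst_word map_cat flatten_cat. Qed.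

Lemma siter_cat n u v : siter n (u ++ v) = siter n u ++ siter n v.
Proof. by elim: n => //= n IH; rewrite /siter /= -!/(siter _ _) IH subst_word_cat. Qed.

Lemma siter_nil n : siter n [::] = [::].
Proof. by elim: n => //= n; rewrite /siter /= => ->. Qed.

Lemma siterD m n w : siter (m + n) w = siter m (siter n w).
Proof. by rewrite /siter iterD. Qed.

Lemma siterS n w : siter n.+1 w = siter n (subst_word sigma w).
Proof. by rewrite /siter iterSr. Qed.

Lemma siter1 w : siter 1 w = subst_word sigma w.
Proof. by []. Qed.

Lemma siterS' n w : siter n.+1 w = subst_word sigma (siter n w).
Proof. by []. Qed.

Lemma size_subst_word w : size w <= size (subst_word sigma w).
Proof.
elim: w => //= a w IH; rewrite /subst_word /= size_cat.
by have := subst_letter_gt0 sigma a; rewrite /subst_word in IH; lia.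
Qed.

Lemma size_siter n w : size w <= size (siter n w).
Proof. by elim: n => // n IH; apply: leq_trans IH _; exact: size_subst_word. Qed.

Lemma siter_infix n u v : infix u v -> infix (siter n u) (siter n v).
Proof.
by move=> /infixP[p [s ->]]; rewrite !siter_cat; apply/infixP; exists (siter n p), (siter n s).
Qed.

Lemma lang_infix u v : lang v -> infix u v -> lang u.
Proof. by move=> [m [a h]] uv; exists m, a; apply: infix_trans h. Qed.

Lemma lang_siter n w : lang w -> lang (siter n w).
Proof. by move=> [m [a h]]; exists (n + m), a; rewrite siterD; apply: siter_infix. Qed.

Lemma lang1 a : lang [:: a].
Proof. by exists 0, a; rewrite infix_refl. Qed.

Definition subst_width := \max_(a : A) size (sigma a).

Lemma subst_widthP a : size (sigma a) <= subst_width.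
Proof. exact: (leq_bigmax (F := fun a => size (sigma a))). Qed.

Lemma size_subst_word_le w : size (subst_word sigma w) <= subst_width * size w.
Proof.
elim: w => //= a w; rewrite /subst_word /= size_cat mulnS => IH.
by rewrite leq_add // subst_widthP.
Qed.

Lemma desubst_prefix w v : prefix w (subst_word sigma v) ->
  exists w' p, [/\ prefix w' v, w = subst_word sigma w' ++ p & size p <= subst_width].
Proof.
elim: v w => [|a v IH] w.
  by rewrite prefixs0 => /eqP ->; exists [::], [::].
have -> : subst_word sigma (a :: v) = sigma a ++ subst_word sigma v by [].
have [le|lt] := leqP (size w) (size (sigma a)).
  move=> _; exists [::], w; split => //.
  exact: leq_trans le (subst_widthP a).
move=> /prefixP[s e].
have ew : w = sigma a ++ drop (size (sigma a)) w.
  rewrite -{1}(cat_take_drop (size (sigma a)) w); congr (_ ++ _).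
  have := congr1 (take (size (sigma a))) e.
  by rewrite (takel_cat _ (ltnW lt)) take_size_cat.
have /IH[w' [p [h1 h2 h3]]] : prefix (drop (size (sigma a)) w) (subst_word sigma v).
  apply/prefixP; exists s.
  by move: e; rewrite {1}ew -catA => /eqP; rewrite eqseq_cat // => /andP[_ /eqP].
exists (a :: w'), p; split => //; first by rewrite /= eqxx.
by rewrite ew h2 /subst_word /= catA.
Qed.

(** Only the images of the two letters at the ends of a word can be cut by an
    occurrence, whence the bound on the sizes of the outer parts. *)
Lemma desubst_infix w v : infix w (subst_word sigma v) ->
  exists s w' p, [/\ infix w' v, w = s ++ subst_word sigma w' ++ p,
    size s <= subst_width & size p <= subst_width].
Proof.
elim: v => [|a v IH].
  by rewrite infixs0 => /eqP ->; exists [::], [::], [::].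
have -> : subst_word sigma (a :: v) = sigma a ++ subst_word sigma v by [].
move=> /infixP[x [y e]].
have [le|lt] := leqP (size (sigma a)) (size x).
  have /IH[s [w' [p [h1 h2 h3 h4]]]] : infix w (subst_word sigma v).
    apply/infixP; exists (drop (size (sigma a)) x), y.
    have := congr1 (drop (size (sigma a))) e.
    rewrite (drop_size_cat _ (erefl (size (sigma a)))) drop_cat; case: ltnP => // h.
    have -> : size (sigma a) = size x by lia.
    by rewrite subnn drop0 drop_size.
  exists s, w', p; split => //.
  by apply: infix_trans h1 _; rewrite -cat1s; apply: infix_catl; rewrite ?infix_refl.
have e2 : w ++ y = drop (size x) (sigma a) ++ subst_word sigma v.
  have := congr1 (drop (size x)) e.
  by rewrite (drop_size_cat _ (erefl (size x))) drop_cat lt => ->.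
set s := drop (size x) (sigma a) in e2.
have ss : size s <= subst_width.
  by rewrite size_drop; apply: leq_trans (subst_widthP a); rewrite leq_subr.
have [le2|lt2] := leqP (size w) (size s).
  by exists w, [::], [::]; split; rewrite ?infix0s //= ?cats0 //; apply: leq_trans le2 ss.
have ew : w = s ++ drop (size s) w.
  rewrite -{1}(cat_take_drop (size s) w); congr (_ ++ _).
  have := congr1 (take (size s)) e2.
  by rewrite (takel_cat _ (ltnW lt2)) take_size_cat // => ->.
have /desubst_prefix[w' [p [h1 h2 h3]]] : prefix (drop (size s) w) (subst_word sigma v).
  apply/prefixP; exists y.
  by move: e2; rewrite {1}ew -catA => /eqP; rewrite eqseq_cat // => /andP[_ /eqP].
exists s, w', p; split => //; last by rewrite -h2 -ew.
by apply: infix_trans (prefixW h1) _; rewrite -cat1s; apply: infix_catl; rewrite ?infix_refl.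
Qed.

End Words.

(** * Primitivity and uniform recurrence *)

Section Recurrence.
Variables (A : finType) (sigma : substitution A).
Implicit Types (a b : A) (u v w : seq A).
Notation siter := (siter sigma).
Notation lang := (lang sigma).

Lemma sum_count (V : nmodType) (f : A -> V) w :
  (\sum_(a <- w) f a = \sum_(a : A) f a *+ count_mem a w)%R.
Proof.
elim: w => [|b w IH].
  by rewrite big_nil big1 // => a _; rewrite mulr0n.
rewrite big_cons IH (bigD1 b) //= [RHS](bigD1 b) //= eqxx mulrnDr addrA; congr (_ + _)%R.
by apply: eq_bigr => a ab; rewrite eq_sym (negPf ab).
Qed.

Lemma count_siter n b w :
  count_mem b (siter n w) = \sum_(a : A) count_mem b (siter n [:: a]) * count_mem a w.
Proof.
have -> : count_mem b (siter n w) = \sum_(a <- w) count_mem b (siter n [:: a]).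
  elim: w => [|a w IH]; first by rewrite siter_nil big_nil.
  by rewrite -cat1s siter_cat count_cat IH big_cons.
have /= -> := sum_count (V := nat) (fun a => count_mem b (siter n [:: a])) w.
by apply: eq_bigr => a _; rewrite -mulr_natr natn.
Qed.

Lemma incidence_exp n (b a : 'I_#|A|) :
  (incidence sigma ^+ n)%R b a = count_mem (enum_val b) (siter n [:: enum_val a]).
Proof.
elim: n a => [|n IH] a.
  by rewrite expr0 mxE /= addn0 (inj_eq enum_val_inj) eq_sym natn.
rewrite exprSr mxE siterS count_siter.
rewrite [RHS](reindex (enum_val (A := predT))) /=; last first.
  by apply: onW_bij; exact: enum_val_bij.
by apply: eq_bigr => c _; rewrite IH mxE /subst_word /= cats0.
Qed.

Hypothesis prim : primitive_substitution sigma.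

Lemma primitive_mem : exists n, forall m a b, n <= m -> b \in siter m [:: a].
Proof.
case: prim => n n0 h; exists n => m a b nm.
have key c : b \in siter n [:: c].
  have := h (enum_rank b) (enum_rank c); rewrite incidence_exp !enum_rankK.
  by rewrite -has_count => /hasP[x xi /eqP <-].
rewrite -(subnKC nm) siterD.
case e : (siter (m - n) [:: a]) => [|c w].
  by have := size_siter sigma (m - n) [:: a]; rewrite e.
by rewrite -cat1s siter_cat mem_cat key.
Qed.

(** A word that occurs in some iterate of [b] occurs in all late enough iterates
    of [a], because these contain [b] at the appropriate level. *)
Lemma lang_eventually w : lang w ->
  exists n, forall m a, n <= m -> infix w (siter m [:: a]).
Proof.
move=> [m0 [b h]]; have [n hn] := primitive_mem.
exists (m0 + n) => m a le.
have -> : m = m0 + (m - m0) by lia.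
rewrite siterD; apply: infix_trans h _; apply: siter_infix.
by rewrite infix1s; apply: hn; lia.
Qed.

(** A long word can be desubstituted [m] times before it gets empty. *)
Lemma lang_long_siter m : exists N, forall w, lang w -> N <= size w ->
  exists a, infix (siter m [:: a]) w.
Proof.
suff H : exists N, forall n b w, infix w (siter n [:: b]) -> N <= size w -> exists a, infix (siter m [:: a]) w.
  case: H => N H; exists N => w [n [b h]]; exact: H h.
elim: m => [|m [N IH]].
  exists 1 => n b [|a w] // _ _; exists a; rewrite infix1s; exact: mem_head.
exists (maxn 2 (N * subst_width sigma + 2 * subst_width sigma).+1) => -[|n] b w h.
  by move: (size_infix h); rewrite /= => ?; lia.
rewrite siterS' in h; have [s [w' [p [h1 h2 h3 h4]]]] := desubst_infix h.
rewrite h2 !size_cat => h5.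
have := size_subst_word_le sigma w' => h6.
have [|a ha] := IH n b w' h1; first nia.
exists a; rewrite siterS'; apply: infix_trans (siter_infix sigma 1 ha) _.
by apply/infixP; exists s, p.
Qed.

(** Uniform recurrence: a long word contains a high iterate of a letter, and
    this iterate contains [w]. *)
Lemma lang_recurrent w : lang w ->
  exists N, forall v, lang v -> N <= size v -> infix w v.
Proof.
move=> /lang_eventually[n hn]; have [N hN] := lang_long_siter n.
by exists N => v lv sv; have [a ha] := hN v lv sv; apply: infix_trans ha; exact: hn.
Qed.

End Recurrence.

(** * Pairing polynomials with words *)

Section PairingTheory.
Local Open Scope ring_scope.

Section Pairing.
Variables (A : finType) (sigma : substitution A) (K : comNzRingType).
Implicit Types (a b : A) (u v w : seq A) (p q : {poly K}).
Notation siter := (siter sigma).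

(** The polynomial [p] applied to the sequence of the lengths of the iterates of
    [w].  Multiplying [p] by ['X] amounts to applying the substitution to [w],
    so that statements on incidence matrices become divisibility statements. *)
Definition pairing p w : K := \sum_(i < size p) p`_i * (size (siter i w))%:R.

Lemma pairingE n p w : (size p <= n)%N ->
  pairing p w = \sum_(i < n) p`_i * (size (siter i w))%:R.
Proof.
move=> le; apply: (sum_widen (F := fun i => p`_i * (size (siter i w))%:R) le) => i h.
by rewrite nth_default ?mul0r.
Qed.

Lemma pairingD p q w : pairing (p + q) w = pairing p w + pairing q w.
Proof.
pose n := maxn (size p) (size q).
rewrite !(pairingE (n := n)) ?leq_maxl ?leq_maxr ?size_polyD //.
by rewrite -big_split; apply: eq_bigr => i _; rewrite coefD mulrDl.
Qed.

Lemma pairingZ c p w : pairing (c *: p) w = c * pairing p w.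
Proof.
rewrite (pairingE (n := size p)) ?size_scale_leq // mulr_sumr.
by apply: eq_bigr => i _; rewrite coefZ mulrA.
Qed.

Lemma pairingN p w : pairing (- p) w = - pairing p w.
Proof. by rewrite -scaleN1r pairingZ mulN1r. Qed.

Lemma pairingB p q w : pairing (p - q) w = pairing p w - pairing q w.
Proof. by rewrite pairingD pairingN. Qed.

Lemma pairing0 w : pairing 0 w = 0.
Proof. by rewrite /pairing size_poly0 big_ord0. Qed.

Lemma pairing_sum (I : Type) (r : seq I) (P : pred I) (F : I -> {poly K}) w :
  pairing (\sum_(i <- r | P i) F i) w = \sum_(i <- r | P i) pairing (F i) w.
Proof. by apply: (big_morph (pairing ^~ w)) => [p q|]; rewrite ?pairingD ?pairing0. Qed.

Lemma pairingXn n w : pairing 'X^n w = (size (siter n w))%:R.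
Proof.
rewrite /pairing size_polyXn (bigD1 ord_max) //= coefXn eqxx mul1r big1 ?addr0 //.
by move=> i; rewrite coefXn -val_eqE /= => /negPf ->; rewrite mul0r.
Qed.

Lemma pairing_mulX p w : pairing (p * 'X) w = pairing p (subst_word sigma w).
Proof.
rewrite (pairingE (n := (size p).+1)) ?(leq_trans (size_polyMleq _ _)) ?size_polyX //; last by rewrite addn2.
rewrite big_ord_recl coefMX eqxx mul0r add0r; apply: eq_bigr => i _.
by rewrite lift0 coefMX siterS.
Qed.

Lemma pairing_mulXn n p w : pairing (p * 'X^n) w = pairing p (siter n w).
Proof.
by elim: n w => [|n IH] w; rewrite ?expr0 ?mulr1 // exprSr mulrA pairing_mulX IH siterS.
Qed.

Lemma pairing_mul p q w :
  pairing (p * q) w = \sum_(i < size q) q`_i * pairing p (siter i w).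
Proof.
rewrite -{1}(coefK q) poly_def mulr_sumr pairing_sum; apply: eq_bigr => i _.
by rewrite -scalerAr pairingZ pairing_mulXn.
Qed.

Lemma pairing_cat p u v : pairing p (u ++ v) = pairing p u + pairing p v.
Proof.
rewrite /pairing -big_split; apply: eq_bigr => i _.
by rewrite siter_cat size_cat natrD mulrDr.
Qed.

Lemma pairing_nil p : pairing p [::] = 0.
Proof. by apply: big1 => i _; rewrite siter_nil mulr0. Qed.

End Pairing.

Lemma pairing_map (A : finType) (sigma : substitution A) (K L : comNzRingType)
    (f : {rmorphism K -> L}) (p : {poly K}) w :
  f (pairing sigma p w) = pairing sigma (map_poly f p) w.
Proof.
rewrite (pairingE _ _ (size_poly _ _)) rmorph_sum; apply: eq_bigr => i _.
by rewrite rmorphM rmorph_nat coef_map.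
Qed.

Section Loops.
Variables (A : finType) (sigma : substitution A).
Implicit Types (a b : A) (u v w : seq A).
Notation siter := (siter sigma).
Notation lang := (lang sigma).

(** A path that returns to its first letter in the graph whose paths are the
    words of the language. *)
Definition loop w := exists a v, w = a :: v /\ lang (rcons w a).

Lemma loop_siter n w : loop w -> loop (siter n w).
Proof.
move=> [a [v [-> h]]].
case e : (siter n [:: a]) => [|b s].
  by have := size_siter sigma n [:: a]; rewrite e.
have e2 : siter n (a :: v) = b :: (s ++ siter n v) by rewrite -cat1s siter_cat e.
exists b, (s ++ siter n v); split => //.
apply: lang_infix (lang_siter n h) _; rewrite -[rcons (a :: v) a]cats1 siter_cat e e2.
by apply/infixP; exists [::], s; rewrite -cats1 /= -!catA.
Qed.

Section Cob.
Variable K : comNzRingType.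
Implicit Types (p q : {poly K}).

(** As in a graph, a function that sums to zero along all loops is a coboundary:
    it is a difference of values at the two ends of a path. *)
Definition cobounding p := forall w, loop w -> pairing sigma p w = 0.

Lemma cobounding_mul p q : cobounding p -> cobounding (p * q).
Proof.
move=> h w lw; rewrite pairing_mul big1 // => i _.
by rewrite h ?mulr0 //; exact: loop_siter.
Qed.

End Cob.

Section Bounded.
Variable K : numFieldType.
Implicit Types (p q : {poly K}).

Definition bounded_on_lang p :=
  exists C : K, forall w, lang w -> `|pairing sigma p w| <= C.

Lemma pairing_letters_bounded p n : exists2 C : K, 0 <= C & forall w, (size w <= n)%N -> `|pairing sigma p w| <= C.
Proof.
pose D : K := \sum_(a : A) `|pairing sigma p [:: a]|.
have D0 : 0 <= D by apply: sumr_ge0.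
exists (D *+ n); first by rewrite mulrn_wge0.
move=> w sw; suff h : `|pairing sigma p w| <= D *+ size w.
  by apply: le_trans h _; rewrite ler_wpMn2l.
elim: w {sw} => [|a w IH]; first by rewrite pairing_nil normr0.
rewrite -cat1s pairing_cat /= mulrS; apply: le_trans (ler_normD _ _) _; apply: lerD => //.
by rewrite /D (bigD1 a) //= lerDl sumr_ge0.
Qed.

(** Removing loops from a word does not change the pairing, and what remains
    once every loop is removed has distinct letters. *)
Lemma cobounding_bounded p : cobounding p -> bounded_on_lang p.
Proof.
move=> cp; have [D D0 hD] := pairing_letters_bounded p 1.
suff H : forall (n : nat) (B : {set A}) w, (#|B| <= n)%N -> lang w -> {subset w <= B} -> `|pairing sigma p w| <= D *+ n.
  by exists (D *+ #|A|) => w lw; apply: (H _ [set: A]) => //; rewrite ?cardsT // => x; rewrite inE.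
elim=> [|n IH] B w cB lw sB.
  case: w lw sB => [|a w] _ sB; first by rewrite pairing_nil normr0.
  by have := sB a (mem_head _ _); move: cB; rewrite leqn0 cards_eq0 => /eqP ->; rewrite inE.
case: w lw sB => [|a w] lw sB; first by rewrite pairing_nil normr0 mulrn_wge0.
(* split [w] after the last occurrence of its first letter *)
pose k := index a (rev (a :: w)); pose u := a :: w.
have ai : a \in rev u by rewrite mem_rev mem_head.
have kl : (k < size u)%N by rewrite -size_rev index_mem.
pose u1 := take (size u - k.+1) u; pose u2 := drop (size u - k) u.
have eu : u = u1 ++ a :: u2.
  rewrite -{1}(cat_take_drop (size u - k.+1) u) -/u1; congr (_ ++ _).
  rewrite (drop_nth a) ?ltn_subrL //.
  have -> : nth a u (size u - k.+1) = a by rewrite -nth_rev // nth_index.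
  by congr (_ :: drop _ _); lia.
have an2 : a \notin u2.
  have -> : u2 = rev (take k (rev u)) by rewrite take_rev revK.
  by rewrite mem_rev; apply: contraT => /negPn /index_ltn; rewrite ltnn.
have h1 : pairing sigma p u1 = 0.
  case e : u1 => [|b v]; first by rewrite pairing_nil.
  have eb : b = a by move: eu; rewrite e /u => -[].
  apply: cp; exists b, v; split => //; apply: lang_infix lw _.
  by rewrite -/u eu e eb; apply/infixP; exists [::], u2; rewrite -cats1 /= -catA.
rewrite -/u eu pairing_cat h1 add0r -cat1s pairing_cat mulrS.
apply: le_trans (ler_normD _ _) _; apply: lerD; first exact: hD.
apply: (IH (B :\ a)).
- by move: cB; rewrite (cardsD1 a) (sB a) ?mem_head.
- by apply: lang_infix lw _; apply/infixP; exists (u1 ++ [:: a]), [::]; rewrite -/u {1}eu -catA cats0.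
- move=> x xu; rewrite !inE; apply/andP; split.
    by apply: contraNneq an2 => <-.
  by apply: sB; rewrite -/u eu mem_cat inE xu !orbT.
Qed.

(** Writing [w] as [s ++ sigma w' ++ q] with bounded ends, the value of [p] on [w]
    is [g] times its value on [w'], up to a bounded error.  As [|g| < 1], the
    errors add up to a bounded quantity. *)
Lemma bounded_on_lang_peel p g : `|g| < 1 ->
  bounded_on_lang (p * ('X - g%:P)) -> bounded_on_lang p.
Proof.
move=> g1 [C hC]; have [D D0 hD] := pairing_letters_bounded p (maxn 1 (subst_width sigma)).
have [a0 _|A0] := pickP (fun _ : A => true); last by exists 0 => w [n [b _]]; have := A0 b.
have C0 : 0 <= C by apply: le_trans (hC [:: a0] _) => //; exact: lang1.

have g1' : 0 < 1 - `|g| by rewrite subr_gt0.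
pose E := (D + C + D) / (1 - `|g|).
have eE : E = D + C + D + `|g| * E by rewrite /E; field; rewrite gt_eqF.
have E0 : 0 <= E by rewrite /E divr_ge0 ?(ltW g1') // !addr_ge0.
have DE : D <= E by rewrite eE -!addrA lerDl !addr_ge0 // mulr_ge0.
exists E => w [n [b h]]; elim: n w h => [|n IH] w h.
  by apply: le_trans DE; apply: hD; apply: leq_trans (size_infix h) _; rewrite leq_maxl.
rewrite siterS' in h; have [s [w' [q [h1 h2 h3 h4]]]] := desubst_infix h.
rewrite h2 !pairing_cat -pairing_mulX.
have -> : p * 'X = p * ('X - g%:P) + g *: p by rewrite mulrBr [p * g%:P]mulrC mul_polyC subrK.
rewrite pairingD pairingZ eE.
have n1 := hD s (leq_trans h3 (leq_maxr _ _)).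
have n2 := hD q (leq_trans h4 (leq_maxr _ _)).
have n3 : `|pairing sigma (p * ('X - g%:P)) w'| <= C by apply: hC; exists n, b.
have n4 : `|g * pairing sigma p w'| <= `|g| * E by rewrite normrM ler_wpM2l // IH.
have -> : D + C + D + `|g| * E = D + ((C + `|g| * E) + D) by ring.
apply: le_trans (ler_normD _ _) _; apply: lerD => //.
apply: le_trans (ler_normD _ _) _; apply: lerD => //.
by apply: le_trans (ler_normD _ _) _; exact: lerD.
Qed.

End Bounded.
End Loops.

End PairingTheory.

(** * Topology of the space of bi-infinite sequences *)

Section Topology.
Local Open Scope classical_set_scope.
Variables (A : finType).
Implicit Types x y : biseq A.

Lemma nbhs_coord (x : biseq A) (i : int) : nbhs x [set y : biseq A | y i = x i].
Proof.
have := @proj_continuous int (fun _ => discrete_topology A) i x [set x i].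
by apply; rewrite nbhs_principalE; exact/principal_filterP.
Qed.

(** Convergence in the product of discrete spaces is eventual constancy of each
    coordinate. *)
Lemma biseq_cvg (F : set_system (biseq A)) x : Filter F ->
  (forall i, F [set y | y i = x i]) -> F --> x.
Proof.
move=> FF h; apply/cvg_sup => i B; rewrite nbhsE => -[C [[D oD DC] Cx] CB].
apply: filterS (h i) => y /= yx; apply: CB; rewrite -DC /=.
by move: Cx; rewrite -DC /=; rewrite /proj yx.
Qed.

Lemma biseq_continuous (f : biseq A -> biseq A) :
  (forall x i, nbhs x [set y | f y i = f x i]) -> continuous f.
Proof.
move=> h x; apply: (@biseq_cvg (nbhs (f @ nbhs x)) (f x)) => i; exact: (h x i).
Qed.

Lemma compact_biseqT : compact [set: biseq A].
Proof.
have := @tychonoff int (fun _ => discrete_topology A) (fun _ => setT).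
have -> : [set f : forall i : int, discrete_topology A | forall i, setT (f i)] = setT.
  by apply/seteqP; split.
apply => _; apply: finite_compact; exact: finite_finset.
Qed.

Lemma hausdorff_biseq : hausdorff_space (biseq A).
Proof.
apply: (@hausdorff_product int (fun _ => discrete_topology A)) => _ a b.
move=> /(_ [set a] [set b]); rewrite !nbhs_principalE.
by case=> [||c [/= -> ->]] //; exact/principal_filterP.
Qed.
End Topology.

Section Biseq.
Local Open Scope classical_set_scope.
Variables (A : finType) (sigma : substitution A).
Implicit Types x y : biseq A.
Notation siter := (siter sigma).
Notation sw := (subst_word sigma).
Notation S := (@shiftZ A).
Notation T := (subst_biseq sigma).

Definition window x (i : int) n : seq A := [seq x (i + Posz j)%R | j <- iota 0 n].

Lemma subst_word_cons a w : sw (a :: w) = sigma a ++ sw w.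
Proof. by []. Qed.

Lemma size_window x i n : size (window x i n) = n.
Proof. by rewrite size_map size_iota. Qed.

Lemma nth_window a x i n j : j < n -> nth a (window x i n) j = x (i + Posz j)%R.
Proof. by move=> jn; rewrite (nth_map 0) ?size_iota // nth_iota. Qed.

Lemma windowD x i m n : window x i (m + n) = window x i m ++ window x (i + Posz m)%R n.
Proof.
rewrite /window iotaD map_cat add0n; congr (_ ++ _).
rewrite -{1}(addn0 m) iotaDl -map_comp; apply: eq_map => j /=.
by rewrite PoszD addrA.
Qed.

Lemma window_sub x i m j n : (i <= j)%R -> (j + Posz n <= i + Posz m)%R ->
  infix (window x j n) (window x i m).
Proof.
move=> ij h; pose k := `|j - i|%N; have ek : j = (i + Posz k)%R by rewrite /k; lia.
have -> : m = k + (n + (m - (k + n))) by lia.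
by rewrite windowD windowD -ek; apply/infixP; eexists; eexists.
Qed.

Lemma iter_shiftE n x i : iter n S x i = x (i + Posz n)%R.
Proof.
elim: n i => [|n IH] i; first by rewrite addr0.
by rewrite /= /shiftZ IH; congr x; lia.
Qed.

Lemma window_shift m x i n : window (iter m S x) i n = window x (i + Posz m)%R n.
Proof. by apply: eq_map => j; rewrite iter_shiftE; congr x; lia. Qed.

Lemma subst_biseq_pos a x n k : k < size (sw (window x 0 n)) ->
  T x (Posz k) = nth a (sw (window x 0 n)) k.
Proof.
move=> kn.
have -> : T x (Posz k) = nth (x 0%R) (sw [seq x (Posz j) | j <- iota 0 k.+1]) k by [].
have -> : [seq x (Posz j) | j <- iota 0 k.+1] = window x 0 k.+1.
  by apply: eq_map => j; rewrite add0r.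
have kk : k < size (sw (window x 0 k.+1)).
  by apply: leq_trans (size_subst_word _ _); rewrite size_window.
rewrite (set_nth_default a) //.
have [le|lt] := leqP n k.+1.
  by rewrite -(subnKC le) windowD subst_word_cat nth_cat kn.
by rewrite -(subnKC (ltnW lt)) windowD subst_word_cat nth_cat kk.
Qed.

Lemma subst_biseq_neg a x n k : k < size (sw (window x (- Posz n) n)) ->
  T x (Negz k) = nth a (rev (sw (window x (- Posz n) n))) k.
Proof.
move=> kn.
have -> : T x (Negz k) = nth (x 0%R) (rev (sw [seq x (Negz j) | j <- rev (iota 0 k.+1)])) k by [].
have -> : [seq x (Negz j) | j <- rev (iota 0 k.+1)] = window x (- Posz k.+1) k.+1.
  apply: (@eq_from_nth _ a); rewrite ?size_map ?size_rev ?size_iota // => i ik.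
  rewrite nth_window // (nth_map 0) ?size_rev ?size_iota // nth_rev ?size_iota //.
  by rewrite nth_iota; [congr x|]; lia.
have kk : k < size (sw (window x (- Posz k.+1) k.+1)).
  by apply: leq_trans (size_subst_word _ _); rewrite size_window.
rewrite (set_nth_default a) ?size_rev //.
have H m l : k < size (sw (window x (- Posz l) l)) -> l <= m ->
    nth a (rev (sw (window x (- Posz m) m))) k = nth a (rev (sw (window x (- Posz l) l))) k.
  move=> kl le; rewrite -{2}(subnK le) windowD subst_word_cat rev_cat nth_cat.
  have -> : (- Posz m + Posz (m - l) = - Posz l)%R by lia.
  by rewrite size_rev kl.
by have [le|/ltnW le] := leqP n k.+1; rewrite (H _ _ _ le).
Qed.

Lemma subst_biseq_shift x : T (S x) = iter (size (sigma (x 0%R))) S (T x).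
Proof.
apply: functional_extensionality_dep => -[k|k]; rewrite iter_shiftE.
- have wS : window x 0 k.+2 = x 0%R :: window (S x) 0 k.+1.
    by rewrite -(add1n k.+1) windowD -(window_shift 1).
  have kk : k < size (sw (window (S x) 0 k.+1)).
    by apply: leq_trans (size_subst_word _ _); rewrite size_window.
  rewrite (subst_biseq_pos (x 0%R) kk).
  have -> : (Posz k + Posz (size (sigma (x 0%R))) = Posz (size (sigma (x 0%R)) + k))%R by lia.
  rewrite (@subst_biseq_pos (x 0%R) x k.+2); last first.
    by rewrite wS subst_word_cons size_cat ltn_add2l.
  by rewrite wS subst_word_cons [RHS]nth_cat ltnNge leq_addr addKn.
- set m := size _; have m0 : 0 < m by exact: subst_letter_gt0.
  have wS : window (S x) (- Posz k.+1) k.+1 = window x (- Posz k) k ++ [:: x 0%R].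
    rewrite (window_shift 1) -{2}(addn1 k) windowD; congr (_ ++ _).
      by congr window; lia.
    by rewrite /window /=; congr [:: x _]; lia.
  have kk : k < size (sw (window (S x) (- Posz k.+1) k.+1)).
    by apply: leq_trans (size_subst_word _ _); rewrite size_window.
  have h1 : sw [:: x 0%R] = sigma (x 0%R) by rewrite /subst_word /= cats0.
  rewrite (subst_biseq_neg (x 0%R) kk) wS subst_word_cat rev_cat nth_cat size_rev h1 -/m.
  have [lt|le] := ltnP k m.
    have -> : (Negz k + Posz m = Posz (m - k.+1))%R by lia.
    have e : window x 0 1 = [:: x 0%R] by rewrite /window /= addr0.
    by rewrite nth_rev // (@subst_biseq_pos (x 0%R) x 1) e h1 -/m //; lia.
  have -> : (Negz k + Posz m = Negz (k - m))%R by lia.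
  rewrite (@subst_biseq_neg (x 0%R) x k) //.
  have := size_subst_word sigma (window x (- Posz k) k); rewrite size_window; lia.
Qed.

Lemma subst_biseq_shiftn n x :
  T (iter n S x) = iter (size (sw (window x 0 n))) S (T x).
Proof.
elim: n => [|n IH] //=.
rewrite subst_biseq_shift IH -iterD -(addn1 n) windowD subst_word_cat size_cat addnC.
congr (iter (_ + size _) S _).
by rewrite iter_shiftE /subst_word /= cats0; congr (sigma (x _)); lia.
Qed.

Lemma window_subst x n :
  window (T x) 0 (size (sw (window x 0 n))) = sw (window x 0 n).
Proof.
apply: (@eq_from_nth _ (x 0%R)); rewrite size_window // => k kn.
by rewrite nth_window // add0r; exact: subst_biseq_pos.
Qed.

Lemma window_siter m x n :
  window (iter m T x) 0 (size (siter m (window x 0 n))) = siter m (window x 0 n).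
Proof.
elim: m => [|m IH]; first by rewrite size_window.
by rewrite siterS' -IH window_subst.
Qed.

Lemma siter_shiftn m n x :
  iter m T (iter n S x) = iter (size (siter m (window x 0 n))) S (iter m T x).
Proof.
elim: m => [|m IH]; first by rewrite size_window.
by rewrite /= IH subst_biseq_shiftn window_siter.
Qed.

Lemma nbhs_window x i n : nbhs x [set y | window y i n = window x i n].
Proof.
elim: n => [|n IH]; first by apply: filterS (filterT : nbhs x setT).
apply: filterS (filterI IH (nbhs_coord x (i + Posz n)%R)) => y /= [h1 h2].
by rewrite -addn1 !windowD h1 /window /= addr0 h2.
Qed.

Lemma window_cvg (z : nat -> biseq A) x :
  (forall n, window (z n) (- Posz n) (n + n) = window x (- Posz n) (n + n)) -> z @ \oo --> x.
Proof.
move=> hz; apply: biseq_cvg => i; exists `|i|%N.+1 => //= n /= ni; change (z n i = x i).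
have := hz n; have -> : i = (- Posz n + Posz (absz (i + Posz n)%R))%R by lia.
move=> e; have jn : absz (i + Posz n)%R < n + n by lia.
by rewrite -!(nth_window (x 0%R) _ _ jn) e.
Qed.

Lemma continuous_shift : continuous S.
Proof.
by apply: biseq_continuous => x i; exact: (nbhs_coord x (i + 1)%R).
Qed.

Lemma continuous_subst : continuous T.
Proof.
apply: biseq_continuous => x i.
have H j n := nbhs_window x j n.
case: i => k.
  apply: filterS (H 0%R k.+1) => y h; change (T y (Posz k) = T x (Posz k)).
  have kk z : k < size (sw (window z 0 k.+1)).
    by apply: leq_trans (size_subst_word _ _); rewrite size_window.
  by rewrite (subst_biseq_pos (x 0%R) (kk x)) (subst_biseq_pos (x 0%R) (kk y)) h.
apply: filterS (H (- Posz k.+1)%R k.+1) => y h; change (T y (Negz k) = T x (Negz k)).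
have kk z : k < size (sw (window z (- Posz k.+1) k.+1)).
  by apply: leq_trans (size_subst_word _ _); rewrite size_window.
by rewrite (subst_biseq_neg (x 0%R) (kk x)) (subst_biseq_neg (x 0%R) (kk y)) h.
Qed.

End Biseq.

(** * The subshift *)

Section OmegaFacts.
Local Open Scope classical_set_scope.
Variables (A : finType) (sigma : substitution A).
Implicit Types x y : biseq A.
Notation siter := (siter sigma).
Notation lang := (lang sigma).
Notation sw := (subst_word sigma).
Notation S := (@shiftZ A).
Notation T := (subst_biseq sigma).
Notation Omega := (Omega sigma).

Let invariant_compact (K : set (biseq A)) :=
  [/\ K !=set0, compact K, T @` K `<=` K & S @` K `<=` K].

Lemma Omega_sub K : invariant_compact K -> Omega `<=` K.
Proof. by move=> hK x; apply; split. Qed.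

Lemma Omega_shift x : Omega x -> Omega (S x).
Proof. by move=> h K [hK _]; case: (hK) => _ _ _; apply; exists x => //; exact: Omega_sub h. Qed.

Lemma Omega_subst x : Omega x -> Omega (T x).
Proof. by move=> h K [hK _]; case: (hK) => _ _ + _; apply; exists x => //; exact: Omega_sub h. Qed.

Lemma Omega_shiftn n x : Omega x -> Omega (iter n S x).
Proof. by move=> h; elim: n => //= n; exact: Omega_shift. Qed.

Lemma Omega_substn n x : Omega x -> Omega (iter n T x).
Proof. by move=> h; elim: n => //= n; exact: Omega_subst. Qed.

Lemma compact_Omega : compact Omega.
Proof.
have cl : closed Omega.
  rewrite /Defs.Omega /smallest; apply: closed_bigI => K [[_ cK _ _] _].
  exact: compact_closed (@hausdorff_biseq A) cK.
by apply: (subclosed_compact cl (@compact_biseqT A)).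
Qed.

Hypothesis prim : primitive_substitution sigma.
Hypothesis unbounded : forall n, exists w, lang w /\ n <= size w.

Lemma long_siter n : exists m, forall m' a, m <= m' -> n <= size (siter m' [:: a]).
Proof.
have [w [lw sw]] := unbounded n; have [m h] := lang_eventually prim lw.
exists m => m' a mm; apply: leq_trans sw _; apply: size_infix; exact: h.
Qed.

(** An invariant compact set contains shifts of the iterates of one of its points,
    and these approximate [x], every factor of which occurs in a late iterate. *)
Lemma bi_lang_Omega x : (forall i n, lang (window x i n)) -> Omega x.
Proof.
move=> h K [[[y Ky] cK TK SK] _].
have SKn n z : K z -> K (iter n S z) by move=> Kz; elim: n => //= n IH; apply: SK; exists (iter n S z).
have TKn n z : K z -> K (iter n T z) by move=> Kz; elim: n => //= n IH; apply: TK; exists (iter n T z).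
have clK : closed K by exact: compact_closed (@hausdorff_biseq A) cK.
have H n : exists z, K z /\ window z (- Posz n) (n + n) = window x (- Posz n) (n + n).
  have [m hm] := lang_eventually prim (h (- Posz n)%R (n + n)).
  have /infixP[p [s e]] := hm m (y 0%R) (leqnn _).
  exists (iter (size p + n) S (iter m T y)); split; first by apply: SKn; exact: TKn.
  rewrite window_shift; have -> : (- Posz n + Posz (size p + n) = 0 + Posz (size p))%R by lia.
  have := window_siter sigma m y 1.
  have -> : window y 0 1 = [:: y 0%R] by rewrite /window /= addr0.
  rewrite e !size_cat size_window windowD => /eqP; rewrite eqseq_cat ?size_window // => /andP[_].
  by rewrite windowD eqseq_cat ?size_window // => /andP[/eqP].
have [z hz] := choice H.
have cz : z @ \oo --> x by apply: window_cvg => n; exact: (hz n).2.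
by apply: (closed_cvg K clK _ x cz); apply: nearW => n; exact: (hz n).1.
Qed.

(** Compactness, applied to words of the language centered at 0. *)
Lemma bi_lang_exists : exists x : biseq A, forall i n, lang (window x i n).
Proof.
have H n : exists x, lang (window x (- Posz n) (n + n)).
  have [w [lw sw]] := unbounded (n + n).+1.
  case: w lw sw => // a w lw sw.
  exists (fun i => nth a (a :: w) (absz (i + Posz n)%R)).
  apply: lang_infix lw _.
  suff -> : window (fun i => nth a (a :: w) (absz (i + Posz n)%R)) (- Posz n) (n + n) = take (n + n) (a :: w).
    by apply/infixP; exists [::], (drop (n + n) (a :: w)); rewrite cat0s cat_take_drop.
  apply: (@eq_from_nth _ a); rewrite size_window ?size_take; first by case: ltnP => //; lia.
  move=> i lt; rewrite nth_window // nth_take //; congr nth; lia.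
have [z hz] := choice H.
have [|x [_ cx]] := @compact_biseqT A (z @ \oo) _; first exact: filterT.
exists x => i n.
have [||y [/= h1 h2]] := cx [set y | lang (window y i n)] [set y | window y i n = window x i n].
- exists (`|i| + n)%N => //= m /= le; apply: lang_infix (hz m) _; apply: window_sub; lia.
- exact: nbhs_window.
- by rewrite -h2.
Qed.

Lemma Omega_nonempty : Omega !=set0.
Proof. by have [x hx] := bi_lang_exists; exists x; exact: bi_lang_Omega. Qed.

(** The sequences whose factors at non-negative indices all belong to the language
    form an invariant compact set.  Restricting to non-negative indices makes
    [window_subst] sufficient for the stability under the substitution. *)
Lemma Omega_lang x (i n : nat) : Omega x -> lang (window x (Posz i) n).
Proof.
pose K := [set y : biseq A | forall n, lang (window y 0 n)].
suff H : invariant_compact K.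
  move=> /(Omega_shiftn i) /(Omega_sub H) /(_ n).
  by rewrite window_shift add0r.
split.
- by have [y hy] := bi_lang_exists; exists y => n1; exact: hy.
- apply: (subclosed_compact _ (@compact_biseqT A)) => //.
  move=> y cy n1; have [y' [h1 h2]] := cy _ (nbhs_window y 0 n1).
  by rewrite /= in h2; rewrite -h2; exact: h1.
- move=> _ [y Ky <-] n1; apply: lang_infix (lang_siter 1 (Ky n1)) _.
  rewrite siter1 -window_subst; apply: window_sub => //.
  by have := size_subst_word sigma (window y 0 n1); rewrite size_window; lia.
- move=> _ [y Ky <-] n1; apply: lang_infix (Ky n1.+1) _.
  by rewrite (window_shift 1); apply: window_sub; lia.
Qed.

Lemma Omega_recurrent w : lang w -> exists N, forall x m, Omega x ->
  exists i, [/\ m <= i, i + size w <= m + N & window x (Posz i) (size w) = w].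
Proof.
move=> /(lang_recurrent prim)[N hN]; exists N => x m Ox.
have /infixP[p [s e]] := hN _ (Omega_lang m N Ox) (eq_leq (esym (size_window x (Posz m) N))).
have sz := congr1 size e; rewrite size_window !size_cat in sz.
exists (m + size p); split; first exact: leq_addr.
  by rewrite sz !addnA leq_addr.
move: e; rewrite sz windowD windowD => /eqP; rewrite eqseq_cat ?size_window // => /andP[_].
by rewrite eqseq_cat ?size_window // => /andP[/eqP h _]; rewrite PoszD.
Qed.

Lemma Omega_prefix w : lang w -> exists2 x, Omega x & window x 0 (size w) = w.
Proof.
move=> /Omega_recurrent[N hN]; have [x Ox] := Omega_nonempty.
have [i [_ _ h]] := hN x 0 Ox.
by exists (iter i S x); [exact: Omega_shiftn | rewrite window_shift add0r].
Qed.

Lemma invariant_compact_image (f : biseq A -> biseq A) : continuous f ->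
  compact (f @` Omega).
Proof. by move=> cf; apply: continuous_compact compact_Omega; exact: continuous_subspaceT. Qed.

(** The image of [Omega] under the shift is again an invariant compact set, so
    that it contains the smallest one. *)
Lemma Omega_unshift x : Omega x -> exists2 y, Omega y & S y = x.
Proof.
suff H : invariant_compact (S @` Omega) by move=> /(Omega_sub H) [y Oy <-]; exists y.
split.
- by have [y Oy] := Omega_nonempty; exists (S y); exists y.
- by apply: invariant_compact_image; exact: continuous_shift.
- move=> _ [_ [y Oy <-] <-]; rewrite subst_biseq_shift.
  have := subst_letter_gt0 sigma (y 0%R); case: (size _) => // n _.
  by exists (iter n S (T y)) => //; apply: Omega_shiftn; exact: Omega_subst.
- by move=> _ [_ [y Oy <-] <-]; exists (S y) => //; exact: Omega_shift.
Qed.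

Lemma Omega_unshiftn n x : Omega x -> exists2 y, Omega y & iter n S y = x.
Proof.
elim: n x => [|n IH] x Ox; first by exists x.
by have [y Oy <-] := Omega_unshift Ox; have [z Oz <-] := IH _ Oy; exists z.
Qed.

(** Shifting past the iterate of the letter of index 0 amounts to shifting the
    sequence before it is substituted. *)
Lemma tower_normalize n j y : Omega y ->
  exists y' j', [/\ Omega y', j' < size (siter n [:: y' 0%R]) &
    iter j S (iter n T y) = iter j' S (iter n T y')].
Proof.
elim/ltn_ind: j y => j IH y Oy.
have [lt|le] := ltnP j (size (siter n [:: y 0%R])); first by exists y, j.
have m0 := size_siter sigma n [:: y 0%R].
have [|y' [j' [h1 h2 h3]]] := IH (j - size (siter n [:: y 0%R])) _ (S y) (Omega_shift Oy).
  by move: m0 => /=; lia.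
exists y', j'; split => //; rewrite -h3 (siter_shiftn sigma n 1) -iterD.
by rewrite /window /= addr0 subnK.
Qed.

(** The shifts of the images of the points of [Omega] form an invariant compact
    set; bounding the shift makes it a finite union of compact sets. *)
Lemma Omega_desubst x : Omega x ->
  exists y j, [/\ Omega y, j < size (sigma (y 0%R)) & x = iter j S (T y)].
Proof.
have red j y : Omega y -> exists y' j', [/\ Omega y', j' < size (sigma (y' 0%R)) & iter j S (T y) = iter j' S (T y')].
  move=> /(tower_normalize 1 j)[y' [j' [h1 h2 h3]]]; exists y', j'; split => //.
  by move: h2; rewrite siter1 /subst_word /= cats0.
pose K := \big[setU/set0]_(j < (subst_width sigma).+1) ((fun y => iter j S (T y)) @` Omega).
have KP z : K z <-> exists y j, Omega y /\ z = iter j S (T y).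
  rewrite /K -(bigcup_mkord _ (fun j => (fun y => iter j S (T y)) @` Omega)); split; first by move=> [j _ [y Oy <-]]; exists y, j.
  move=> [y [j [Oy ->]]]; have [y' [j' [h1 h2 h3]]] := red j y Oy.
  exists j' => /=; first by have := subst_widthP sigma (y' 0%R); lia.
  by exists y'.
suff H : invariant_compact K.
  by move=> /(Omega_sub H) /KP[y [j [Oy ->]]]; exact: red.
split.
- by have [y Oy] := Omega_nonempty; exists (T y); apply/KP; exists y, 0.
- apply: bigsetU_compact => j _; apply: invariant_compact_image.
  have cj : continuous (iter j S).
    elim: (j : nat) => [|n IH] /=; first by move=> z; exact: cvg_id.
    by move=> z; apply: continuous_comp; [exact: IH|exact: continuous_shift].
  by move=> z; apply: continuous_comp; [exact: continuous_subst|exact: cj].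
- move=> _ [z /KP[y [j [Oy ->]]] <-]; apply/KP; rewrite subst_biseq_shiftn.
  by exists (T y); eexists; split; [exact: Omega_subst|].
- move=> _ [z /KP[y [j [Oy ->]]] <-]; apply/KP; by exists y, j.+1.
Qed.

Lemma Omega_desubstn n x : Omega x ->
  exists y j, [/\ Omega y, j < size (siter n [:: y 0%R]) & x = iter j S (iter n T y)].
Proof.
elim: n x => [|n IH] x Ox; first by exists x, 0.
have [y [j [Oy _ ->]]] := Omega_desubst Ox.
have [z [i [Oz _ ->]]] := IH y Oy.
by rewrite subst_biseq_shiftn -iterD; have := tower_normalize n.+1 _ Oz; apply.
Qed.

End OmegaFacts.

(** * Potentials *)

Section Potential.
Local Open Scope classical_set_scope.
Local Open Scope ring_scope.
Variables (A : finType) (sigma : substitution A) (R : realType).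
Implicit Types (x y : biseq A) (p q : {poly R}).
Notation lang := (lang sigma).
Notation sw := (subst_word sigma).
Notation S := (@shiftZ A).
Notation T := (subst_biseq sigma).
Notation Omega := (Omega sigma).
Notation pairing := (pairing sigma).

Hypothesis prim : primitive_substitution sigma.
Hypothesis unbounded : forall n, exists w, lang w /\ (n <= size w)%N.

Definition birkhoff p x n : R := pairing p (window x 0 n).

(** The theorem of Gottschalk and Hedlund: bounded Birkhoff sums have a continuous
    transfer function.  The supremum is the standard choice for a forward
    dynamical system; the sign is such that the potential grows by [pairing p]
    along the orbit. *)
Definition potential p x : R := - sup (range (birkhoff p x)).

Lemma birkhoffD p x m n :
  birkhoff p x (m + n) = birkhoff p x m + birkhoff p (iter m S x) n.
Proof. by rewrite /birkhoff windowD pairing_cat window_shift add0r. Qed.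

Lemma birkhoff1 p x : birkhoff p x 1 = pairing p [:: x 0].
Proof. by rewrite /birkhoff /window /= addr0. Qed.

(** A word on which the modulus of the pairing is almost maximal occurs with
    bounded gaps.  Between its ends the Birkhoff sum goes from almost its infimum
    to almost its supremum, or conversely, so that it is almost maximal at one of
    the ends. *)
Lemma birkhoff_near_max p : bounded_on_lang sigma p -> forall e, 0 < e ->
  exists N, forall x m, Omega x -> exists j, [/\ (m <= j)%N, (j <= m + N)%N &
    forall n, birkhoff p x n <= birkhoff p x j + e].
Proof.
move=> [C hC] e e0.
pose V := [set `|pairing p w| | w in lang].
have [w0 [lw0 _]] := unbounded 0.
have sV : has_sup V.
  split; first by exists `|pairing p w0|; exists w0.
  by exists C => _ [w lw <-]; exact: hC.
have [_ [w lw <-] hw] := sup_adherent e0 sV.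
have le w' : lang w' -> `|pairing p w'| <= sup V by move=> lw'; apply: ub_le_sup sV.2 _ _; exists w'.
have [N hN] := Omega_recurrent prim unbounded lw.
exists N => x m Ox; have [i [mi iN ew]] := hN x m Ox.
have diff n k : `|birkhoff p x n - birkhoff p x k| <= sup V.
  wlog nk : n k / (n <= k)%N => [H|].
    by have [|/ltnW] := leqP n k; [exact: H | rewrite distrC; exact: H].
  rewrite distrC -(subnKC nk) birkhoffD addrAC subrr add0r.
  by apply: le; rewrite window_shift add0r; exact: Omega_lang.
have ei : birkhoff p x (i + size w) = birkhoff p x i + pairing p w.
  by rewrite birkhoffD /birkhoff window_shift add0r ew.
have [w_ge|w_lt] := lerP 0 (pairing p w).
- exists (i + size w)%N; split; [lia|lia|] => n.
  have := ler_norm (birkhoff p x n - birkhoff p x i); have := diff n i.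
  by move: hw; rewrite ger0_norm // ei; lra.
- exists i; split; [lia|lia|] => n.
  have := ler_norm (birkhoff p x n - birkhoff p x (i + size w)); have := diff n (i + size w)%N.
  by move: hw; rewrite ltr0_norm // ei; lra.
Qed.

Section Bounded.
Variable p : {poly R}.
Hypothesis bp : bounded_on_lang sigma p.

Let has_sup_birkhoff x : Omega x -> has_sup (range (birkhoff p x)).
Proof.
move=> Ox; split; first by exists (birkhoff p x 0), 0%N.
have [C hC] := bp; exists C => _ [n _ <-].
by apply: le_trans (ler_norm _) (hC _ _); exact: Omega_lang.
Qed.

Let birkhoff_le x n : Omega x -> birkhoff p x n <= - potential p x.
Proof. by move=> Ox; rewrite opprK; apply: ub_le_sup (has_sup_birkhoff Ox).2 _ _; exists n. Qed.

Let potential_ge x M : (forall n, birkhoff p x n <= M) -> - M <= potential p x.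
Proof.
move=> h; rewrite lerN2; apply: ge_sup; first by exists (birkhoff p x 0), 0%N.
by move=> _ [n _ <-].
Qed.

Lemma potential_bounded : exists2 C : R, 0 <= C & forall x, Omega x -> `|potential p x| <= C.
Proof.
have [C hC] := bp; exists C.
  by have [w [lw _]] := unbounded 0; apply: le_trans (hC w lw).
move=> x Ox; rewrite ler_norml; apply/andP; split.
  by apply: potential_ge => n; apply: le_trans (ler_norm _) (hC _ _); exact: Omega_lang.
have h0 : birkhoff p x 0 = 0 by rewrite /birkhoff pairing_nil.
have := birkhoff_le 0 Ox; rewrite h0; have := hC _ (Omega_lang unbounded 0 0 Ox).
by rewrite pairing_nil normr0; lra.
Qed.

Lemma potential_shift x : Omega x -> potential p (S x) = potential p x + pairing p [:: x 0].
Proof.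
move=> Ox; have OSx := Omega_shift Ox.
have bS n : birkhoff p x n.+1 = pairing p [:: x 0] + birkhoff p (S x) n.
  by rewrite -add1n birkhoffD birkhoff1.
apply/eqP; rewrite eq_le; apply/andP; split; last first.
  rewrite -[_ + _]opprK; apply: potential_ge => n.
  by have := birkhoff_le n.+1 Ox; rewrite bS; lra.
(* the maximum is almost attained at a positive time, hence also by the sums
   that start at [S x] *)
apply/ler_addgt0Pr => e e0; have [N hN] := birkhoff_near_max bp e0.
have [[|j] [// _ _ hj]] := hN x 1%N Ox.
suff : - (birkhoff p x j.+1 + e) <= potential p x.
  by have := birkhoff_le j OSx; rewrite bS; lra.
exact: potential_ge.
Qed.

Lemma potential_shiftn x n : Omega x -> potential p (iter n S x) = potential p x + birkhoff p x n.
Proof.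
move=> Ox; elim: n => [|n IH]; first by rewrite /birkhoff pairing_nil addr0.
rewrite iterS potential_shift ?IH; last exact: Omega_shiftn.
by rewrite -addrA -addn1 birkhoffD birkhoff1.
Qed.

(** By [birkhoff_near_max] the supremum is almost attained within a time that does
    not depend on the point. *)
Lemma potential_local e : 0 < e -> exists N, forall x y, Omega x -> Omega y ->
  window x 0 N = window y 0 N -> `|potential p x - potential p y| <= e.
Proof.
move=> e0; have [N hN] := birkhoff_near_max bp e0.
exists N => x y Ox Oy.
have H x' y' : Omega x' -> Omega y' -> window x' 0 N = window y' 0 N -> potential p y' - potential p x' <= e.
  move=> Ox' Oy' exy; have [j [_ jN hj]] := hN x' 0 Ox'.
  have := potential_ge hj; have := birkhoff_le j Oy'.
  suff -> : birkhoff p x' j = birkhoff p y' j by lra.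
  rewrite add0n in jN; rewrite /birkhoff; congr pairing; move: exy; rewrite -(subnKC jN) !windowD.
  by move/eqP; rewrite eqseq_cat ?size_window // => /andP[/eqP].
by move=> exy; rewrite ler_norml; have := H _ _ Ox Oy exy; have := H _ _ Oy Ox (esym exy); lra.
Qed.

Lemma potential_return e : 0 < e -> exists N, forall x y i, Omega x -> Omega y ->
  window x (Posz i) N = window y 0 N ->
  `|potential p x - potential p y + birkhoff p x i| <= e.
Proof.
move=> e0; have [N hN] := potential_local e0; exists N => x y i Ox Oy h.
have := hN (iter i S x) y (Omega_shiftn i Ox) Oy.
rewrite window_shift add0r potential_shiftn // => /(_ h).
by rewrite addrAC.
Qed.

End Bounded.

Lemma window_return x y N : Omega x -> Omega y ->
  exists i, window x (Posz i) N = window y 0 N.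
Proof.
move=> Ox Oy; have [M hM] := Omega_recurrent prim unbounded (Omega_lang unbounded 0 N Oy).
by have [i [_ _]] := hM x 0%N Ox; rewrite size_window; exists i.
Qed.

(** The potential depends on a choice, its differences do not: by [delta_unique]
    they are the limits of [- pairing p] along the words that separate [x] from
    closer and closer returns to [y].  Hence [delta] is linear in [p] and
    compatible with the substitution, as [pairing] is. *)
Definition delta p x y := potential p x - potential p y.

Lemma deltaE p x y : delta p x y = potential p x - potential p y.
Proof. by []. Qed.

Lemma delta_unique p x y c : bounded_on_lang sigma p -> Omega x -> Omega y ->
  (forall e N, 0 < e -> exists i, window x (Posz i) N = window y 0 N /\
     `|c + birkhoff p x i| <= e) -> delta p x y = c.
Proof.
move=> bp Ox Oy h; apply/eqP; rewrite -subr_eq0 -normr_le0.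
apply/ler_addgt0Pr => e e0; have e2 : 0 < e / 2 by lra.
have [N hN] := potential_return bp e2.
have [i [ei hi]] := h _ N e2; have := hN x y i Ox Oy ei.
rewrite -/(delta p x y) add0r => h1.
have -> : delta p x y - c = (delta p x y + birkhoff p x i) - (c + birkhoff p x i) by ring.
by apply: le_trans (ler_normB _ _) _; lra.
Qed.

Lemma window_prefix_eq x y i M N : (N <= M)%N -> window x i M = window y 0 M -> window x i N = window y 0 N.
Proof.
move=> NM; rewrite -(subnKC NM) !windowD => /eqP.
by rewrite eqseq_cat ?size_window // => /andP[/eqP].
Qed.

Lemma delta_lin p q a x y : bounded_on_lang sigma p -> bounded_on_lang sigma q ->
  bounded_on_lang sigma (a *: p + q) ->
  Omega x -> Omega y -> delta (a *: p + q) x y = a * delta p x y + delta q x y.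
Proof.
move=> bp bq bpq Ox Oy; apply: delta_unique => // e N e0.
have a1 : 0 < `|a| + 1 by have := normr_ge0 a; lra.
have e1 : 0 < e / 2 / (`|a| + 1) by rewrite !divr_gt0.
have e2 : 0 < e / 2 by lra.
have [N1 hN1] := potential_return bp e1; have [N2 hN2] := potential_return bq e2.
have [i ei] := window_return (maxn N (maxn N1 N2)) Ox Oy.
exists i; split; first by apply: window_prefix_eq ei; lia.
have h1 := hN1 x y i Ox Oy (window_prefix_eq _ ei).
have h2 := hN2 x y i Ox Oy (window_prefix_eq _ ei).
have -> : a * delta p x y + delta q x y + birkhoff (a *: p + q) x i =
  a * (delta p x y + birkhoff p x i) + (delta q x y + birkhoff q x i).
  by rewrite /birkhoff pairingD pairingZ; ring.
apply: le_trans (ler_normD _ _) _; rewrite normrM.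
have h3 : `|delta q x y + birkhoff q x i| <= e / 2 by apply: h2; lia.
have h4 : `|delta p x y + birkhoff p x i| <= e / 2 / (`|a| + 1) by apply: h1; lia.
have : `|a| * `|delta p x y + birkhoff p x i| <= e / 2.
  apply: le_trans (ler_wpM2l (normr_ge0 _) h4) _.
  by rewrite mulrA ler_pdivrMr // mulrDr mulr1 mulrC lerDl ltW.
lra.
Qed.

(** A return of [x] close to [y] is sent by the substitution to a return of its
    image close to the image of [y]. *)
Lemma delta_subst p x y : bounded_on_lang sigma p -> bounded_on_lang sigma (p * 'X) ->
  Omega x -> Omega y -> delta p (T x) (T y) = delta (p * 'X) x y.
Proof.
move=> bp bpX Ox Oy; apply/esym; apply: delta_unique => // e N e0.
have [N1 hN1] := potential_return bp e0.
have [i ei] := window_return (maxn N N1) Ox Oy.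
exists i; split; first by apply: window_prefix_eq ei; lia.
have eX : birkhoff (p * 'X) x i = birkhoff p (T x) (size (sw (window x 0 i))).
  by rewrite /birkhoff pairing_mulX window_subst.
rewrite eX; apply: hN1; [exact: Omega_subst|exact: Omega_subst|].
have e1 : window (iter i S x) 0 N1 = window y 0 N1.
  by rewrite window_shift add0r; apply: window_prefix_eq ei; lia.
have := subst_biseq_shiftn sigma i x => e2.
have -> : window (T x) (size (sw (window x 0 i))) N1 = window (T (iter i S x)) 0 N1.
  by rewrite e2 window_shift add0r.
have le : (N1 <= size (sw (window y 0 N1)))%N by rewrite -{1}(size_window y 0 N1) size_subst_word.
apply: (window_prefix_eq le); rewrite -{1}e1 !window_subst; congr sw; exact: e1.
Qed.

(** The words between [x] and its returns to [y] are loops. *)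
Lemma delta_cobounding p x y : cobounding sigma p -> Omega x -> Omega y ->
  x 0 = y 0 -> delta p x y = 0.
Proof.
move=> cp Ox Oy xy; apply: delta_unique => //; first exact: cobounding_bounded.
move=> e N e0; have [i ei] := window_return N.+1 Ox Oy.
exists i; split; first by apply: window_prefix_eq ei; lia.
rewrite add0r; suff -> : birkhoff p x i = 0 by rewrite normr0 ltW.
case: i ei => [|i] ei; first by rewrite /birkhoff pairing_nil.
apply: cp; exists (x 0), (window x 1 i); split.
  by rewrite -(add1n i) windowD add0r /window /= addr0.
have -> : rcons (window x 0 i.+1) (x 0) = window x 0 (i.+1 + 1)%N; last exact: Omega_lang.
rewrite windowD -cats1 add0r; congr (_ ++ _).
have := window_prefix_eq (_ : (1 <= N.+1)%N) ei => /(_ isT).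
by rewrite xy /window /= addr0 => ->; rewrite addr0.
Qed.

End Potential.

(** * Finiteness of the fibres *)

Section FibreTheory.
Local Open Scope classical_set_scope.
Local Open Scope ring_scope.

(** The pairing of [p * q] is a combination of the pairings of [p] with iterates. *)
Lemma bounded_on_lang_mul (A : finType) (sigma : substitution A) (K : numFieldType) (p q : {poly K}) :
  bounded_on_lang sigma p -> bounded_on_lang sigma (p * q).
Proof.
move=> [C hC]; exists (\sum_(i < size q) `|q`_i| * C) => w lw.
rewrite pairing_mul; apply: le_trans (ler_norm_sum _ _ _) _; apply: ler_sum => i _.
by rewrite normrM ler_wpM2l //; apply: hC; exact: lang_siter.
Qed.

Lemma pairing_XnC (A : finType) (sigma : substitution A) (K : comNzRingType) (c : K) i w :
  pairing sigma ('X^i - c%:P) w = (size (siter sigma i w))%:R - c * (size w)%:R.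
Proof.
by rewrite pairingB pairingXn -alg_polyC pairingZ -(expr0 ('X : {poly K})) pairingXn.
Qed.

Lemma pigeonhole (I T : finType) (f : I -> T) m : (#|T| * m < #|I|)%N ->
  exists t, (m < #|[pred i | f i == t]|)%N.
Proof.
move=> lt; apply: contrapT => /forallNP h; move: lt; apply/negP; rewrite -leqNgt.
rewrite -[#|I|]sum1_card (partition_big f xpredT) //= -sum_nat_const.
apply: leq_sum => t _; have /negP := h t; rewrite -leqNgt; apply: leq_trans.
by rewrite -sum1_card.
Qed.

(** The window starts at a negative index [- m]; in [no_infinite_fibre] the points
    are shifted back so that only windows at non-negative indices are used. *)
Lemma biseq_separate (A : finType) (x : nat -> biseq A) M : injective x ->
  exists m N, forall i j, (i < M)%N -> (j < M)%N -> window (x i) (- Posz m) N = window (x j) (- Posz m) N -> i = j.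
Proof.
move=> ix.
have h (ij : nat * nat) : exists c, ij.1 <> ij.2 -> x ij.1 c <> x ij.2 c.
  have [e|/eqP ne] := eqVneq ij.1 ij.2; first by exists 0.
  apply: contrapT => /forallNP h; apply: ne; apply: ix; apply: functional_extensionality_dep => c.
  by apply: contrapT => nc; apply: (h c) => _; exact: nc.
have [c hc] := choice h.
pose m := \max_(i < M) \max_(j < M) absz (c (i : nat, j : nat)).
exists m, (m + m).+1 => i j iM jM e; apply: contrapT => ne.
have cm : (absz (c (i, j)) <= m)%N.
  apply: leq_trans (leq_bigmax (Ordinal iM)).
  exact: (leq_bigmax (F := fun j : 'I_M => absz (c (i, j : nat))) (Ordinal jM)).
apply: (hc (i, j) ne) => /=; pose l := absz (c (i, j) + Posz m)%R.
have el : c (i, j) = - Posz m + Posz l by rewrite /l; lia.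
have ll : (l < (m + m).+1)%N by rewrite /l; lia.
by rewrite el -!(nth_window (x i 0) _ _ ll) e.
Qed.

Section Fibres.
Variables (A : finType) (sigma : substitution A) (R : realType).
Implicit Types (x y : biseq A) (p q : {poly R}).
Notation siter := (siter sigma).
Notation lang := (lang sigma).
Notation S := (@shiftZ A).
Notation T := (subst_biseq sigma).
Notation Omega := (Omega sigma).
Notation delta := (delta sigma).

Hypothesis prim : primitive_substitution sigma.
Hypothesis unbounded : forall n, exists w, lang w /\ (n <= size w)%N.

Variables (beta : R) (d k : nat) (P : {poly int}).
Hypothesis beta1 : 1 < beta.
Hypothesis bbeta : bounded_on_lang sigma ('X - beta%:P).
Hypothesis sP : size P = d.+3.
Hypothesis mP : P \is monic.
Hypothesis P0 : P`_0 * P`_0 = 1.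
Hypothesis rP : root (map_poly intr P) beta.
Hypothesis cP : cobounding sigma (P * 'X^k).

Notation D i := ('X^i - (beta ^+ i)%:P).

(** The case of ['X - beta] implies that of all its multiples, in particular of
    the polynomials [D i] that define the map to the torus. *)
Lemma root_bounded p : root p beta -> bounded_on_lang sigma p.
Proof. by move=> /factor_theorem[q ->]; rewrite mulrC; exact: bounded_on_lang_mul. Qed.

Lemma D_root i : root (D i) beta.
Proof. by rewrite /root !hornerE subrr. Qed.

Lemma DX_bounded m i : bounded_on_lang sigma ('X^m * D i).
Proof. by apply: root_bounded; rewrite rootM D_root orbT. Qed.

Lemma delta0 x y : Omega x -> Omega y -> delta (0 : {poly R}) x y = 0.
Proof.
move=> Ox Oy; have h := DX_bounded 0 0.
have := delta_lin prim unbounded (a := -1) h h; rewrite scaleN1r addNr => ->//.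
  by rewrite mulN1r addNr.
by apply: root_bounded; exact: root0.
Qed.

Lemma delta_sum (I : Type) (r : seq I) (c : I -> R) (F : I -> {poly R}) x y : Omega x -> Omega y ->
  (forall i, root (F i) beta) ->
  delta (\sum_(i <- r) c i *: F i) x y = \sum_(i <- r) c i * delta (F i) x y.
Proof.
move=> Ox Oy h; elim: r => [|i r IH]; first by rewrite !big_nil delta0.
have hr : root (\sum_(j <- r) c j *: F j) beta.
  by rewrite /root horner_sum big1 // => j _; rewrite hornerZ (eqP (h j)) mulr0.
rewrite !big_cons -IH; apply: delta_lin => //; apply: root_bounded => //.
by rewrite /root hornerD hornerZ (eqP (h i)) (eqP hr) mulr0 addr0.
Qed.

Lemma delta_substn p m x y : root p beta -> Omega x -> Omega y ->
  delta p (iter m T x) (iter m T y) = delta ('X^m * p) x y.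
Proof.
move=> rp; elim: m x y => [|m IH] x y Ox Oy; first by rewrite expr0 mul1r.
rewrite !iterSr IH; [|exact: Omega_subst|exact: Omega_subst].
rewrite delta_subst //; last 2 first.
- by apply: root_bounded; rewrite rootM rp orbT.
- by apply: root_bounded; rewrite !rootM rp orbT.
by congr (delta _ _ _); rewrite exprSr; ring.
Qed.

(** When [S^j sigma^m x] and [S^j' sigma^m y] have the same potentials, these
    equations hold for the differences [z i] of the lengths of the [i]-th iterates
    of the prefixes that the shifts cut off. *)
Definition level m x y (z : nat -> int) := forall i, (i <= d.+1)%N ->
  (z i)%:~R - beta ^+ i * (z 0%N)%:~R = delta ('X^m * D i) x y.

(** The inverse of the companion matrix of [P], integral because the constant
    coefficient of [P] is its own inverse. *)
Definition backward (z : nat -> int) : nat -> int := fun i =>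
  if i is i'.+1 then z i' else - P`_0 * \sum_(j < d.+2) P`_j.+1 * z j.

(** The relations [cobounding (P * 'X^k)] and [P.[beta] = 0] say that the vector of
    the [delta ('X^m * D i)] evolves by the companion matrix of [P] modulo the
    line of its eigenvector for [beta]; the integer vector [z] lifts it and has
    to follow the same recurrence. *)
Lemma level_backward m x y z : Omega x -> Omega y -> x 0 = y 0 -> (k <= m)%N ->
  level m.+1 x y z -> level m x y (backward z).
Proof.
move=> Ox Oy xy km lz.
have b0 : beta != 0 by rewrite gt_eqF // (lt_trans ltr01).
have D1 i : delta ('X^m * D i.+1) x y = beta ^+ i * delta ('X^m * D 1%N) x y + delta ('X^(m.+1) * D i) x y.
  rewrite -delta_lin //; try exact: DX_bounded; last first.
    by apply: root_bounded; rewrite /root !(hornerE, hornerXn) /=; apply/eqP; ring.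
  by congr (delta _ _ _); rewrite -mul_polyC !exprS !rmorphM /= expr0 mulr1; ring.
set w := backward z 0%N.
have sumP : \sum_(j < d.+2) (P`_j.+1)%:~R * beta ^+ j = - (P`_0)%:~R / beta :> R.
  have := rP; rewrite /root horner_coef size_map_poly_id0 ?rmorph_eq0; last first.
    by rewrite intr_eq0 lead_coef_eq0 monic_neq0.
  rewrite sP big_ord_recl coef_map /= expr0 mulr1 => /eqP /(canRL (addKr _)); rewrite addr0.
  move=> e; rewrite -[in RHS]e mulr_suml; apply: eq_bigr => j _.
  by rewrite coef_map /= /bump leq0n add1n exprSr; field.
have e1 : \sum_(j < d.+2) (P`_j.+1)%:~R * (z j)%:~R = - (P`_0)%:~R * w%:~R :> R.
  rewrite /w /backward -intrN -intrM mulrA mulNr mulrN opprK P0 mul1r rmorph_sum.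
  by apply: eq_bigr => j _; rewrite rmorphM.
have e2 : \sum_(j < d.+2) (P`_j.+1)%:~R * delta ('X^m * D j.+1) x y = 0.
  rewrite -(delta_sum (index_enum _)) //; last first.
    by move=> i; rewrite rootM D_root orbT.
  have -> : \sum_(j < d.+2) (P`_j.+1)%:~R *: ('X^m * D j.+1) = 'X^m * map_poly intr P :> {poly R}.
    have h : map_poly intr P = \sum_(j < d.+3) (P`_j)%:~R *: 'X^j :> {poly R}.
      by rewrite -[LHS]coefK poly_def size_map_poly_id0 ?intr_eq0 ?lead_coef_eq0 ?monic_neq0 // sP;
        apply: eq_bigr => j _; rewrite coef_map.
    have h2 : \sum_(j < d.+3) (P`_j)%:~R *: (beta ^+ j)%:P = 0 :> {poly R}.
      have := rP; rewrite /root horner_coef size_map_poly_id0 ?intr_eq0 ?lead_coef_eq0 ?monic_neq0 //.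
      rewrite sP => /eqP; move/(congr1 polyC) => e; rewrite polyC0 in e; rewrite -[RHS]e rmorph_sum.
      by apply: eq_bigr => j _; rewrite coef_map /= rmorphM /= mul_polyC.
      (* subtracting [P.[beta] = 0] makes every term a multiple of some [D j] *)
  transitivity ('X^m * (\sum_(j < d.+3) (P`_j)%:~R *: 'X^j - \sum_(j < d.+3) (P`_j)%:~R *: (beta ^+ j)%:P)).
      rewrite -sumrB [in RHS]big_ord_recl -scalerBr [nat_of_ord ord0]/= !expr0 polyC1 subrr scaler0 add0r mulr_sumr; apply: eq_bigr => j _.
      by rewrite -scalerBr -scalerAr.
    by rewrite h2 subr0 -h.
  apply: delta_cobounding => // v lv.
  have -> : 'X^m * map_poly intr P = map_poly intr (P * 'X^k * 'X^(m - k)) :> {poly R}.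
    by rewrite -mulrA -exprD subnKC // rmorphM /= map_polyXn mulrC.
  by rewrite -pairing_map (cobounding_mul _ cP) // rmorph0.
have ez j : (j <= d.+1)%N -> (z j)%:~R = beta ^+ j * (z 0%N)%:~R + delta ('X^(m.+1) * D j) x y.
  by move=> /lz <-; ring.
have key : (z 0%N)%:~R - beta * w%:~R = delta ('X^m * D 1%N) x y.
  have e3 : \sum_(j < d.+2) (P`_j.+1)%:~R * beta ^+ j * (delta ('X^m * D 1%N) x y - (z 0%N)%:~R) = (P`_0)%:~R * w%:~R :> R.
    transitivity (\sum_(j < d.+2) (P`_j.+1)%:~R * delta ('X^m * D j.+1) x y - \sum_(j < d.+2) (P`_j.+1)%:~R * (z j)%:~R); last first.
      by rewrite e1 e2; ring.
    rewrite -sumrB; apply: eq_bigr => j _.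
    by rewrite (D1 j) (ez j (ltn_ord j)); ring.
  rewrite -mulr_suml sumP in e3.
  have p0 : (P`_0)%:~R != 0 :> R by rewrite intr_eq0; apply: contra_eq_neq P0 => ->; rewrite mul0r eq_sym oner_eq0.
  move: e3 => /(congr1 (fun t => t * beta / (P`_0)%:~R)) e3.
  have := e3; rewrite (_ : - _ / beta * _ * beta / _ = (z 0%N)%:~R - delta ('X^m * D 1%N) x y); last by field; rewrite b0 p0.
  rewrite (_ : _ * w%:~R * beta / _ = beta * w%:~R); last by field; rewrite p0.
  by move=> <-; ring.
case=> [|i] id; first by rewrite expr0 mul1r subrr expr0 subrr mulr0 delta0.
rewrite -[backward z i.+1]/(z i) -/w D1 -key (ez i); last exact: ltnW.
by move: (delta ('X^(m.+1) * D i) x y) (w%:~R : R) => e w'; rewrite exprS; ring.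
Qed.

Lemma backward_inj n z z' :
  (forall i, (i <= d.+1)%N -> iter n backward z i = iter n backward z' i) ->
  forall i, (i <= d.+1)%N -> z i = z' i.
Proof.
elim: n => // n IH h; apply: IH => i id.
set u := iter n backward z in h *; set v := iter n backward z' in h *.
have lt j : (j <= d)%N -> u j = v j by move=> jd; have := h j.+1 jd.
move: id; rewrite leq_eqVlt => /orP[/eqP ->|]; last by rewrite ltnS; exact: lt.
have e0 : - P`_0 * (\sum_(j < d.+2) P`_j.+1 * u j) = - P`_0 * (\sum_(j < d.+2) P`_j.+1 * v j).
  exact: (h 0%N isT).
have e1 : \sum_(j < d.+2) P`_j.+1 * u j = \sum_(j < d.+2) P`_j.+1 * v j.
  by have := congr1 (fun t => - P`_0 * t) e0; rewrite /= !mulrA mulrNN P0 !mul1r.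
have P1 : P`_d.+2 = 1 by move: mP; rewrite monicE lead_coefE sP => /eqP.
rewrite big_ord_recr [in RHS]big_ord_recr /= P1 !mul1r in e1; move: e1.
suff -> : \sum_(j < d.+1) P`_j.+1 * u j = \sum_(j < d.+1) P`_j.+1 * v j by move=> /addrI.
by apply: eq_bigr => j _; rewrite lt // -ltnS.
Qed.

Lemma level_backwardn n x y z : Omega x -> Omega y -> x 0 = y 0 ->
  level (k + n) x y z -> level k x y (iter n backward z).
Proof.
move=> Ox Oy xy; elim: n z => [|n IH] z; first by rewrite addn0.
by rewrite addnS iterSr => h; apply: IH; apply: level_backward => //; rewrite leq_addr.
Qed.

(** By boundedness of ['X - beta] on the language, an additive constant turns the
    lengths of the iterates into a sequence that grows at most by a factor [beta]. *)
Lemma size_siter_bound : exists2 K : R, 0 <= K &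
  forall n a, (size (siter n [:: a]))%:R <= K * beta ^+ n.
Proof.
have [C hC] := bbeta.
have [w0 [lw0 _]] := unbounded 0.
have C0 : 0 <= C by apply: le_trans (hC w0 lw0).
have b1 : 0 < beta - 1 by rewrite subr_gt0.
exists (1 + C / (beta - 1)); first by rewrite addr_ge0 // divr_ge0 // ltW.
move=> n a; suff : (size (siter n [:: a]))%:R + C / (beta - 1) <= (1 + C / (beta - 1)) * beta ^+ n.
  by apply: le_trans; rewrite lerDl divr_ge0 // ltW.
elim: n => [|n IH]; first by rewrite expr0 mulr1.
have := hC _ (lang_siter n (lang1 sigma a)).
rewrite -['X]expr1 pairing_XnC -siterD.
move=> h1; have := ler_norm ((size (siter (1 + n) [:: a]))%:R - beta * (size (siter n [:: a]))%:R).
rewrite exprS add1n.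
set s1 : R := (size (siter n.+1 _))%:R; set s0 : R := (size (siter n _))%:R in IH *.
have : beta * (s0 + C / (beta - 1)) <= beta * ((1 + C / (beta - 1)) * beta ^+ n).
  by rewrite ler_pM2l // (lt_trans ltr01).
have e1 : beta * (C / (beta - 1)) = C / (beta - 1) + C by field; rewrite gt_eqF.
by move: h1; rewrite add1n -/s1 -/s0 mulrDr e1 [beta * (_ * _)]mulrCA; lra.
Qed.

(** Uniformity in [m] comes from [delta_substn]: all these values are differences
    of the same potentials at other points. *)
Lemma delta_bounded : exists2 C : R, 0 <= C & forall m i x y, (i <= d.+1)%N ->
  Omega x -> Omega y -> `|delta ('X^m * D i) x y| <= C.
Proof.
have h i : exists C : R, 0 <= C /\ forall x, Omega x -> `|potential sigma (D i) x| <= C.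
  by have [|C C0 hC] := @potential_bounded A sigma R unbounded (D i); [apply: root_bounded; exact: D_root|exists C].
have [F hF] := choice h.
(* a sum, as a bound that serves all [i] at once *)
exists (\sum_(i < d.+2) (F i + F i)); first by apply: sumr_ge0 => i _; rewrite addr_ge0 // (hF _).1.
move=> m i x y id Ox Oy; rewrite -delta_substn //; last exact: D_root.
apply: (@le_trans _ _ (F i + F i)).
  apply: le_trans (ler_normB _ _) _; apply: lerD; apply: (hF i).2; exact: Omega_substn.
have id2 : (i < d.+2)%N by [].
rewrite (bigD1 (Ordinal id2)) //= lerDl; apply: sumr_ge0 => j _; rewrite addr_ge0 // (hF _).1 //.
Qed.

(** One step back divides [z 0] by [beta] up to a bounded error, and the other
    coordinates are determined by [z 0] up to a bounded error. *)
Lemma level_bounded K : 0 <= K -> exists B : nat, forall n x y z,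
  Omega x -> Omega y -> x 0 = y 0 -> level (k + n) x y z ->
  `|(z 0%N)%:~R| <= K * beta ^+ (k + n) ->
  forall i, (i <= d.+1)%N -> (absz (iter n backward z i) <= B)%N.
Proof.
move=> K0; have [C C0 hC] := delta_bounded.
have b1 : 0 < beta - 1 by rewrite subr_gt0.
have b0 : 0 < beta by exact: lt_trans beta1.
pose E := C / (beta - 1); have E0 : 0 <= E by rewrite divr_ge0 // ltW.
have eE : E + C = beta * E by rewrite /E; field; rewrite gt_eqF.
pose M := beta ^+ d.+1 * (K * beta ^+ k + E) + C.
exists (Num.truncn M).+1 => n x y z Ox Oy xy lz hz i id.
have key : `|(iter n backward z 0%N)%:~R| <= K * beta ^+ k + E.
  have {}hz : `|(z 0%N)%:~R| <= K * beta ^+ (k + n) + E by apply: le_trans hz _; rewrite lerDl.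
  elim: n z lz hz => [|n IH] z lz hz; first by rewrite addn0 in hz.
  rewrite addnS in lz hz; rewrite iterSr; have lz' := level_backward Ox Oy xy (leq_addr _ _) lz.
  apply: IH => //; rewrite -(ler_pM2l b0) mulrDr -eE mulrCA -exprS addrA.
  have := lz' 1%N isT; rewrite [backward z 1%N]/= expr1 => e1.
  have := hC (k + n)%N 1%N x y isT Ox Oy; rewrite -e1 => e2.
  have -> : beta * `|(backward z 0%N)%:~R| = `|(z 0%N)%:~R - ((z 0%N)%:~R - beta * (backward z 0%N)%:~R)|.
    by rewrite opprB addrCA subrr addr0 normrM gtr0_norm.
  by apply: le_trans (ler_normB _ _) _; apply: lerD.
have lw := level_backwardn Ox Oy xy lz; set w := iter n backward z in key lw *.
have M0 : 0 <= M.
  by rewrite /M; do ?[apply: addr_ge0 => //|apply: mulr_ge0 => //|apply: exprn_ge0; exact: ltW].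
suff h : `|(w i)%:~R| <= M.
  have /andP[_ lt] := truncn_itv M0.
  apply: ltnW; rewrite ltnS -ltnS -(ltr_nat R); apply: le_lt_trans lt.
  by move: h; rewrite -intr_norm -abszE.
have -> : (w i)%:~R = beta ^+ i * (w 0%N)%:~R + ((w i)%:~R - beta ^+ i * (w 0%N)%:~R) by ring.
apply: le_trans (ler_normD _ _) _; apply: lerD; last by rewrite lw //; exact: hC.
rewrite normrM ger0_norm ?exprn_ge0 ?(ltW b0) // ler_pM ?exprn_ge0 ?(ltW b0) //.
by rewrite ler_weXn2l // ltW.
Qed.

Lemma delta_shiftn_D m i x y : Omega x -> Omega y ->
  delta (D i) (iter m S x) (iter m S y) = delta (D i) x y +
   (Posz (size (siter i (window x 0 m))) - Posz (size (siter i (window y 0 m))))%:~R.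
Proof.
move=> Ox Oy; have bD : bounded_on_lang sigma (D i) by apply: root_bounded; exact: D_root.
rewrite !deltaE !potential_shiftn // /birkhoff !pairing_XnC !size_window rmorphB /=; ring.
Qed.

Lemma window_iter_subst n j N x : (j < size (siter n [:: x 0]))%N -> (N <= size (siter n [:: x 1]))%N ->
  window (iter n T x) (Posz j) N = take N (drop j (siter n [:: x 0; x 1])).
Proof.
move=> jx Nx.
have e : [:: x 0; x 1] = window x 0 2 by rewrite /window /= addr0.
have sz : size (siter n [:: x 0; x 1]) = (size (siter n [:: x 0]) + size (siter n [:: x 1]))%N.
  by rewrite -size_cat -siter_cat.
have h := window_siter sigma n x 2; rewrite -e in h; rewrite -h.
set L := size (siter n [:: x 0; x 1]) in sz *.
have -> : L = (j + (N + (L - (j + N))))%N by lia.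
by rewrite windowD windowD add0r drop_size_cat ?size_window // take_size_cat ?size_window.
Qed.

(** Every point of the fibre is written [S^j sigma^n u] with [j < |sigma^n(u_0)|].
    Among many points of a fibre, the pigeonhole principle selects points for
    which [u_0], [u_1] and the integers [delta (D i)] agree.  For these the
    differences of lengths form integer vectors at level [n] that [backward]
    brings injectively into a box that does not depend on [n].  Hence the number
    of values of [j] is bounded independently of [n], whereas [j], [u_0] and
    [u_1] determine the point on a window whose size grows with [n]. *)
Lemma no_infinite_fibre : ~ exists x : nat -> biseq A, [/\ injective x, forall n, Omega (x n) &
  forall n m i, (i <= d.+1)%N -> exists z : int, delta (D i) (x n) (x m) = z%:~R].
Proof.
move=> [x [ix Ox zx]].
have [C C0 hC] := delta_bounded; have [K K0 hK] := size_siter_bound.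
have [B hB] := level_bounded K0.
pose CB := (Num.truncn C).+1.
pose box1 : finType := (A * A * {ffun 'I_d.+2 -> 'I_(CB + CB).+1})%type.
pose box2 : finType := {ffun 'I_d.+2 -> 'I_(B + B).+1}.
pose M := (#|box1| * #|box2|).+1.
have [m [N sepN]] := biseq_separate M ix.
have ex_y i : exists y : biseq A, Omega y /\ iter m S y = x i.
  by have [y] := Omega_unshiftn prim unbounded m (Ox i); exists y.
have [y hy] := choice ex_y.
have Oy i : Omega (y i) by have [] := hy i.
have ey i : iter m S (y i) = x i by have [] := hy i.
have zy n l i : (i <= d.+1)%N -> exists z : int, delta (D i) (y n) (y l) = z%:~R.
  move=> id; have [z] := zx n l i id; rewrite -(ey n) -(ey l) delta_shiftn_D //.
  by set s := (Posz _ - Posz _)%R => ez; exists (z - s); rewrite rmorphB /= -ez addrK.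
have sep i j : (i < M)%N -> (j < M)%N -> window (y i) 0 N = window (y j) 0 N -> i = j.
  move=> iM jM e; apply: sepN => //; move: e; rewrite -!ey !window_shift.
  by rewrite addNr.
have [n0 hn0] := long_siter prim unbounded N.
pose n := (k + n0)%N.
have hn a : (N <= size (siter n [:: a]))%N by apply: hn0; rewrite leq_addl.
have [u hu0] := choice (fun i => Omega_desubstn prim unbounded n (Oy i)).
have [j hu] := choice hu0.
have ex_z (il : nat * 'I_d.+2) : exists z : int, delta (D il.2) (y il.1) (y 0%N) = z%:~R.
  exact: zy (ltn_ord il.2).
have [zz' hzz'] := choice ex_z; pose zz i l := zz' (i, l).
have hzz i (l : 'I_d.+2) : delta (D l) (y i) (y 0%N) = (zz i l)%:~R by exact: (hzz' (i, l)).
have zzC i l : (absz (zz i l) <= CB)%N.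
  have := hC 0%N l (y i) (y 0%N) (ltn_ord l) (Oy i) (Oy 0%N); rewrite expr0 mul1r hzz => h.
  have /andP[_ lt] := truncn_itv C0; rewrite -ltnS -(ltr_nat R).
  by apply: le_lt_trans (lt_trans lt _); [rewrite -intr_norm -abszE in h; exact: h | rewrite ltr_nat].
pose f (i : 'I_M) : box1 := (u i 0, u i 1, [ffun l => inord (absz (zz i l + Posz CB))]).
have [t ht] : exists t, (#|box2| < #|[pred i | f i == t]|)%N.
  by apply: pigeonhole; rewrite card_ord.
set G := [pred i | f i == t] in ht.
have /card_gt0P[r rG] : (0 < #|G|)%N by exact: leq_ltn_trans ht.
have feq i : i \in G -> [/\ u i 0 = u r 0, u i 1 = u r 1 & forall l, (l <= d.+1)%N -> delta (D l) (y r) (y i) = 0].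
  move: rG; rewrite !inE => /eqP <- /eqP[-> -> /ffunP h]; split => // l ld.
  have lt : (l < d.+2)%N by [].
  have := h (Ordinal lt); rewrite !ffunE => /(congr1 (@nat_of_ord _)); rewrite !inordK.
  - move=> e; have ez : zz i (Ordinal lt) = zz r (Ordinal lt) by have := zzC i (Ordinal lt); have := zzC r (Ordinal lt); move: e => /=; lia.
    have := hzz i (Ordinal lt); have := hzz r (Ordinal lt); rewrite ez /= => <-.
    by rewrite !deltaE; lra.
  - by have := zzC r (Ordinal lt); lia.
  - by have := zzC i (Ordinal lt); lia.
pose z i l : int := Posz (size (siter l (window (iter n T (u i)) 0 (j i)))) - Posz (size (siter l (window (iter n T (u r)) 0 (j r)))).
have lz i : i \in G -> level n (u r) (u i) (z i).
  move=> iG l ld; have [Oi ji yi] := hu i; have [Or jr yr] := hu r.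
  have [_ _ /(_ l ld)] := feq i iG; rewrite -delta_substn //; last exact: D_root.
  have bD : bounded_on_lang sigma (D l) by apply: root_bounded; exact: D_root.
  rewrite yi yr !deltaE !potential_shiftn //; try exact: Omega_substn.
  by rewrite /birkhoff !pairing_XnC !size_window /z !size_window !rmorphB /= => e; lra.
have z0 i : z i 0%N = Posz (j i) - Posz (j r) by rewrite /z !size_window.
have zb i : i \in G -> `|(z i 0%N)%:~R| <= K * beta ^+ n.
  move=> iG; have [Oi ji yi] := hu i; have [Or jr yr] := hu r; have [e0 _ _] := feq i iG.
  rewrite e0 in ji; apply: le_trans (hK n (u r 0)).
  rewrite z0 -intr_norm -abszE -pmulrn ler_nat; move: ji jr; clear; set L := size _.
  by move=> ji jr; move: (j i) (j r) L ji jr; clear; lia.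
have wB (i : 'I_M) l : i \in G -> (l <= d.+1)%N -> (absz (iter n0 backward (z i) l) <= B)%N.
  move=> iG ld; have [Oi _ _] := hu i; have [Or _ _] := hu r; have [e0 _ _] := feq i iG.
  by apply: (hB n0 (u r) (u i) (z i)) => //; [exact: lz | exact: zb].
pose g (i : 'I_M) : box2 := [ffun l : 'I_d.+2 => inord (absz (iter n0 backward (z i) l + Posz B))].
have ig : {in G &, injective g}.
  move=> i i' iG iG' /ffunP h.
  have ez : z i 0%N = z i' 0%N.
    apply: (backward_inj (n := n0)) => // l ld; have lt : (l < d.+2)%N by [].
    have := h (Ordinal lt); rewrite !ffunE => /(congr1 (@nat_of_ord _)).
    have b1 := wB i l iG ld; have b2 := wB i' l iG' ld.
    by rewrite !inordK /=; lia.
  have ej : j i = j i' by move: ez; rewrite !z0; lia.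
  apply: ord_inj; apply: sep => //.
  have [Oi ji yi] := hu i; have [Oi' ji' yi'] := hu i'.
  have [e0 e1 _] := feq i iG; have [e0' e1' _] := feq i' iG'.
  rewrite yi yi' !window_shift !add0r !window_iter_subst // ?hn //.
  by rewrite e0 e1 e0' e1' ej.
by move: ht; rewrite -(card_in_imset ig) ltnNge max_card.
Qed.

End Fibres.

End FibreTheory.

(** * Linear recurrences *)

Section LinearRecurrences.
Local Open Scope ring_scope.
Local Open Scope complex_scope.
Variable R : realType.
Notation C := (Cplx R).
Implicit Types (u v : nat -> C) (p q : {poly C}).

Definition vanishing u := forall e : R, 0 < e -> exists N, forall n, (N <= n)%N -> `|u n| <= e%:C.

Lemma norm_real (z : C) : exists2 r : R, 0 <= r & `|z| = r%:C.
Proof. by eexists; last exact: normc_def; exact: sqrtr_ge0. Qed.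

Lemma vanishingD u v : vanishing u -> vanishing v -> vanishing (fun n => u n + v n).
Proof.
move=> hu hv e e0; have e2 : 0 < e / 2 by lra.
have [N hN] := hu _ e2; have [M hM] := hv _ e2.
exists (maxn N M) => n; rewrite geq_max => /andP[n1 n2].
rewrite (splitr e) rmorphD; apply: le_trans (ler_normD _ _) _.
by apply: lerD; [exact: hN|exact: hM].
Qed.

Lemma vanishingZ c u : vanishing u -> vanishing (fun n => c * u n).
Proof.
move=> hu e e0; have [r r0 er] := norm_real c; pose b := r + 1.
have nc : `|c| <= b%:C by rewrite er lecR /b; lra.
have b0 : 0 < b by rewrite /b; lra.
have [N hN] := hu (e / b) (divr_gt0 e0 b0).
exists N => n nN; rewrite normrM.
have -> : e%:C = b%:C * (e / b)%:C by rewrite -rmorphM /= mulrC divfK ?gt_eqF.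
by apply: ler_pM => //; exact: hN.
Qed.

Lemma vanishing_shift k u : vanishing u -> vanishing (fun n => u (n + k)%N).
Proof. by move=> hu e /hu[N hN]; exists N => n nN; apply: hN; exact: leq_trans nN (leq_addr _ _). Qed.

Lemma vanishing_eq u v : u =1 v -> vanishing u -> vanishing v.
Proof. by move=> uv hu e /hu[N hN]; exists N => n nN; rewrite -uv; exact: hN. Qed.

Lemma vanishing_contract u g : `|g| < 1 ->
  vanishing (fun n => u n.+1 - g * u n) -> vanishing u.
Proof.
move=> g1 hv e e0; have [r r0 er] := norm_real g.
have r1 : r < 1 by rewrite -ltcR -er.
have e2 : 0 < (1 - r) * (e / 2) by rewrite mulr_gt0 //; lra.
have [N hN] := hv _ e2.
have [b b0 hb] : exists2 b : R, 0 <= b & `|u N| <= b%:C.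
  by have [b b0 eb] := norm_real (u N); exists b => //; rewrite eb.
have step m : `|u (N + m)%N| <= (r ^+ m * b + e / 2)%:C.
  elim: m => [|m IH].
    by rewrite addn0 expr0 mul1r; apply: le_trans hb _; rewrite lecR; lra.
  rewrite addnS -[u _](subrK (g * u (N + m)%N)).
  apply: le_trans (ler_normD _ _) _.
  apply: (@le_trans _ _ (((1 - r) * (e / 2))%:C + r%:C * (r ^+ m * b + e / 2)%:C)).
    apply: lerD; first by apply: hN; rewrite leq_addr.
    by rewrite normrM er; apply: ler_wpM2l => //; rewrite ler0c.
  by rewrite -rmorphM -rmorphD lecR exprS; nra.
have [M hM] : exists M, forall m, (M <= m)%N -> r ^+ m * b <= e / 2.
  have ar : `|r| < 1 by rewrite ger0_norm.
  have e3 : 0 < e / 2 / (b + 1) by rewrite divr_gt0 //; lra.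
  have [M _ hM] := (cvgr0Pnorm_le _).1 (cvg_expr ar) _ e3.
  exists M => m mM; have := hM m mM; rewrite /= ger0_norm ?exprn_ge0 // => h.
  apply: (@le_trans _ _ (r ^+ m * (b + 1))); first by rewrite ler_wpM2l ?exprn_ge0 // lerDl.
  by rewrite -ler_pdivlMr //; lra.
exists (N + M)%N => n nNM; have -> : n = (N + (n - N))%N by lia.
apply: le_trans (step _) _; rewrite lecR.
by have := hM (n - N)%N; rewrite leq_subRL; [move=> /(_ nNM); lra | lia].
Qed.

Definition shift_action p u n := \sum_(i < size p) p`_i * u (n + i)%N.

Lemma shift_actionE m p u n : (size p <= m)%N ->
  shift_action p u n = \sum_(i < m) p`_i * u (n + i)%N.
Proof.
move=> le; apply: (sum_widen (F := fun i => p`_i * u (n + i)%N) le) => i h.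
by rewrite nth_default ?mul0r.
Qed.

Lemma shift_action_mulXsubC p g u n :
  shift_action (p * ('X - g%:P)) u n = shift_action p u n.+1 - g * shift_action p u n.
Proof.
have s1 : (size (p * ('X - g%:P))%R <= (size p).+1)%N.
  by apply: leq_trans (size_polyMleq _ _) _; rewrite size_XsubC addn2.
rewrite (shift_actionE _ _ s1) mulrBr.
under eq_bigr => i _ do rewrite coefB coefMX coefMC mulrBl.
rewrite sumrB; congr (_ - _).
  rewrite big_ord_recl eqxx mul0r add0r; apply: eq_bigr => i _.
  by rewrite lift0 /= addSnnS.
rewrite big_ord_recr /= nth_default // mul0r mul0r addr0 mulr_sumr.
by apply: eq_bigr => i _; rewrite mulrA [_ * g]mulrC.
Qed.

(** A sequence with [u_(n+1) - g u_n] tending to zero and [|g| < 1] tends to zero;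
    this applies to one root after the other. *)
Lemma vanishing_peel p (gs : seq C) u : all (fun g => `|g| < 1) gs ->
  vanishing (shift_action (p * \prod_(g <- gs) ('X - g%:P)) u) -> vanishing (shift_action p u).
Proof.
elim: gs p => [|g gs IH] p /=; first by rewrite big_nil mulr1.
move=> /andP[g1 h]; rewrite big_cons mulrA => /(IH _ h) hv.
apply: (vanishing_contract g1); apply: vanishing_eq hv => n.
exact: shift_action_mulXsubC.
Qed.

End LinearRecurrences.

(** * Density of the orbits of the translation *)

Section Companion.
Local Open Scope ring_scope.
Local Open Scope complex_scope.
Variables (d : nat) (P : {poly int}).

(** The companion matrix of [P], acting on the entries at the indices up to
    [d.+1]. *)
Definition forward (K : comNzRingType) (s : nat -> K) : nat -> K := fun i =>
  if (i < d.+1)%N then s i.+1 else - \sum_(j < d.+2) (P`_j)%:~R * s j.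

Lemma forward_iter (K : comNzRingType) n (s : nat -> K) i : (i <= d.+1)%N ->
  iter n (@forward K) s i = iter (n + i) (@forward K) s 0%N.
Proof.
elim: i n => [|i IH] n id; first by rewrite addn0.
by rewrite addnS -addSn -IH 1?ltnW // iterS {2}/forward id.
Qed.

Lemma forward_ext (K : comNzRingType) n (s t : nat -> K) :
  (forall i, (i <= d.+1)%N -> s i = t i) ->
  forall i, (i <= d.+1)%N -> iter n (@forward K) s i = iter n (@forward K) t i.
Proof.
move=> h; elim: n => // n IH i id; rewrite !iterS /forward; case: ltnP => id2; first exact: IH.
by congr (- _); apply: eq_bigr => j _; rewrite IH // -ltnS.
Qed.

Lemma forward_sum (K : comNzRingType) m n (c : 'I_m -> K) (e : 'I_m -> nat -> K) i :
  iter n (@forward K) (fun i => \sum_j c j * e j i) i = \sum_j c j * iter n (@forward K) (e j) i.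
Proof.
elim: n i => // n IH i; rewrite iterS {1}/forward; case: ifP => id.
  by rewrite IH; apply: eq_bigr => j _; rewrite iterS /forward id.
rewrite (eq_bigr (fun j => c j * - \sum_(l < d.+2) (P`_l)%:~R * iter n (@forward K) (e j) l)).
  rewrite -sumrN; under [LHS]eq_bigr => l _ do rewrite IH mulr_sumr -sumrN.
  rewrite exchange_big; apply: eq_bigr => j _; rewrite mulrN mulr_sumr -sumrN.
  by apply: eq_bigr => l _; rewrite mulrCA.
by move=> j _; rewrite iterS /forward id.
Qed.

Lemma forward_add (K : comNzRingType) n (s t : nat -> K) i :
  iter n (@forward K) (fun i => s i + t i) i = iter n (@forward K) s i + iter n (@forward K) t i.
Proof.
elim: n i => // n IH i; rewrite !iterS /forward; case: ifP => _; first exact: IH.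
by rewrite -opprD -big_split /=; congr (- _); apply: eq_bigr => j _; rewrite IH mulrDr.
Qed.

Lemma forward_intr (K : comNzRingType) n (z : nat -> int) i :
  (iter n (@forward int) z i)%:~R = iter n (@forward K) (fun i => (z i)%:~R) i.
Proof.
elim: n i => // n IH i; rewrite !iterS /forward; case: ifP => _ //.
rewrite rmorphN rmorph_sum /=; congr (- _); apply: eq_bigr => j _.
by rewrite rmorphM /= IH intz.
Qed.

Hypothesis sP : size P = d.+3.
Hypothesis mP : P \is monic.

Lemma forward_rec (K : comNzRingType) n (s : nat -> K) :
  \sum_(j < d.+3) (P`_j)%:~R * iter (n + j) (@forward K) s 0%N = 0.
Proof.
have P1 : P`_d.+2 = 1 by move: mP; rewrite monicE lead_coefE sP => /eqP.
rewrite big_ord_recr /= P1 mul1r addnS -addSn -forward_iter // iterS {2}/forward ltnn.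
apply/eqP; rewrite subr_eq0; apply/eqP; apply: eq_bigr => j _.
by rewrite [X in _ = _ * X]forward_iter // -ltnS.
Qed.

Hypothesis P0 : P`_0 * P`_0 = 1.

Lemma forward_surj (K : comNzRingType) n (s : nat -> K) :
  exists t, forall i, (i <= d.+1)%N -> iter n (@forward K) t i = s i.
Proof.
elim: n s => [|n IH] s; first by exists s.
pose c j : K := (P`_j)%:~R.
pose t0 i := if i is i'.+1 then s i' else - c 0%N * (s d.+1 + \sum_(j < d.+1) c j.+1 * s j).
have [t ht] := IH t0; exists t => i id; rewrite iterS.
have -> : forward (iter n (@forward K) t) i = forward t0 i.
  exact: (forward_ext 1 ht).
rewrite /forward; case: ltnP => id2; first by [].
have -> : i = d.+1 by apply/eqP; rewrite eqn_leq id id2.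
rewrite big_ord_recl; under eq_bigr => j _ do rewrite lift0.
rewrite [t0 ord0]/= mulrA mulrN -/(c 0%N) -intrM P0 mulN1r.
rewrite opprD opprK /t0 -/(\sum_(j < d.+1) c j.+1 * s j) addrK //.
Qed.

Variables (R : realType) (beta : R) (gs : seq (Cplx R)).
Hypothesis fP : map_poly intr P = ('X - (beta%:C : Cplx R)%:P) * \prod_(g <- gs) ('X - g%:P).
Hypothesis gs1 : all (fun g => `|g| < 1) gs.

(** The coordinates are consecutive terms of a linear recurrence; once [beta] is
    removed all characteristic roots lie in the open unit disk. *)
Lemma forward_contract (s : nat -> R) i e : (i <= d.+1)%N -> 0 < e -> exists N, forall n, (N <= n)%N ->
  `|iter n (@forward R) s i - beta ^+ i * iter n (@forward R) s 0%N| <= e.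
Proof.
pose u n : Cplx R := (iter n (@forward R) s 0%N)%:C.
have h1 : vanishing (fun n => u n.+1 - beta%:C * u n).
  have : vanishing (shift_action ('X - (beta%:C : Cplx R)%:P) u).
    apply: (vanishing_peel gs1); rewrite -fP => e' e0; exists 0%N => n _.
    rewrite (shift_actionE (m := d.+3)); last by rewrite -sP size_poly.
    rewrite (_ : \sum_(_ < _) _ = 0) ?normr0 ?ler0c ?ltW //.
    have := congr1 (fun x => x%:C : Cplx R) (forward_rec n s).
    rewrite rmorph_sum => e1; rewrite -[RHS]/(0%:C : Cplx R) -e1; apply: eq_bigr => j _.
    by rewrite coef_map rmorphM /= /u rmorph_int.
  apply: vanishing_eq => n.
  rewrite /shift_action size_XsubC !big_ord_recl big_ord0 /= !coefB !coefX !coefC /= addn0 addr0 addn1.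
  by rewrite sub0r subr0 mul1r mulNr addrC.
have h2 : vanishing (fun n => u (n + i)%N - beta%:C ^+ i * u n).
  elim: i => [|i IH].
    by move=> e' e0; exists 0%N => n _; rewrite addn0 expr0 mul1r subrr normr0 ler0c ltW.
  apply: vanishing_eq (vanishingD (vanishing_shift i h1) (vanishingZ beta%:C IH)) => n.
  by rewrite addnS exprS; ring.
move=> id e0; have [N hN] := h2 e e0; exists N => n /hN.
rewrite /u (forward_iter _ _ id) -!rmorphXn -!rmorphM -rmorphB.
have -> (x : R) : `|(x%:C : Cplx R)| = `|x|%:C.
  by rewrite normc_def /= expr0n addr0 sqrtr_sqr.
by rewrite lecR.
Qed.

(** Real vectors are pulled back by a power of the companion matrix, rounded to
    integers, and pushed forward.  The rounding error is bounded before the push,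
    which brings it close to the eigenline of [beta], where all the quantities
    [z_i - beta^i z_0] vanish. *)
Lemma companion_dense (y : nat -> R) e : 0 < e -> exists z : nat -> int,
  forall i, (0 < i <= d.+1)%N -> `|y i - ((z i)%:~R - beta ^+ i * (z 0%N)%:~R)| < e.
Proof.
move=> e0; pose E (j : 'I_d.+2) i : R := (i == j :> nat)%:R.
have e1 : 0 < e / 2 / d.+2%:R by rewrite !divr_gt0.
have [n hn] : exists n, forall i j : 'I_d.+2,
    `|iter n (@forward R) (E j) i - beta ^+ i * iter n (@forward R) (E j) 0%N| <= e / 2 / d.+2%:R.
  have H (ij : 'I_d.+2 * 'I_d.+2) : exists N, forall n, (N <= n)%N ->
     `|iter n (@forward R) (E ij.2) ij.1 - beta ^+ ij.1 * iter n (@forward R) (E ij.2) 0%N| <= e / 2 / d.+2%:R.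
    by apply: forward_contract => //; rewrite -ltnS.
  have [N hN] := choice H; exists (\max_ij N ij)%N => i j.
  by apply: (hN (i, j)); exact: leq_bigmax.
pose s i := if i == 0%N then 0 else y i.
have [t ht] := forward_surj n s.
pose zt i : int := Num.floor (t i).
pose r i : R := t i - (zt i)%:~R.
have r01 i : `|r i| <= 1.
  rewrite /r /zt; have /andP[h1] := floor_itv (t i); rewrite rmorphD /= => h2. 
  by rewrite ger0_norm; lra.
exists (iter n (@forward int) zt) => i /andP[i0 id].
have key l : (l <= d.+1)%N -> s l = (iter n (@forward int) zt l)%:~R + \sum_(j < d.+2) r j * iter n (@forward R) (E j) l.
  move=> ld; rewrite -ht // forward_intr -forward_sum -forward_add.
  apply: forward_ext => // l' ld'; have lt : (l' < d.+2)%N by [].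
  rewrite (bigD1 (Ordinal lt)) //= big1 ?addr0 /E ?eqxx ?mulr1 /r; first by ring.
  by move=> j jl; rewrite -val_eqE /= eq_sym in jl; rewrite (negPf jl) mulr0.
have -> : y i = s i - beta ^+ i * s 0%N by rewrite /s eqxx mulr0 subr0 gtn_eqF.
rewrite (key i id) (key 0%N) //.
set Zi := (iter n _ zt i)%:~R; set Z0 := (iter n _ zt 0%N)%:~R.
set Si := \sum_j _; set S0 := \sum_j _.
have -> : Zi + Si - beta ^+ i * (Z0 + S0) - (Zi - beta ^+ i * Z0) = Si - beta ^+ i * S0 by ring.
have lt : (i < d.+2)%N by [].
rewrite /Si /S0 mulr_sumr -sumrB; apply: le_lt_trans (ler_norm_sum _ _ _) _.
apply: (@le_lt_trans _ _ (\sum_(j < d.+2) e / 2 / d.+2%:R)); last first.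
  by rewrite sumr_const card_ord -[X in X < _]mulr_natr divfK ?pnatr_eq0 //; lra.
apply: ler_sum => j _; rewrite mulrCA -mulrBr normrM.
by rewrite -[X in _ <= X]mul1r ler_pM //; exact: (hn (Ordinal lt) j).
Qed.

End Companion.

(** * The finite extension of a translation *)

Section ExtensionTheory.
Local Open Scope classical_set_scope.
Local Open Scope ring_scope.
Local Open Scope complex_scope.

Lemma infinite_injection T (B : set T) : ~ finite_set B ->
  exists x : nat -> T, injective x /\ forall n, B (x n).
Proof.
move/infiniteP/card_leP => [f].
pose i n : set_type [set: nat] := SigSub (mem_set (I : setT n)).
exists (fun n => val (f (i n))); split; last by move=> n; exact: set_valP.
move=> m n /val_inj e.
have := 'inj_f (mem_set (I : setT (i m))) (mem_set (I : setT (i n))) e.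
by move/(congr1 val).
Qed.

Section Torus.
Variables (R : realType) (d : nat).
Implicit Types a x : 'rV[R]_d.

Lemma torus_proj0 : torus_proj (0 : 'rV[R]_d) = 0.
Proof. by apply: (@addrI _ (torus_proj 0)); rewrite -torus_projD !addr0. Qed.

Lemma torus_projN a : torus_proj (- a) = - torus_proj a.
Proof. by apply: (@addrI _ (torus_proj a)); rewrite -torus_projD !subrr torus_proj0. Qed.

Lemma torus_projMn a n : torus_proj (a *+ n) = torus_proj a *+ n.
Proof. by elim: n => [|n IH]; rewrite ?torus_proj0 // !mulrS torus_projD IH. Qed.

Lemma torus_projMz a (n : int) : torus_proj (a *~ n) = torus_proj a *~ n.
Proof.
case: n => n; first by rewrite -!pmulrn torus_projMn.
by rewrite NegzE !mulrNz torus_projN -!pmulrn torus_projMn.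
Qed.

Lemma torus_proj_repr (t : torus R d) : torus_proj (repr t) = t.
Proof. by rewrite /torus_proj reprK. Qed.

Lemma continuous_torus_proj : continuous (@torus_proj R d).
Proof. exact: pi_continuous. Qed.

End Torus.

Lemma torus_null0 (R : realType) d (N : set (torus R d.+1)) : N `<=` set0 -> torus_null N.
Proof.
move=> N0 e e0; exists (fun _ => 0), (fun _ => 0); split.
- by move=> n i; rewrite mxE.
- by move=> x [_ /N0].
- rewrite eseries0 ?lee_fin ?ltW // => n _ _.
  by rewrite big_ord_recl subrr mul0r.
Qed.

Section FiniteExtension.
Variables (A : finType) (sigma : substitution A) (R : realType).
Implicit Types (x y : biseq A) (p q : {poly R}).
Notation lang := (lang sigma).
Notation S := (@shiftZ A).
Notation Omega := (Omega sigma).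

Hypothesis prim : primitive_substitution sigma.
Hypothesis unbounded : forall n, exists w, lang w /\ (n <= size w)%N.

Variables (beta : R) (d k : nat) (P : {poly int}) (gs : seq (Cplx R)).
Hypothesis beta1 : 1 < beta.
Hypothesis bbeta : bounded_on_lang sigma ('X - beta%:P).
Hypothesis sP : size P = d.+3.
Hypothesis mP : P \is monic.
Hypothesis P0 : P`_0 * P`_0 = 1.
Hypothesis rP : root (map_poly intr P) beta.
Hypothesis cP : cobounding sigma (P * 'X^k).
Hypothesis fP : map_poly intr P = ('X - (beta%:C : Cplx R)%:P) * \prod_(g <- gs) ('X - g%:P).
Hypothesis gs1 : all (fun g => `|g| < 1) gs.

Notation D i := ('X^i - (beta ^+ i)%:P).

(** Along an orbit the potential of ['X^i - beta^i] increases by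
    [|sigma^i(x_0)| - beta^i], which is a constant modulo 1. *)
Definition internal_coordinates x : 'rV[R]_d.+1 := \row_i potential sigma (D i.+1) x.

Definition rotation : 'rV[R]_d.+1 := \row_i (- beta ^+ i.+1).

(** The potentials are continuous by [potential_local]. *)
Lemma continuous_internal_coordinates : {within Omega, continuous internal_coordinates}.
Proof.
apply/subspace_continuousP => x Ox; apply/cvg_ballP => e e0.
have e2 : 0 < e / 2 by lra.
have h (i : 'I_d.+1) : exists N, forall y, Omega y -> window x 0 N = window y 0 N ->
    `|potential sigma (D i.+1) x - potential sigma (D i.+1) y| <= e / 2.
  have bD := root_bounded bbeta (D_root beta i.+1).
  by have [N hN] := potential_local prim unbounded bD e2; exists N => y Oy; exact: hN.
have [N hN] := choice h.
pose M := (\max_i N i)%N.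
rewrite near_withinE; apply: filterS (nbhs_window x 0 M) => y ey Oy.
split=> // i j; rewrite !mxE; apply: le_lt_trans (hN j y Oy _) _; last by lra.
by apply: (window_prefix_eq (leq_bigmax j)); rewrite ey.
Qed.

Lemma internal_coordinates_shift x : Omega x ->
  torus_proj (internal_coordinates (S x)) = torus_proj (internal_coordinates x) + torus_proj rotation.
Proof.
move=> Ox; rewrite -torus_projD; apply/torus_proj_eq => i; rewrite !mxE.
rewrite potential_shift //; last by apply: (root_bounded bbeta); exact: D_root.
rewrite pairing_XnC mulr1 opprD addrACA subrr add0r opprK subrK.
exact: Num.Theory.natr_int.
Qed.

(** Density of the orbits is the density of the points [z_i - beta^i z_0] in the
    space of dimension [d.+1]: [z_0] is the time and the [z_i] are translations by
    integers. *)
Lemma minimal_rotation : minimal_translation (torus_proj rotation).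
Proof.
move=> x U [t0 Ut] openU.
have oP : open (@torus_proj R d.+1 @^-1` U).
  by move/continuousP: (@continuous_torus_proj R d.+1); apply.
have : nbhs (repr t0) (@torus_proj R d.+1 @^-1` U).
  by apply: open_nbhs_nbhs; split => //=; rewrite torus_proj_repr.
move/nbhs_ballP => [e /= e0 he].
pose y i := repr t0 0 (inord i.-1) - repr x 0 (inord i.-1).
have [z hz] := companion_dense sP mP P0 fP gs1 y e0.
exists (x + torus_proj rotation *~ (z 0%N)); split; last by exists (z 0%N).
rewrite -{1}(torus_proj_repr x) -torus_projMz -torus_projD.
pose v : 'rV[R]_d.+1 := \row_i (z i.+1)%:~R.
have -> : torus_proj (repr x + rotation *~ z 0%N) = torus_proj (repr x + rotation *~ z 0%N + v).
  apply/torus_proj_eq => i; rewrite opprD addrA subrr add0r !mxE rpredN; exact: intr_int.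
apply: he; split => // i j; rewrite ord1 /ball /=.
have := hz j.+1; rewrite ltn_ord /= => /(_ isT); rewrite /y /= inord_val.
by congr (`|_| < _); rewrite -[rotation *~ _]scaler_int !mxE; ring.
Qed.

(** The map identifies two points when the differences of their potentials are
    integers, so that all its fibres are finite. *)
Theorem finite_extension : finite_extension_of_minimal_translation R d.+1 sigma.
Proof.
exists (fun x => torus_proj (internal_coordinates x)), (torus_proj rotation); split.
- split; last exact: internal_coordinates_shift.
  move=> x; apply: continuous_comp; first exact: continuous_internal_coordinates.
  exact: continuous_torus_proj.
- exact: minimal_rotation.
- apply: torus_null0 => t /infinite_injection[x [ix hx]].
  apply: (no_infinite_fibre prim unbounded beta1 bbeta sP mP P0 rP cP).
  exists x; split => //; first by move=> n; case: (hx n).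
  move=> n m [|i] id.
    exists 0; have -> : D 0%N = 0 :> {poly R} by rewrite !expr0 polyC1 subrr.
    by apply: (delta0 prim unbounded bbeta); [case: (hx n)|case: (hx m)].
  have e : torus_proj (internal_coordinates (x n)) = torus_proj (internal_coordinates (x m)).
    by have [_ /= ->] := hx n; have [_ /= ->] := hx m.
  have lt : (i < d.+1)%N by [].
  have := (torus_proj_eq _ _).1 e (Ordinal lt); rewrite !mxE => /intrP[z ez].
  by exists z.
Qed.

End FiniteExtension.

End ExtensionTheory.

(** * Eigenvalues of the subshift *)

Section EigenvalueTheory.
Local Open Scope classical_set_scope.
Local Open Scope ring_scope.
Local Open Scope complex_scope.

Lemma nbhs_cylinder (A : finType) (x : biseq A) (U : set (biseq A)) : nbhs x U ->
  exists N, forall y, window y (- Posz N) (N + N) = window x (- Posz N) (N + N) -> U y.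
Proof.
move=> xU; apply: contrapT => /forallNP h.
have H N : exists y, window y (- Posz N) (N + N) = window x (- Posz N) (N + N) /\ ~ U y.
  apply: contrapT => /forallNP h2; apply: (h N) => y e; apply: contrapT => ny.
  by apply: (h2 y).
have [z hz] := choice H.
have cz : z @ \oo --> x by apply: window_cvg => n; exact: (hz n).1.
have [N _ hN] := cz U xU.
exact: (hz N).2 (hN N (leqnn N)).
Qed.

Section Eigenvalues.
Variables (A : finType) (sigma : substitution A) (R : realType).
Notation C := (Cplx R).
Notation lang := (lang sigma).
Notation S := (@shiftZ A).
Notation T := (subst_biseq sigma).
Notation Omega := (Omega sigma).
Notation siter := (siter sigma).

Hypothesis prim : primitive_substitution sigma.
Hypothesis unbounded : forall n, exists w, lang w /\ (n <= size w)%N.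

Section Eigenfunction.
Variables (eta : C) (f : biseq A -> C).
Hypothesis eta1 : `|eta| = 1.
Hypothesis cf : {within Omega, continuous f}.
Hypothesis f1 : forall u, Omega u -> `|f u| = 1.
Hypothesis fS : forall u, Omega u -> f (S u) = eta * f u.

Let fSn n u : Omega u -> f (iter n S u) = eta ^+ n * f u.
Proof.
move=> Ou; elim: n => [|n IH]; first by rewrite mul1r.
by rewrite iterS fS ?IH ?exprS ?mulrA //; exact: Omega_shiftn.
Qed.

(** Uniform continuity gives the same statement for windows centered at 0; the
    modulus of [f x - f y] is invariant under the shift, which moves the window to
    non-negative indices. *)
Lemma eigenfunction_local (e : R) : 0 < e -> exists m, forall x y, Omega x -> Omega y ->
  window x 0 m = window y 0 m -> `|f x - f y| <= e%:C.
Proof.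
move=> e0; apply: contrapT => /forallNP h.
have H j : exists xy : biseq A * biseq A, [/\ Omega xy.1, Omega xy.2,
    window xy.1 (- Posz j) (j + j) = window xy.2 (- Posz j) (j + j) &
    ~ (`|f xy.1 - f xy.2| <= e%:C)].
  have /existsNP[x /existsNP[y h2]] := h (j + j)%N.
  have [Ox [Oy [exy ne]]] : Omega x /\ Omega y /\ window x 0 (j + j) = window y 0 (j + j) /\ ~ (`|f x - f y| <= e%:C).
    by move: h2 => /not_implyP[Ox /not_implyP[Oy /not_implyP[exy ne]]].
  exists (iter j S x, iter j S y); split; [exact: Omega_shiftn|exact: Omega_shiftn| |].
    by rewrite !window_shift addNr.
  by rewrite /= !fSn // -mulrBr normrM normrX eta1 expr1n mul1r.
have [z hz] := choice H.
have [|x [Ox cx]] := @compact_Omega A sigma ((fun j => (z j).1) @ \oo) _.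
  by exists 0%N => // j _; have [] := hz j.
have e2 : 0 < (e / 2)%:C :> C by rewrite ltcR; lra.
move/subspace_continuousP: cf => /(_ x Ox) /cvgrPdist_lt /(_ _ e2).
rewrite near_withinE => /nbhs_cylinder[N hN].
have [||y [[j /= Nj ejy] ey]] := cx ((fun j => (z j).1) @` [set j | (N <= j)%N])
    [set y | window y (- Posz N) (N + N) = window x (- Posz N) (N + N)].
- by exists N => // j /= Nj; exists j.
- exact: nbhs_window.
have [Oj1 Oj2 exy ne] := hz j; apply: ne; rewrite /= -ejy in ey.
have sub (u v : biseq A) : window u (- Posz j) (j + j) = window v (- Posz j) (j + j) ->
    window u (- Posz N) (N + N) = window v (- Posz N) (N + N).
  have -> : (j + j = (j - N) + ((N + N) + (j - N)))%N by lia.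
  rewrite windowD [RHS]windowD => /eqP; rewrite eqseq_cat ?size_window // => /andP[_ /eqP].
  rewrite windowD [RHS]windowD => /eqP; rewrite eqseq_cat ?size_window // => /andP[/eqP + _].
  by have -> : (- Posz j + Posz (j - N) = - Posz N)%R by lia.
have h1 := hN _ ey Oj1.
have h2 : `|f x - f (z j).2| < (e / 2)%:C by apply: hN => //; rewrite -(sub _ _ exy).
have -> : f (z j).1 - f (z j).2 = (f x - f (z j).2) - (f x - f (z j).1) by ring.
apply: le_trans (ler_normB _ _) _; rewrite (splitr e) rmorphD.
by apply: lerD; exact: ltW.
Qed.

(** A point that begins with the loop [h] and its shift by [|h|] start with the
    same letter, so that after [n] substitutions they share a long prefix while
    they differ by [|sigma^n(h)|] shifts. *)
Lemma eigenvalue_loop h : loop sigma h -> vanishing (fun n => eta ^+ size (siter n h) - 1).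
Proof.
move=> [a [v [-> lh]]] e e0; have [m hm] := eigenfunction_local e0.
have [n0 hn0] := long_siter prim unbounded m.
have [y Oy ey] := Omega_prefix prim unbounded lh.
exists n0 => n nn.
pose w := a :: v.
have /andP[/eqP e1 /eqP e2] : (window y 0 (size w) == w) && (window y (Posz (size w)) 1 == [:: a]).
  by rewrite -eqseq_cat ?size_window // -[Posz (size w)]add0r -windowD addn1 -[_.+1](size_rcons w a) ey cats1.
have e3 : window y 0 1 = [:: a].
  by move: e1; rewrite /w /= -add1n windowD => -[ea _]; rewrite /window /= -ea.
have e4 : window (iter (size w) S y) 0 1 = [:: a] by rewrite window_shift add0r.
pose x := iter n T y; pose x' := iter n T (iter (size w) S y).
have ex' : x' = iter (size (siter n w)) S x by rewrite /x' siter_shiftn e1.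
have Ox : Omega x by exact: Omega_substn.
have Ox' : Omega x' by apply: Omega_substn; exact: Omega_shiftn.
have := hm x' x Ox' Ox; rewrite {2}ex' fSn // -{2}[f x]mul1r -mulrBl normrM f1 // mulr1; apply.
apply: (window_prefix_eq (hn0 n a nn)).
have := window_siter sigma n y 1; rewrite e3 => ->.
by have := window_siter sigma n (iter (size w) S y) 1; rewrite e4 => ->.
Qed.

Lemma norm_expz_sub1 (u : C) (c : int) : `|u| = 1 -> `|u ^ c - 1| <= (absz c)%:R * `|u - 1|.
Proof.
move=> u1; have u0 : u != 0 by rewrite -normr_eq0 u1 oner_eq0.
have pos n : `|u ^+ n - 1| <= n%:R * `|u - 1|.
  elim: n => [|n IH]; first by rewrite subrr normr0 mul0r.
  have -> : u ^+ n.+1 - 1 = u ^+ n * (u - 1) + (u ^+ n - 1) by rewrite exprSr; ring.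
  apply: le_trans (ler_normD _ _) _; rewrite normrM normrX u1 expr1n mul1r.
  by rewrite -[n.+1]add1n natrD mulrDl mul1r lerD2l.
case: c => n; first exact: pos.
rewrite NegzE -exprnN abszN /=.
have -> : u ^- n.+1 - 1 = - u ^- n.+1 * (u ^+ n.+1 - 1) by field; rewrite expf_neq0.
by rewrite normrM normrN normfV normrX u1 expr1n invr1 mul1r.
Qed.

Lemma norm_expz_sum (u : C) (I : Type) (r : seq I) (F : I -> int) : u != 0 -> `|u| = 1 ->
  `|u ^ (\sum_(i <- r) F i) - 1| <= \sum_(i <- r) `|u ^ F i - 1|.
Proof.
move=> u0 u1; elim: r => [|i r IH]; first by rewrite !big_nil expr0z subrr normr0.
rewrite !big_cons expfzDr //; set b := \sum_(j <- r) F j in IH *.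
have -> : u ^ F i * u ^ b - 1 = u ^ F i * (u ^ b - 1) + (u ^ F i - 1) by ring.
apply: le_trans (ler_normD _ _) _; rewrite addrC lerD2l // normrM.
have -> : `|u ^ F i| = 1 by case: (F i) => n; rewrite ?NegzE -?exprnN ?normfV normrX u1 expr1n ?invr1.
by rewrite mul1r.
Qed.

(** By [eigenvalue_loop] the powers of [eta] with exponents
    [pairing t (sigma^n(h))] tend to 1; the exponent does not change when [n] runs
    through the multiples of [q], so that a non-zero power of [eta] equals 1. *)
Lemma eigenvalue_torsion (t : {poly int}) q h : (0 < q)%N -> loop sigma h ->
  pairing sigma t h != 0 -> cobounding sigma (('X^q - 1) * t) -> Defs.root_of_unity eta.
Proof.
move=> q0 lh th ct; have eta0 : eta != 0 by rewrite -normr_eq0 eta1 oner_eq0.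
have per n : pairing sigma t (siter (q * n) h) = pairing sigma t h.
  elim: n => [|n IH]; first by rewrite muln0.
  have := ct _ (loop_siter (q * n) lh).
  rewrite mulrBl mul1r pairingB mulrC pairing_mulXn -siterD IH => /eqP.
  by rewrite subr_eq0 mulnS => /eqP.
set c := pairing sigma t h in th per.
have small (e : R) : 0 < e -> `|eta ^ c - 1| <= e%:C.
  move=> e0; pose B : R := \sum_(i < size t) (absz t`_i)%:R.
  have B0 : 0 <= B by apply: sumr_ge0.
  have e1 : 0 < e / (B + 1) by rewrite divr_gt0 // ltr_wpDl.
  have [N hN] := eigenvalue_loop lh e1.
  have qN : (N <= q * N)%N by rewrite leq_pmull.
  rewrite -(per N) /pairing; apply: le_trans (norm_expz_sum _ _ eta0 eta1) _.
  apply: (@le_trans _ _ (\sum_(i < size t) (absz t`_i)%:R * (e / (B + 1))%:C)).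
    apply: ler_sum => i _.
    have -> : eta ^ (t`_i * (size (siter i (siter (q * N) h)))%:R) = (eta ^+ size (siter i (siter (q * N) h))) ^ t`_i.
      by rewrite natz mulrC -exprz_exp.
    apply: le_trans (norm_expz_sub1 _ _) _; first by rewrite normrX eta1 expr1n.
    rewrite ler_wpM2l // -siterD; apply: hN.
    by apply: leq_trans qN (leq_addl _ _).
  rewrite -mulr_suml.
  have -> : \sum_(i < size t) (absz t`_i)%:R = B%:C :> C.
    by rewrite /B rmorph_sum; apply: eq_bigr => i _; rewrite rmorph_nat.
  by rewrite -rmorphM lecR mulrA ler_pdivrMr ?ltr_wpDl // mulrDr mulr1 mulrC lerDl ltW.
have e1 : eta ^ c = 1.
  apply/eqP; rewrite -subr_eq0 -normr_eq0; have [r r0 er] := norm_real (eta ^ c - 1).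
  rewrite er; apply/eqP; congr (_%:C); apply/eqP; rewrite eq_le r0 andbT.
  by apply/ler_addgt0Pr => e e0; rewrite add0r -lecR -er; exact: small.
exists (absz c); first by rewrite absz_gt0.
apply/unity_rootP; move: e1; case: (c) => n //=.
by rewrite NegzE -exprnN => /(congr1 (@GRing.inv _)); rewrite invrK invr1.
Qed.
End Eigenfunction.
End Eigenvalues.

End EigenvalueTheory.

(** * Eigenvalues of minimal translations *)

Section ExclusionTheory.
Local Open Scope classical_set_scope.
Local Open Scope ring_scope.
Local Open Scope complex_scope.

Section Character.
Variable R : realType.
Notation C := (Cplx R).

(** The character [exp (2 i pi t)]. *)
Definition circle (t : R) : C := (cos (2 * pi * t) +i* sin (2 * pi * t))%C.

Lemma circleD s t : circle (s + t) = circle s * circle t.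
Proof.
by rewrite /circle mulrDr cosD sinD; apply/eqP; rewrite eq_complex /= eqxx /= addrC [X in X + _]mulrC eqxx.
Qed.

Lemma norm_circle t : `|circle t| = 1.
Proof. by rewrite normc_def /= cos2Dsin2 sqrtr1. Qed.

Lemma circle0 : circle 0 = 1.
Proof. by rewrite /circle mulr0 cos0 sin0. Qed.

Lemma circle_half : circle (2^-1) = -1.
Proof.
rewrite /circle (_ : 2 * pi * 2^-1 = pi); last by rewrite mulrC mulrA mulVf ?mul1r // pnatr_eq0.
by rewrite cospi sinpi; apply/eqP; rewrite eq_complex /= oppr0 !eqxx.
Qed.

Lemma circleMn t n : circle (t *+ n) = circle t ^+ n.
Proof. by elim: n => [|n IH]; rewrite ?circle0 // mulrS circleD IH exprS. Qed.

Lemma circle1 : circle 1 = 1.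
Proof.
have -> : 1 = 2^-1 *+ 2 :> R by rewrite -[RHS]mulr_natr mulVf // pnatr_eq0.
by rewrite circleMn circle_half -signr_odd.
Qed.

Lemma circle_int (z : int) : circle z%:~R = 1.
Proof.
have nat n : circle n%:R = 1 by rewrite circleMn circle1 expr1n.
case: z => n; first exact: nat.
rewrite NegzE rmorphN /=; have := circleD (- n.+1%:R) n.+1%:R.
by rewrite addNr circle0 nat mulr1 => <-.
Qed.

Lemma continuous_circle : continuous circle.
Proof.
move=> t; apply/cvgrPdist_lt => e e0.
have er : e = (complex.Re e)%:C by rewrite RRe_real // gtr0_real.
have e1 : 0 < complex.Re e / 2 by rewrite divr_gt0 // -ltcR -er.
have cc : {for t, continuous (fun t : R => cos (2 * pi * t))}.
  by apply: continuous_comp; [exact: mulrl_continuous|exact: continuous_cos].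
have cs : {for t, continuous (fun t : R => sin (2 * pi * t))}.
  by apply: continuous_comp; [exact: mulrl_continuous|exact: continuous_sin].
move/cvgrPdist_lt: cc => /(_ _ e1) hc; move/cvgrPdist_lt: cs => /(_ _ e1) hs.
apply: filterS2 hc hs => s h1 h2.
have -> : circle t - circle s = (cos (2 * pi * t) - cos (2 * pi * s))%:C + 'i%C * (sin (2 * pi * t) - sin (2 * pi * s))%:C.
  by apply/eqP; rewrite eq_complex /= !(mul0r, mul1r, addr0, subr0, add0r) !eqxx.
apply: le_lt_trans (ler_normD _ _) _; rewrite normrM.
have nr (x : R) : `|(x%:C : C)| = `|x|%:C by rewrite normc_def /= expr0n addr0 sqrtr_sqr.
have ni : `|('i%C : C)| = 1 by rewrite normc_def /= expr0n add0r expr1n sqrtr1.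
by rewrite !nr ni mul1r -rmorphD er ltcR; move: h1 h2; lra.
Qed.

End Character.

Section Exclusive.
Variables (A : finType) (sigma : substitution A) (R : realType) (d : nat).
Notation C := (Cplx R).

Definition first_character n (t : torus R d.+1) : C := circle (repr t 0 0 *+ n).

Lemma first_character_proj n (x : 'rV[R]_d.+1) : first_character n (torus_proj x) = circle (x 0 0 *+ n).
Proof.
have : torus_proj (repr (torus_proj x)) = torus_proj x by rewrite torus_proj_repr.
move/torus_proj_eq/(_ 0); rewrite !mxE => /intrP[z ez].
rewrite /first_character; have -> : repr (torus_proj x) 0 0 = x 0 0 + z%:~R by rewrite -ez addrCA subrr addr0.
by rewrite mulrnDl circleD [circle (z%:~R *+ n)]circleMn circle_int expr1n mulr1.
Qed.

Lemma first_characterD n s t : first_character n (s + t) = first_character n s * first_character n t.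
Proof.
rewrite -[s]torus_proj_repr -[t]torus_proj_repr -torus_projD !first_character_proj.
by rewrite mxE mulrnDl circleD.
Qed.

Lemma continuous_first_character n : continuous (first_character n).
Proof.
apply/quotient_continuous.
have -> : first_character n \o \pi_(quotient_topology _)%qT = (fun x : 'rV[R]_d.+1 => circle (x 0 0 *+ n)).
  by apply/funext => x /=; rewrite -first_character_proj.
move=> x; apply: (@continuous_comp _ _ _ (fun x : 'rV[R]_d.+1 => x 0 0 *+ n) (@circle R)); last exact: continuous_circle.
apply: (@continuous_comp _ _ _ (fun x : 'rV[R]_d.+1 => x 0 0) (fun y => y *+ n)); last exact: natmul_continuous.
exact: coord_continuous.
Qed.

(** Composing with the characters of the torus, the first coordinate of the
    translation gives an eigenvalue.  If its order were [n], the character [n] times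
    the first coordinate would be constant on an orbit, whereas it takes the
    value -1 and the orbit is dense. *)
Lemma finite_extension_irrational :
  finite_extension_of_minimal_translation R d.+1 sigma -> ~ only_root_of_unity_eigenvalues R sigma.
Proof.
move=> [f [a [[cf fS] mina _]]] h.
have [|n n0 /unity_rootP un] := h (first_character 1 a).
  split; first exact: norm_circle.
  exists (fun u => first_character 1 (f u)); split.
  - move=> x; apply: continuous_comp; [exact: cf|exact: continuous_first_character].
  - by move=> u _; exact: norm_circle.
  - by move=> u Ou; rewrite fS // first_characterD mulrC.
have an : first_character n a = 1 by rewrite /first_character circleMn -un /first_character mulr1n.
pose U := first_character n @^-1` [set z : C | `|-1 - z| < 1].
have oU : open U.
  move/continuousP: (@continuous_first_character n); apply.
  have := @ball_open _ C (-1) 1; rewrite (_ : ball _ _ = [set z : C | `|-1 - z| < 1]) //; exact.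
have [|t [Ut [m _ em]]] := mina 0 U _ oU.
  exists (torus_proj (\row__ (2^-1 / n%:R))); rewrite /U /= first_character_proj mxE -[2^-1 / n%:R *+ n]mulr_natr divfK ?pnatr_eq0 -?lt0n //.
  by rewrite circle_half subrr normr0.
have := Ut; rewrite /U /= -em add0r.
have -> : first_character n (a *~ m) = 1.
  have pos k : first_character n (a *+ k) = 1.
    elim: k => [|k IH]; last by rewrite mulrS first_characterD an IH mulr1.
    by rewrite mulr0n -(torus_proj0 R d.+1) first_character_proj mxE mul0rn circle0.
  case: m {em} => m; first by rewrite -pmulrn pos.
  have := first_characterD n (a *~ Negz m) (a *+ m.+1); rewrite NegzE mulrNz -pmulrn addNr pos mulr1 => <-.
  by rewrite -(torus_proj0 R d.+1) first_character_proj mxE mul0rn circle0.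
by rewrite -opprD normrN -[1 + 1]/(2%:R) normr_nat ltrn1.
Qed.

End Exclusive.

End ExclusionTheory.

(** * The minimal polynomial of the Perron eigenvalue *)

Section PolynomialTheory.
Local Open Scope ring_scope.
Local Open Scope complex_scope.

Section MinimalPolynomial.
Variable F : numFieldType.
Implicit Types (p q : {poly rat}) (x : F).

Lemma irreducible_common_root p q x : irreducible_poly p ->
  root (map_poly ratr p) x -> root (map_poly ratr q) x -> p %| q.
Proof.
move=> ip rp rq; apply: contraT; rewrite -irreducible_poly_coprime //.
move/Bezout_coprimepP => [[u v] /= /eqpf_eq[c c0 e]].
have := congr1 (fun r => (map_poly ratr r).[x] : F) e.
rewrite rmorphD !rmorphM /= !hornerE (eqP rp) (eqP rq) !mulr0 addr0 map_polyZ /= rmorph1 hornerZ hornerC mulr1.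
by move=> /esym/eqP; rewrite fmorph_eq0 (negPf c0).
Qed.

Lemma minimal_polynomial_dvd p q x : minimal_polynomial p x ->
  root (map_poly ratr q) x -> p %| q.
Proof. by move=> [_ ip rp]; exact: irreducible_common_root. Qed.

Lemma minimal_polynomial_uniq p q x : minimal_polynomial p x -> minimal_polynomial q x -> p = q.
Proof.
move=> mp mq; have [mop _ rp] := mp; have [moq _ rq] := mq.
apply/eqP; rewrite -eqp_monic // /eqp.
by rewrite (minimal_polynomial_dvd mp rq) (minimal_polynomial_dvd mq rp).
Qed.

Lemma map_ratr_int (P : {poly int}) : map_poly ratr (map_poly intr P : {poly rat}) = map_poly intr P :> {poly F}.
Proof. by rewrite -map_poly_comp; apply: eq_map_poly => z /=; rewrite ratr_int. Qed.

(** Gauss's lemma: a rational factor of a monic integer polynomial is proportional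
    to an integer polynomial with leading coefficient 1 or -1. *)
Lemma minimal_polynomial_int p x : integralOver (intr : int -> F) x -> minimal_polynomial p x ->
  exists2 P : {poly int}, P \is monic & p = map_poly intr P.
Proof.
move=> [q mq rq] mp; have [mop _ _] := mp.
have : p %| map_poly (intr : int -> rat) q.
  by apply: (minimal_polynomial_dvd mp); rewrite map_ratr_int.
move=> /dvdpP_rat_int[p1 [a a0 ep] [r eq]].
have lead1 : lead_coef p1 * lead_coef r = 1.
  by rewrite -lead_coefM -eq; apply/eqP; rewrite -monicE.
have u : lead_coef p1 * lead_coef p1 = 1.
  have := congr1 absz lead1; rewrite abszM => /eqP; rewrite muln_eq1 => /andP[/eqP h _].
  by move: h; case: (lead_coef p1) => -[|[|n]].
have mP : lead_coef p1 *: p1 \is monic.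
  by rewrite monicE -mul_polyC lead_coefM lead_coefC u.
exists (lead_coef p1 *: p1) => //.
have al : a * (lead_coef p1)%:~R = 1.
  by move: mop; rewrite monicE ep lead_coefZ lead_coef_map_inj ?rmorph0 //; [move/eqP|exact: intr_inj].
rewrite ep map_polyZ /=; congr (_ *: _).
have e2 : a = a * (lead_coef p1 * lead_coef p1)%:~R by rewrite u mulr1.
by rewrite e2 intrM mulrA al mul1r.
Qed.

End MinimalPolynomial.

Lemma Cayley_Hamilton_entries (R : comNzRingType) n (M : 'M[R]_n) b i :
  \sum_(k < size (char_poly M)) (char_poly M)`_k * (M ^+ k) b i = 0.
Proof.
case: n M b i => [M [] //|n M b i].
have E (p : {poly R}) : horner_mx M p = \sum_(k < size p) p`_k *: M ^+ k.
  rewrite -{1}[p]coefK poly_def rmorph_sum; apply: eq_bigr => k _.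
  by rewrite /= linearZ rmorphXn /= horner_mx_X.
have := Cayley_Hamilton M; rewrite E => /matrixP/(_ b i).
rewrite summxE mxE => e; rewrite -[RHS]e.
by apply: eq_bigr => k _; rewrite mxE.
Qed.

Section Incidence.
Variables (A : finType) (sigma : substitution A).

Definition incidenceZ : 'M[int]_#|A| := map_mx Posz (incidence sigma).

Lemma incidenceZ_exp n b a :
  (incidenceZ ^+ n) b a = Posz (count_mem (enum_val b) (siter sigma n [:: enum_val a])).
Proof.
rewrite -incidence_exp; elim: n a => [|n IH] a; first by rewrite !expr0 !mxE; case: eqP.
rewrite !exprSr !mxE (big_morph Posz PoszD (erefl _)); apply: eq_bigr => c _.
by rewrite IH mxE PoszM.
Qed.

Lemma size_siter_incidence n a :
  (size (siter sigma n [:: enum_val a]))%:R = \sum_b (incidenceZ ^+ n) b a :> int.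
Proof.
rewrite natz; under eq_bigr => b _ do rewrite incidenceZ_exp.
rewrite -(big_morph Posz PoszD (erefl _)); congr Posz.
rewrite -sum1_size (sum_count (V := nat) (fun _ => 1%N)) /=.
rewrite (reindex (enum_val (A := predT))) /=; last by apply: onW_bij; exact: enum_val_bij.
by apply: eq_bigr => b _; rewrite -mulr_natr natn mul1r.
Qed.

(** The lengths of the iterates are the column sums of the powers of the incidence
    matrix, which satisfy the theorem of Cayley and Hamilton. *)
Lemma pairing_char_poly w : pairing sigma (char_poly incidenceZ) w = 0.
Proof.
elim: w => [|a w IH]; first exact: pairing_nil.
rewrite -cat1s pairing_cat IH addr0 -(enum_rankK a) /pairing.
under eq_bigr => k _ do rewrite size_siter_incidence mulr_sumr.
by rewrite exchange_big big1 // => b _; exact: Cayley_Hamilton_entries.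
Qed.

Variable R : realType.

Lemma incidenceCE : incidenceC R sigma = map_mx intr incidenceZ.
Proof. by apply/matrixP => b a; rewrite !mxE. Qed.

Lemma char_poly_incidenceC : char_poly (incidenceC R sigma) = map_poly intr (char_poly incidenceZ).
Proof. by rewrite incidenceCE map_char_poly. Qed.

(** If lengths were bounded, two powers of the incidence matrix would coincide, and
    so would two powers of [beta]. *)
Lemma eigenvalue_unbounded (beta : R) : 1 < beta ->
  eigenvalue (incidenceC R sigma) (beta%:C : Cplx R) ->
  forall n, exists w, lang sigma w /\ (n <= size w)%N.
Proof.
move=> b1 /eigenvalueP[v ev v0] n; apply: contrapT => /forallNP h.
have lt m a : (size (siter sigma m [:: a]) < n)%N.
  by rewrite ltnNge; apply/negP => le; apply: (h (siter sigma m [:: a])); split => //; exact: lang_siter (lang1 _ _).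
pose T : finType := {ffun 'I_#|A| * 'I_#|A| -> 'I_n.+1}.
pose f (m : 'I_#|T|.+1) : T := [ffun ba => inord (count_mem (enum_val ba.1) (siter sigma m [:: enum_val ba.2]))].
have [t ht] : exists t, (1 < #|[pred m | f m == t]|)%N.
  by apply: pigeonhole; rewrite muln1 card_ord.
have /card_gt1P[m [m' [/eqP em /eqP em' mm']]] := ht.
have E : incidenceC R sigma ^+ m = incidenceC R sigma ^+ m'.
  have mX k : incidenceC R sigma ^+ k = map_mx intr (incidenceZ ^+ k).
    rewrite incidenceCE; elim: k => [|k IH]; first by apply/matrixP => b a; rewrite !expr0 !mxE; case: eqP.
    by rewrite !exprS IH; apply/matrixP => b a; rewrite !mxE rmorph_sum; apply: eq_bigr => c _; rewrite !mxE rmorphM.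
  rewrite !mX; congr map_mx; apply/matrixP => b a; rewrite !incidenceZ_exp; congr Posz.
  have := congr1 (fun g : T => nat_of_ord (g (b, a))) (etrans em (esym em')).
  by rewrite !ffunE /= !inordK // ltnS (leq_trans (count_size _ _)) // ltnW // lt.
have vX k : v *m (incidenceC R sigma ^+ k) = (beta ^+ k)%:C *: v.
  elim: k => [|k IH]; first by rewrite !expr0 scale1r; apply/rowP => i; rewrite mxE (bigD1 i) //= mxE eqxx mulr1 big1 ?addr0 // => j ji; rewrite mxE (negPf ji) mulr0.
  rewrite exprS mulmxA ev -scalemxAl IH scalerA exprS rmorphM //.
have := vX m; rewrite E vX => /eqP; rewrite -subr_eq0 -scalerBl scaler_eq0 (negPf v0) orbF subr_eq0.
move=> /eqP /complexI e.
have b0 : 0 < beta by exact: lt_trans b1.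
have : m' = m by apply: ord_inj; apply: (ieexprIn b0 _ e); rewrite gt_eqF.
by move/eqP; rewrite eq_sym (negPf mm').
Qed.

End Incidence.

End PolynomialTheory.

Section Structure.
Local Open Scope ring_scope.
Local Open Scope complex_scope.
Variables (R : realType) (A : finType) (sigma : substitution A).
Notation C := (Cplx R).

(** Each of the two eigenvalues bounds the modulus of the other. *)
Lemma perron_uniq (b b' : R) : 0 <= b -> perron_eigenvalue sigma b -> perron_eigenvalue sigma b' -> b' = b.
Proof.
move=> b0 [e _ h] [e' _ h'].
have nr (x : R) : `|(x%:C : C)| = `|x|%:C by rewrite normc_def /= expr0n addr0 sqrtr_sqr.
have l1 : `|b| <= b' by rewrite -lecR -nr; exact: h'.
have l2 : `|b'| <= b by rewrite -lecR -nr; exact: h.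
by apply/eqP; rewrite eq_le (le_trans (ler_norm _) l2) (le_trans (ler_norm _) l1).
Qed.

Lemma minimal_polynomial_complex (p : {poly rat}) (b : R) :
  minimal_polynomial p b <-> minimal_polynomial p (b%:C : C).
Proof.
have e : root (map_poly ratr p) (b%:C : C) = root (map_poly ratr p) b.
  have -> : map_poly ratr p = map_poly (real_complex R) (map_poly ratr p) :> {poly C}.
    by rewrite -map_poly_comp; apply: eq_map_poly => x /=; rewrite fmorph_rat.
  by rewrite fmorph_root.
by split=> -[h1 h2 h3]; split=> //; rewrite ?e // -e.
Qed.

Lemma torsion_exponent (rs : seq C) : (forall z, z \in rs -> Defs.root_of_unity z \/ z = 0) ->
  exists2 q, (0 < q)%N & forall z, z \in rs -> z ^+ q = 1 \/ z = 0.
Proof.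
elim: rs => [|z rs IH] h; first by exists 1%N.
have [|q q0 hq] := IH; first by move=> y yr; apply: h; rewrite inE yr orbT.
have [[n n0 /unity_rootP zn]|z0] := h z (mem_head _ _); last first.
  by exists q => // y; rewrite inE => /orP[/eqP ->|/hq]; [right|].
exists (n * q)%N; first by rewrite muln_gt0 n0.
move=> y; rewrite inE => /orP[/eqP ->|/hq[e|]]; [left|left|by right].
  by rewrite exprM zn expr1n.
by rewrite mulnC exprM e expr1n.
Qed.

Lemma torsion_dvd (rs : seq C) q : (forall z, z \in rs -> z ^+ q = 1 \/ z = 0) ->
  \prod_(z <- rs) ('X - z%:P) %| 'X^(size rs) * ('X^q - 1) ^+ size rs.
Proof.
elim: rs => [|z rs IH] h; first by rewrite big_nil dvd1p.
rewrite big_cons /= !exprS mulrACA dvdp_mul //.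
  have [zq|->] := h z (mem_head _ _); last by rewrite subr0 dvdp_mulr.
  by rewrite dvdp_mull // dvdp_XsubCl /root !hornerE zq subrr.
by apply: IH => y yr; apply: h; rewrite inE yr orbT.
Qed.

(** The characteristic polynomial of the incidence matrix is the product of the
    minimal polynomial [P] of [beta] and of factors ['X - z] with [z] zero or a root
    of unity: a conjugate of [beta] among these [z] would make the cofactor
    divisible by [P], against the simplicity of [beta].  Such a product divides
    [P * 'X^N * ('X^q - 1)^N] for a common exponent [q], and the latter annihilates
    all lengths by [pairing_char_poly]. *)
Theorem weakly_irreducible_structure (beta : R) d :
  weakly_irreducible_pisot R sigma -> perron_eigenvalue sigma beta -> has_degree beta d.+1 ->
  exists (P : {poly int}) (gs : seq C) (N q : nat),
    [/\ [/\ 1 < beta, size P = d.+2, P \is monic & P`_0 * P`_0 = 1],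
        map_poly intr P = ('X - (beta%:C : C)%:P) * \prod_(g <- gs) ('X - g%:P),
        all (fun g => `|g| < 1) gs, (0 < q)%N &
        forall w, pairing sigma (P * ('X^N * ('X^q - 1) ^+ N)) w = 0].
Proof.
move=> [prim [b0 [pb0 pisb unitb eigs]]] pb [p mp sp].
have e : beta = b0.
  by case: (pisb) => _ b1 _; apply: perron_uniq pb0 pb; rewrite ltW // (lt_trans ltr01).
subst b0; have [inb b1 conj] := pisb; have [eig mup1 _] := pb.
have [P mP eP] := minimal_polynomial_int inb mp.
have [mop ip rp] := mp.
have mpC := (minimal_polynomial_complex p beta).1 mp.
have [_ _ rpC] := mpC.
have szP : size P = d.+2.
  have -> : size P = size p by rewrite eP size_map_inj_poly //; exact: intr_inj.
  by rewrite -sp prednK // lt0n size_poly_eq0 monic_neq0.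
have P0 : P`_0 * P`_0 = 1.
  case: unitb => p' mp' hp'; move: hp'; rewrite -(minimal_polynomial_uniq mp mp') eP coef_map /=.
  by case; [rewrite -[1]/(1%:~R)|rewrite -[1]/(1%:~R) -rmorphN]=> /intr_inj ->.
have PC : map_poly ratr p = map_poly intr P :> {poly C} by rewrite eP map_ratr_int.
pose chi := char_poly (incidenceZ sigma).
have echi : map_poly ratr (map_poly intr chi) = char_poly (incidenceC R sigma) :> {poly C}.
  by rewrite map_ratr_int char_poly_incidenceC.
have chi0 : char_poly (incidenceC R sigma) != 0 by rewrite monic_neq0 // char_poly_monic.
have : p %| map_poly intr chi.
  apply: (minimal_polynomial_dvd mpC); rewrite echi -eigenvalue_root_char; exact: eig.
move=> /dvdpP[r er].
have erC : char_poly (incidenceC R sigma) = map_poly ratr r * map_poly intr P.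
  by rewrite -echi er rmorphM /= PC.
have simple (u v : {poly C}) : char_poly (incidenceC R sigma) = u * v -> root u (beta%:C) -> ~~ root v (beta%:C).
  move=> euv ru; apply/negP => rv.
  have : (2 <= mup (beta%:C : C) (char_poly (incidenceC R sigma)))%N.
    by rewrite mup_geq // euv expr2 dvdp_mul // dvdp_XsubCl.
  by rewrite mup1.
have rPC : root (map_poly intr P) (beta%:C : C) by rewrite -PC.
have nr : ~~ root (map_poly ratr r) (beta%:C : C) by apply: (simple (map_poly intr P)) => //; rewrite erC mulrC.
have [rs ers] := closed_field_poly_normal (map_poly ratr r : {poly C}).
have hrs z : z \in rs -> Defs.root_of_unity z \/ z = 0.
  move=> zr.
  have rz : root (map_poly ratr r) z.
    rewrite ers rootZ ?root_prod_XsubC //; apply: contraNneq chi0 => l0.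
    by rewrite erC ers l0 scale0r mul0r.
  have zb : z != beta%:C by apply: contraNneq nr => <-.
  have : eigenvalue (incidenceC R sigma) z by rewrite eigenvalue_root_char erC rootM rz.
  move=> /eigs /(_ zb) [[p' mp' rz']||]; [|by left|by right].
  have ep' := minimal_polynomial_uniq mpC mp'; subst p'; exfalso.
  have /dvdpP[s es] := irreducible_common_root ip rz' rz.
  by move: nr; rewrite es rmorphM rootM rpC orbT.
have [q q0 hq] := torsion_exponent hrs.
have [ps eps] := closed_field_poly_normal (map_poly intr P : {poly C}).
have lP : lead_coef (map_poly intr P : {poly C}) = 1.
  by rewrite lead_coef_map_inj ?rmorph0 ?(monicP mP) ?rmorph1 //; exact: intr_inj.
rewrite lP scale1r in eps.
have bps : (beta%:C : C) \in ps by move: rPC; rewrite eps root_prod_XsubC.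
have eps2 : map_poly intr P = ('X - (beta%:C : C)%:P) * \prod_(g <- rem (beta%:C : C) ps) ('X - g%:P).
  by rewrite eps (perm_big _ (perm_to_rem bps)) big_cons.
exists P, (rem (beta%:C : C) ps), (size rs), q; split=> //.
  apply/allP => g gps; apply: conj.
    by exists p => //; rewrite PC eps root_prod_XsubC; exact: mem_rem gps.
  apply: contraTneq gps => ->.
  have := simple ('X - (beta%:C : C)%:P) (map_poly ratr r * \prod_(g <- rem (beta%:C : C) ps) ('X - g%:P)).
  rewrite erC eps2 mulrCA => /(_ erefl); rewrite root_XsubC eqxx => /(_ isT).
  by rewrite rootM negb_or root_prod_XsubC => /andP[].
move=> w; apply: (@intr_inj C); rewrite rmorph0 pairing_map.
have : (map_poly intr chi : {poly C}) %| map_poly intr (P * ('X^(size rs) * ('X^q - 1) ^+ size rs)).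
  rewrite -char_poly_incidenceC erC mulrC rmorphM dvdp_mul // ers.
  rewrite !rmorphM !rmorphXn rmorphB /= map_polyXn rmorph1 map_polyX.
  apply: dvdp_trans (torsion_dvd hq); rewrite dvdpZl //.
  by apply: contraNneq chi0 => l0; rewrite erC ers l0 scale0r mul0r.
move=> /dvdpP[s ->]; rewrite mulrC pairing_mul big1 // => i _.
by rewrite -pairing_map pairing_char_poly rmorph0 mulr0.
Qed.

End Structure.

(** * Multiples with a dominant coefficient *)

Section DominantTheory.
Local Open Scope ring_scope.
Local Open Scope complex_scope.

Section L1.
Variable K : numDomainType.
Implicit Types p q : {poly K}.

(** A submultiplicative norm, see [l1M]. *)
Definition l1 p : K := \sum_(i < size p) `|p`_i|.

Lemma l1E n p : (size p <= n)%N -> l1 p = \sum_(i < n) `|p`_i|.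
Proof.
move=> le; apply: (sum_widen (F := fun i => `|p`_i|) le) => i h.
by rewrite nth_default ?normr0.
Qed.

Lemma l1_ge0 p : 0 <= l1 p.
Proof. exact: sumr_ge0. Qed.

Lemma l1D p q : l1 (p + q) <= l1 p + l1 q.
Proof.
pose n := maxn (size p) (size q).
rewrite !(@l1E n) ?leq_maxl ?leq_maxr ?size_polyD // -big_split; apply: ler_sum => i _.
by rewrite coefD ler_normD.
Qed.

Lemma l1Z c p : l1 (c *: p) = `|c| * l1 p.
Proof.
rewrite (@l1E (size p)) ?size_scale_leq // mulr_sumr; apply: eq_bigr => i _.
by rewrite coefZ normrM.
Qed.

Lemma l1N p : l1 (- p) = l1 p.
Proof. by rewrite -scaleN1r l1Z normrN1 mul1r. Qed.

Lemma l1Xn n : l1 'X^n = 1.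
Proof.
rewrite /l1 size_polyXn (bigD1 ord_max) //= coefXn eqxx normr1 big1 ?addr0 //.
by move=> i; rewrite coefXn -val_eqE /= => /negPf ->; rewrite normr0.
Qed.

Lemma l1MXn p n : l1 (p * 'X^n) = l1 p.
Proof.
rewrite (@l1E (n + size p)); last first.
  by apply: leq_trans (size_polyMleq _ _) _; rewrite size_polyXn addnS addnC.
rewrite /l1 -(big_mkord xpredT (fun i => `|(p * 'X^n)`_i|)).
rewrite (big_cat_nat (n := n)) ?leq_addr //= big_nat_cond big1 ?add0r.
  rewrite -{1}[n]add0n big_addn addKn big_mkord; apply: eq_bigr => i _.
  by rewrite coefMXn ltnNge leq_addl /= addnK.
by move=> i /andP[/andP[_ lt] _]; rewrite coefMXn lt normr0.
Qed.

Lemma l1M p q : l1 (p * q) <= l1 p * l1 q.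
Proof.
have sum I (r : seq I) (F : I -> {poly K}) : l1 (\sum_(i <- r) F i) <= \sum_(i <- r) l1 (F i).
  elim: r => [|i r IH]; first by rewrite !big_nil /l1 size_poly0 big_ord0.
  by rewrite !big_cons; apply: le_trans (l1D _ _) _; rewrite lerD2l.
rewrite -{1}[q]coefK poly_def mulr_sumr; apply: le_trans (sum _ _ _) _.
rewrite {2}/l1 mulr_sumr; apply: ler_sum => i _.
by rewrite -scalerAr l1Z l1MXn mulrC.
Qed.
End L1.

Section Dominated.
Variables (R : realType).
Notation C := (Cplx R).

(** Each factor is close to ['X^n] when [n] is large. *)
Lemma prod_powers_close (gs : seq C) (e : R) : all (fun g => `|g| < 1) gs -> 0 < e ->
  exists N, forall n, (N <= n)%N ->
    l1 (\prod_(g <- gs) ('X^n - (g ^+ n)%:P) - 'X^(n * size gs)) <= e%:C.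
Proof.
move=> + e0; elim: gs e e0 => [|g gs IH] e e0 /=.
  move=> _; exists 0%N => n _; rewrite big_nil muln0 expr0 subrr /l1 size_poly0 big_ord0.
  by rewrite ler0c ltW.
move=> /andP[g1 h]; have e3 : 0 < e / 3 by lra.
have [N hN] := IH _ e3 h.
have [r r0 er] := norm_real g.
have ar : `|r| < 1 by rewrite ger0_norm // -ltcR -er.
have [M _ hM] := (cvgr0Pnorm_le _).1 (cvg_expr ar) _ e3.
exists (maxn N M) => n; rewrite geq_max => /andP[nN nM].
have {}hN := hN n nN; have := hM n nM; rewrite /= ger0_norm ?exprn_ge0 // => gn.
have gn1 : r ^+ n <= 1 by apply: exprn_ile1 => //; rewrite ltW // -[r]ger0_norm.
rewrite big_cons; set G := \prod_(g <- gs) _ in hN *.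
have -> : ('X^n - (g ^+ n)%:P) * G - 'X^(n * (size gs).+1) =
    ('X^n - (g ^+ n)%:P) * (G - 'X^(n * size gs)) - (g ^+ n)%:P * 'X^(n * size gs).
  by rewrite mulnS exprD; ring.
apply: le_trans (l1D _ _) _; rewrite l1N mul_polyC l1Z l1Xn mulr1.
have ng : `|g ^+ n| = (r ^+ n)%:C by rewrite normrX er rmorphXn.
have a1 : l1 ('X^n - (g ^+ n)%:P) <= 2.
  apply: le_trans (l1D _ _) _; rewrite l1N l1Xn -alg_polyC l1Z -(expr0 'X) l1Xn mulr1 ng.
  by rewrite -[2]/(1 + 1) lerD2l -[1]/(1%:C) lecR.
apply: (@le_trans _ _ (2 * (e / 3)%:C + (r ^+ n)%:C)).
  rewrite ng lerD2r; apply: le_trans (l1M _ _) _.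
  by apply: ler_pM => //; exact: l1_ge0.
rewrite -[2]/(2%:R) -(rmorph_nat (real_complex R)) -rmorphM -rmorphD lecR; lra.
Qed.

Variables (beta : R) (P : {poly int}) (gs : seq C).
Hypothesis beta1 : 1 < beta.
Hypothesis fP : map_poly intr P = ('X - (beta%:C : C)%:P) * \prod_(g <- gs) ('X - g%:P).
Hypothesis gs1 : all (fun g => `|g| < 1) gs.

(** The polynomial [- ('X^n - beta^n) * prod ('X^n - g^n)] is a multiple of [P], and
    for large [n] its dominant term is [beta^n 'X^m].  Real parts of the
    coefficients of the cofactor give a real cofactor. *)
Lemma real_dominated_multiple : exists (V : {poly R}) j (B : R), 16%:R <= B /\
  l1 (map_poly intr P * V - B *: 'X^j) <= 13%:R / 32%:R * B.
Proof.
have e4 : 0 < 4^-1 :> R by lra.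
have [N hN] := prod_powers_close gs1 e4.
have [n nN bn] : exists2 n, (N <= n)%N & 16%:R <= beta ^+ n.
  have iv : `|beta^-1| < 1 by rewrite ger0_norm ?invr_ge0 ?(ltW (lt_trans ltr01 _)) // invf_lt1 // (lt_trans ltr01).
  have e8 : 0 < 16%:R^-1 :> R by lra.
  have [M _ hM] := (cvgr0Pnorm_le _).1 (cvg_expr iv) _ e8.
  exists (maxn N M); first exact: leq_maxl.
  have b0 : 0 < beta by exact: lt_trans beta1.
  have := hM _ (leq_maxr N M); rewrite /= ger0_norm ?exprn_ge0 ?invr_ge0 ?(ltW b0) // exprVn.
  by rewrite lef_pV2 ?posrE ?exprn_gt0 //; lra.
have {}hN := hN n nN; set m := (n * size gs)%N in hN; set G := \prod_(g <- gs) _ in hN.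
set E := G - 'X^m in hN.
pose W := - (('X^n - (beta%:C ^+ n : C)%:P) * G).
have eW : W - (beta ^+ n)%:C *: 'X^m = - 'X^(n + m) - ('X^n - (beta%:C ^+ n : C)%:P) * E.
  have -> : (beta ^+ n)%:C = beta%:C ^+ n :> C by rewrite rmorphXn.
  by rewrite /W /E exprD -mul_polyC; move: (_%:P) => b; ring.
have lW : l1 (W - (beta ^+ n)%:C *: 'X^m) <= (13%:R / 32%:R * beta ^+ n)%:C.
  rewrite eW; apply: le_trans (l1D _ _) _; rewrite !l1N l1Xn.
  apply: (@le_trans _ _ (1 + (1 + (beta ^+ n)%:C) * (4^-1)%:C)).
    rewrite lerD2l; apply: le_trans (l1M _ _) _; apply: ler_pM; rewrite ?l1_ge0 //.
    apply: le_trans (l1D _ _) _; rewrite l1N l1Xn -alg_polyC l1Z -(expr0 'X) l1Xn mulr1.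
    rewrite lerD2l -rmorphXn normc_def /= expr0n addr0 sqrtr_sqr ger0_norm //.
    by rewrite (le_trans _ bn).
  by rewrite -[1]/(1%:C) -!(rmorphD, rmorphM) lecR; move: bn; lra.
have [V eV] : exists V, W = map_poly intr P * V.
  suff : map_poly intr P %| W by move=> /dvdpP[V ->]; exists V; rewrite mulrC.
  rewrite fP dvdpNr dvdp_mul //.
    by rewrite dvdp_XsubCl /root !hornerE subrr.
  rewrite /G; elim: (gs) => [|g s IH]; first by rewrite !big_nil.
  by rewrite !big_cons dvdp_mul // dvdp_XsubCl /root !hornerE subrr.
pose VR : {poly R} := \poly_(i < size V) complex.Re V`_i.
have cVR i : VR`_i = complex.Re V`_i.
  by rewrite coef_poly; case: ltnP => // h; rewrite nth_default.
exists VR, m, (beta ^+ n); split => //.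
have Resum (I : Type) (r : seq I) (F : I -> C) : complex.Re (\sum_(i <- r) F i) = \sum_(i <- r) complex.Re (F i).
  by elim: r => [|i r IH]; rewrite ?big_nil // !big_cons -IH; case: (F i) (\sum_(j <- r) F j) => [a b] [a' b'].
have coefW i : (map_poly intr P * VR - beta ^+ n *: 'X^m)`_i = complex.Re (W - (beta ^+ n)%:C *: 'X^m)`_i.
  rewrite !coefB !coefZ !coefXn eV !coefM.
  have -> (z : C) (b : R) (l : nat) : complex.Re (z - b%:C * l%:R) = complex.Re z - b * l%:R.
    by rewrite -(rmorph_nat (real_complex R)) -rmorphM; case: z.
  congr (_ - _); rewrite Resum; apply: eq_bigr => k _.
  rewrite cVR 2!coef_map /=. rewrite -(rmorph_int (real_complex R)).
  by case: (V`_(i - k)) => a b /=; rewrite mul0r subr0.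
set Y := map_poly intr P * VR - _ in coefW *; set Z := W - _ in lW coefW.
rewrite -lecR; apply: le_trans lW.
rewrite (@l1E _ (maxn (size Y) (size Z)) Y) ?leq_maxl // (@l1E _ (maxn (size Y) (size Z)) Z) ?leq_maxr //.
rewrite rmorph_sum; apply: ler_sum => i _; rewrite coefW; exact: normc_ge_Re.
Qed.

(** The real cofactor is scaled by a large integer [k] and rounded; the rounding
    error is bounded by [c], independently of [k]. *)
Lemma dominated_multiple : exists (V : {poly int}) j,
  \sum_(i < size (P * V)) `|(P * V)`_i| < 2 * (P * V)`_j.
Proof.
have [V [j [B [B8 lV]]]] := real_dominated_multiple.
pose c : R := l1 (map_poly intr P : {poly R}) * (size V)%:R.
have c0 : 0 <= c by rewrite mulr_ge0 // l1_ge0.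
pose k := (Num.truncn c).+1.
have ck : c < k%:R by have /andP[] := truncn_itv c0.
have k0 : 0 < k%:R :> R by rewrite ltr0n.
pose VZ : {poly int} := \poly_(i < size V) Num.floor (k%:R * V`_i).
exists VZ, j; set r := P * VZ.
pose rR : {poly R} := map_poly intr r.
have l1r : l1 (rR - (k%:R * B) *: 'X^j) < k%:R * B / 2.
  have -> : rR - (k%:R * B) *: 'X^j = k%:R *: (map_poly intr P * V - B *: 'X^j) +
     map_poly intr P * (map_poly intr VZ - k%:R *: V).
    by rewrite /rR /r rmorphM /= scalerBr scalerA mulrBr -!scalerAr; ring.
  apply: le_lt_trans (l1D _ _) _; rewrite l1Z ger0_norm ?ltW //.
  have h1 : l1 (map_poly intr P * (map_poly intr VZ - k%:R *: V)) <= c.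
    apply: le_trans (l1M _ _) _; rewrite /c ler_wpM2l ?l1_ge0 //.
    rewrite (@l1E _ (size V)); last first.
      apply: leq_trans (size_polyD _ _) _; rewrite geq_max size_polyN (leq_trans (size_scale_leq _ _)) // andbT.
      by apply: leq_trans (size_poly _ _) _; exact: size_poly.
    rewrite -[X in _ <= X]mul1r -[X in X * _]/1 mul1r.
    apply: (@le_trans _ _ (\sum_(i < size V) 1)); last by rewrite sumr_const card_ord.
    apply: ler_sum => i _; rewrite coefB coef_map coefZ /VZ coef_poly ltn_ord /=.
    have /andP[h1] := floor_itv (k%:R * V`_i); rewrite rmorphD /= => h2.
    by rewrite distrC ger0_norm; lra.
  have h2 : k%:R * l1 (map_poly intr P * V - B *: 'X^j) <= k%:R * (13%:R / 32%:R * B) by rewrite ler_pM2l.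
  have h3 : 16%:R * k%:R <= k%:R * B by rewrite mulrC ler_pM2l.
  move: h1 h2; set x := l1 (_ - B *: _); set y := l1 (_ * (_ - _)) => h1 h2; lra.
have rB m : (size rR <= m)%N -> (j < m)%N -> \sum_(i < m) `|(r`_i)%:~R - (k%:R * B) * (i == j :> nat)%:R| < k%:R * B / 2.
  move=> sm jm; apply: le_lt_trans l1r; rewrite (@l1E _ m).
    by apply: ler_sum => i _; rewrite coefB coef_map coefZ coefXn.
  apply: leq_trans (size_polyD _ _) _; rewrite geq_max sm size_polyN.
  by apply: leq_trans (size_scale_leq _ _) _; rewrite size_polyXn.
have kB : 0 < k%:R * B by apply: mulr_gt0 => //; lra.
pose m := maxn (size r) j.+1.
have sr : (size rR <= m)%N by rewrite size_map_inj_poly //; [exact: leq_maxl|exact: intr_inj].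
have jm : (j < m)%N by exact: leq_maxr.
have sumr : \sum_(i < size r) `|r`_i| = \sum_(i < m) `|r`_i|.
  exact: (@l1E int m r (leq_maxl _ _)).
have := rB m sr jm; rewrite (bigD1 (Ordinal jm)) //= eqxx mulr1 => h.
rewrite sumr (bigD1 (Ordinal jm)) //=.
rewrite -(ltr_int R) rmorphD rmorphM /= rmorph_sum /=.
have e1 : \sum_(i < m | i != Ordinal jm) `|r`_i|%:~R = \sum_(i < m | i != Ordinal jm) `|(r`_i)%:~R - (k%:R * B) * (i == j :> nat)%:R| :> R.
  by apply: eq_bigr => i ij; rewrite intr_norm -val_eqE /= in ij *; rewrite (negPf ij) mulr0 subr0.
rewrite e1; move: h; set s := \sum_(i < m | _) _; rewrite intr_norm.
have s0 : 0 <= s by apply: sumr_ge0.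
set x : R := (r`_j)%:~R => h.
have := ler_norm (k%:R * B - x); rewrite distrC => h2.
have x0 : 0 < x by lra.
by rewrite ger0_norm ?ltW //; lra.
Qed.

End Dominated.

End DominantTheory.

(** * Certificates on finite words *)

Section CertificateTheory.
Local Open Scope ring_scope.
Local Open Scope complex_scope.

Section ClosedWords.
Variables (A : finType) (sigma : substitution A).
Implicit Types (a b : A) (u v w : seq A).
Notation siter := (siter sigma).
Notation lang := (lang sigma).
Notation sw := (subst_word sigma).

(** Stability of the set of pairs under the substitution is a finite condition, and
    by induction it makes all pairs of the language occur in [u]. *)
Definition closed_word u := (forall a, a \in u) /\
  forall a b, infix [:: a; b] (sw u) -> infix [:: a; b] u.

Lemma infix_pair_cat a b (s t : seq A) : infix [:: a; b] (s ++ t) ->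
  [\/ infix [:: a; b] s, infix [:: a; b] t | exists s' t', s = rcons s' a /\ t = b :: t'].
Proof.
elim: s => [|x s IH]; first by constructor 2.
rewrite cat_cons infix_consl => /orP[|/IH[h|h|[s' [t' [-> ->]]]]].
- rewrite prefix_cons => /andP[/eqP <-]; case: s {IH} => [|y s] /=.
    case: t => [|y t] //= /andP[/eqP <- _].
    by constructor 3; exists [::], t.
  case/andP => /eqP -> _; constructor 1.
  by rewrite /= ?eqxx ?prefix0s.
- by constructor 1; rewrite infix_consl h orbT.
- by constructor 2.
- by constructor 3; exists (x :: s'), t'.
Qed.

Lemma closed_word_pairs u : closed_word u -> forall a b, lang [:: a; b] -> infix [:: a; b] u.
Proof.
move=> [lu pu] a b [n [c]]; elim: n a b => [|n IH] a b.
  by move=> /size_infix.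
rewrite siterS'.
have sub x y : infix [:: x; y] u -> infix (sigma x ++ sigma y) (sw u).
  by move=> /(siter_infix sigma 1); rewrite siter1 /subst_word /= cats0.
have sub1 x : infix (sigma x) (sw u).
  by have /(siter_infix sigma 1) : infix [:: x] u; rewrite ?infix1s // siter1 /subst_word /= cats0.
have H v : (forall x y, infix [:: x; y] v -> infix [:: x; y] u) -> infix [:: a; b] (sw v) -> infix [:: a; b] u.
  elim: v => [|x v IHv] hv; first by rewrite infixs0.
  move=> /infix_pair_cat[h|h|[s [t [e1 e2]]]].
  - by apply: pu; apply: infix_trans h (sub1 x).
  - by apply: IHv h => y z h; apply: hv; rewrite infix_consl h orbT.
  - case: v e2 hv {IHv} => [|y v] // e2 hv.
    apply: pu; apply: infix_trans (sub x y (hv _ _ _)); last first.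
      by rewrite infix_consl prefix_cons eqxx prefix_cons eqxx prefix0s.
    have := subst_letter_gt0 sigma y; move: e2 => /=.
    case: (sigma y) => [|y0 sy] // [-> _] _.
    by apply/infixP; exists s, sy; rewrite e1 -cats1 -catA.
by apply: H => x y; exact: IH.
Qed.

(** The restriction of [cobounding] to the loops that can be seen in [u], put as an
    equality of sums from the beginning of [u]. *)
Definition cob_on (p : {poly int}) u := forall i j x0, (i < size u)%N -> (j < size u)%N ->
  nth x0 u i = nth x0 u j -> pairing sigma p (take i u) = pairing sigma p (take j u).

(** The sums from the beginning of [u] define the height of a letter.  As all pairs
    of the language occur in [u], the pairing with a letter is a difference of
    heights at the next letter and at this one, everywhere in the language. *)
Lemma cob_on_cobounding p u : closed_word u -> cob_on p u -> cobounding sigma p.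
Proof.
move=> cu pu h [a0 [v [-> lv]]].
have lu := cu.1.
pose phi a := pairing sigma p (take (index a u) u).
have phiE i : (i < size u)%N -> pairing sigma p (take i u) = phi (nth a0 u i).
  by move=> iu; apply: (pu _ _ a0) => //; rewrite ?index_mem ?nth_index.
have pair a b : lang [:: a; b] -> pairing sigma p [:: a] = phi b - phi a.
  move=> /(closed_word_pairs cu)/infixP[s [t e]].
  have h1 := phiE (size s); have h2 := phiE (size s).+1.
  rewrite e !size_cat /= in h1 h2.
  have {}h1 : pairing sigma p s = phi a.
    by have := h1 ltac:(lia); rewrite take_size_cat // nth_cat ltnn subnn.
  have {}h2 : pairing sigma p (s ++ [:: a]) = phi b.
    have := h2 ltac:(lia); rewrite -cat1s catA take_size_cat; last by rewrite size_cat addn1.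
    by move=> ->; rewrite nth_cat size_cat addn1 ltnn subnn.
  by rewrite -h1 -h2 pairing_cat addrAC subrr add0r.
suff H w b c : lang (rcons (b :: w) c) -> pairing sigma p (b :: w) = phi c - phi b.
  by rewrite (H _ _ _ lv) subrr.
elim: w b => [|d w IH] b lw; first exact: pair.
have l1 : lang [:: b; d].
  by apply: lang_infix lw _; apply/infixP; exists [::], (rcons w c).
have l2 : lang (rcons (d :: w) c).
  by apply: lang_infix lw _; apply/infixP; exists [:: b], [::]; rewrite cats0.
by rewrite -cat1s pairing_cat (pair _ _ l1) IH //; ring.
Qed.

Lemma not_cob_on p u : lang u -> ~ cob_on p u ->
  exists2 h, loop sigma h & pairing sigma p h != 0.
Proof.
move=> lu nc; apply: contrapT => nh; apply: nc => i j x0 iu ju e.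
wlog ij : i j iu ju e / (i <= j)%N.
  by move=> H; have [le|/ltnW le] := leqP i j; [exact: H|apply/esym; exact: H].
move: ij; rewrite leq_eqVlt => /orP[/eqP ->//|ij].
have et : take j u = take i u ++ drop i (take j u).
  by rewrite -{1}(cat_take_drop i (take j u)) take_takel // ltnW.
rewrite et pairing_cat; set h := drop i (take j u).
suff -> : pairing sigma p h = 0 by rewrite addr0.
apply/eqP; apply: contraT => ph; exfalso; apply: nh; exists h => //.
have sh : (0 < size h)%N by rewrite size_drop size_takel ?subn_gt0 // ltnW.
have hh : nth x0 h 0 = nth x0 u i by rewrite nth_drop addn0 nth_take.
case eh : h sh hh => [|a v] // _ /= ea.
exists a, v; split => //; apply: lang_infix lu _.
rewrite -eh -cats1 ea e; apply/infixP; exists (take i u), (drop j.+1 u).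
by rewrite -catA /= -drop_nth // catA -et cat_take_drop.
Qed.

Hypothesis prim : primitive_substitution sigma.

Lemma finite_eventually (T : finType) (Q : T -> nat -> Prop) :
  (forall t, exists n, forall m, (n <= m)%N -> Q t m) -> exists n, forall m, (n <= m)%N -> forall t, Q t m.
Proof.
move=> /choice[f hf]; exists (\max_t f t)%N => m le t; apply: hf.
exact: leq_trans (leq_bigmax t) le.
Qed.

Lemma closed_word_siter : exists n, forall m, (n <= m)%N -> forall a0, closed_word (siter m [:: a0]).
Proof.
have [n1 h1] : exists n, forall m, (n <= m)%N -> forall ab : A * A, lang [:: ab.1; ab.2] -> forall a0, infix [:: ab.1; ab.2] (siter m [:: a0]).
  apply: finite_eventually => ab.
  have [/(lang_eventually prim)[n hn]|nl] := pselect (lang [:: ab.1; ab.2]); last by exists 0%N.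
  by exists n => m nm _ a0; exact: hn.
have [n2 h2] := primitive_mem prim.
exists (maxn n1 n2) => m; rewrite geq_max => /andP[m1 m2] a0; split; first by move=> a; exact: h2.
move=> a b ab; apply: (h1 m m1 (a, b)); exists m.+1, a0; exact: ab.
Qed.

End ClosedWords.

Section Dichotomy.
Variables (R : realType) (A : finType) (sigma : substitution A) (beta : R) (d : nat).
Hypothesis wip : weakly_irreducible_pisot R sigma.
Hypothesis pb : perron_eigenvalue sigma beta.
Hypothesis db : has_degree beta d.+1.

(** Along the loop [h], the combination [t] of the lengths of the iterates is a
    non-zero periodic sequence. *)
Definition torsion_case := exists (t : {poly int}) q h, [/\ (0 < q)%N, loop sigma h,
  pairing sigma t h != 0 & cobounding sigma (('X^q - 1) * t)].

Let prim : primitive_substitution sigma.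
Proof. by case: wip. Qed.

Lemma perron_gt1 : 1 < beta.
Proof. by have [P [gs [N [q [[]]]]]] := weakly_irreducible_structure wip pb db. Qed.

Lemma lang_unbounded n : exists w, lang sigma w /\ (n <= size w)%N.
Proof. by case: pb => e _ _; exact: eigenvalue_unbounded perron_gt1 e n. Qed.

(** Starting from the polynomial of [weakly_irreducible_structure], factors
    ['X^q - 1] are removed as long as the result is cobounding. *)
Theorem torsion_or_cobounding : torsion_case \/
  exists (P : {poly int}) gs N, [/\ [/\ 1 < beta, size P = d.+2, P \is monic & P`_0 * P`_0 = 1],
   map_poly intr P = ('X - (beta%:C : Cplx R)%:P) * \prod_(g <- gs) ('X - g%:P),
   all (fun g => `|g| < 1) gs & cobounding sigma (P * 'X^N)].
Proof.
have [P [gs [N [q [hP fP gs1 q0 h0]]]]] := weakly_irreducible_structure wip pb db.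
pose Q j := P * ('X^N * ('X^q - 1) ^+ j).
have QN : cobounding sigma (Q N) by move=> w _; exact: h0.
have QS j : Q j.+1 = ('X^q - 1) * Q j by rewrite /Q exprS; ring.
have [c0|nc0] := pselect (cobounding sigma (Q 0%N)).
  by right; exists P, gs, N; split => //; move: c0; rewrite /Q expr0 mulr1.
left; suff H n : cobounding sigma (Q n) -> torsion_case by exact: H QN.
elim: n => [|n IH] cn; first by case: nc0.
have [c|nc] := pselect (cobounding sigma (Q n)); first exact: IH.
have /existsNP[h /not_implyP[lh /eqP ph]] := nc.
by exists (Q n), q, h; split => //; rewrite -QS.
Qed.

Lemma torsion_case_eigenvalues : torsion_case -> only_root_of_unity_eigenvalues R sigma.
Proof.
move=> [t [q [h [q0 lh th ct]]]] eta [eta1 [f [cf f1 fS]]].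
exact: (eigenvalue_torsion prim lang_unbounded eta1 cf f1 fS q0 lh th ct).
Qed.

End Dichotomy.

End CertificateTheory.

(** * The coboundary case *)

Section CertificateExistence.
Local Open Scope ring_scope.
Local Open Scope complex_scope.

Section CoboundingCase.
Variables (R : realType) (A : finType) (sigma : substitution A) (beta : R) (d : nat).
Hypothesis wip : weakly_irreducible_pisot R sigma.
Hypothesis pb : perron_eigenvalue sigma beta.
Hypothesis db : has_degree beta d.+1.
Variables (P : {poly int}) (gs : seq (Cplx R)) (N : nat).
Hypothesis beta1 : 1 < beta.
Hypothesis sP : size P = d.+2.
Hypothesis mP : P \is monic.
Hypothesis P0 : P`_0 * P`_0 = 1.
Hypothesis fP : map_poly intr P = ('X - (beta%:C : Cplx R)%:P) * \prod_(g <- gs) ('X - g%:P).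
Hypothesis gs1 : all (fun g => `|g| < 1) gs.
Hypothesis cP : cobounding sigma (P * 'X^N).

Lemma bounded_on_lang_real (p : {poly R}) :
  bounded_on_lang sigma (map_poly (real_complex R) p) -> bounded_on_lang sigma p.
Proof.
move=> [C hC]; exists (complex.Re C) => w /hC.
rewrite -pairing_map normc_def /= expr0n addr0 sqrtr_sqr => h.
have Cr : C \is Num.real by apply: ger0_real; apply: le_trans h; rewrite ler0c.
by rewrite -lecR RRe_real.
Qed.

Lemma bounded_on_lang_peels (K : numFieldType) (p : {poly K}) (rs : seq K) : all (fun g => `|g| < 1) rs ->
  bounded_on_lang sigma (p * \prod_(g <- rs) ('X - g%:P)) -> bounded_on_lang sigma p.
Proof.
elim: rs p => [|g rs IH] p /=; first by rewrite big_nil mulr1.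
by move=> /andP[g1 h]; rewrite big_cons mulrA => /(IH _ h); exact: bounded_on_lang_peel.
Qed.

(** The cobounding polynomial is bounded on the language, and all its roots but
    [beta] lie in the open unit disk, hence can be peeled off. *)
Lemma cobounding_balance : bounded_on_lang sigma ('X - beta%:P).
Proof.
apply: bounded_on_lang_real; rewrite rmorphB /= map_polyX map_polyC /=.
apply: (bounded_on_lang_peels gs1); rewrite -fP.
have h0 : all (fun g : Cplx R => `|g| < 1) (nseq N 0) by apply/allP => g /nseqP[-> _]; rewrite normr0.
apply: (bounded_on_lang_peels h0).
have -> : \prod_(g <- nseq N (0 : Cplx R)) ('X - g%:P) = 'X^N.
  by rewrite big_nseq subr0 -[RHS]mulr1; elim: (N) => [|n IH] /=; rewrite ?expr0 ?mul1r // IH exprS mulrA.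
apply: cobounding_bounded => w lw.
have -> : map_poly intr P * 'X^N = map_poly intr (P * 'X^N) :> {poly Cplx R} by rewrite rmorphM /= map_polyXn.
by rewrite -pairing_map cP // rmorph0.
Qed.

Lemma root_real : root (map_poly intr P) beta.
Proof.
have : root (map_poly intr P) (beta%:C : Cplx R) by rewrite fP rootM root_XsubC eqxx.
have -> : map_poly intr P = map_poly (real_complex R) (map_poly intr P) :> {poly Cplx R}.
  by rewrite -map_poly_comp; apply: eq_map_poly => z /=; rewrite rmorph_int.
by rewrite fmorph_root.
Qed.

(** In degree 1 the unit [beta] would be 1 or -1, which [1 < beta] excludes. *)
Lemma degree_gt0 : (0 < d)%N.
Proof.
rewrite lt0n; apply/eqP => d0; move: sP; rewrite d0 => sP'.
have P1 : P`_1 = 1 by move: mP; rewrite monicE lead_coefE sP' => /eqP.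
have := root_real; rewrite /root horner_coef size_map_inj_poly // ?sP'; last exact: intr_inj.
rewrite !big_ord_recl big_ord0 !coef_map /= P1 expr0 expr1 mulr1 mul1r addr0 => /eqP e.
have : (P`_0)%:~R * (P`_0)%:~R = 1 :> R by rewrite -intrM P0.
move: e; set x : R := _%:~R => e; have -> : x = - beta by apply/eqP; rewrite -subr_eq0 opprK; apply/eqP.
by rewrite mulrNN => e2; have := beta1; nra.
Qed.

Lemma cobounding_extension : finite_extension_of_minimal_translation R d sigma.
Proof.
have prim : primitive_substitution sigma by case: wip.
have ub := lang_unbounded wip pb db; have := degree_gt0.
case: d sP => [|d'] // sP' _.
exact: (finite_extension prim ub beta1 cobounding_balance sP' mP P0 root_real cP fP gs1).
Qed.

(** Multiples of a cobounding polynomial are cobounding. *)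
Lemma cobounding_dominated : exists (r : {poly int}) j, cobounding sigma r /\
  \sum_(i < size r) `|r`_i| < 2 * r`_j.
Proof.
have [V [j h]] := dominated_multiple beta1 fP gs1.
exists (P * V * 'X^N), (j + N)%N; split.
  by rewrite mulrAC; exact: cobounding_mul.
rewrite coefMXn ltnNge leq_addl /= addnK.
have := l1MXn (P * V) N; rewrite /l1 => ->; exact: h.
Qed.

End CoboundingCase.

Section Certificates.
Variables (A : finType) (sigma : substitution A).

Definition difference_poly (c c' : seq nat) : {poly int} :=
  Poly (map Posz c) - Poly (map Posz c').

Lemma coef_difference_poly c c' i : (difference_poly c c')`_i = Posz (nth 0%N c i) - Posz (nth 0%N c' i).
Proof.
have H s : (Poly (map Posz s))`_i = Posz (nth 0%N s i).
  rewrite coef_Poly; have [lt|le] := ltnP i (size s); first by rewrite (nth_map 0%N).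
  by rewrite !nth_default // size_map.
by rewrite coefB !H.
Qed.

(** The two lists are the positive and the negative parts of the coefficients. *)
Lemma difference_polyP (p : {poly int}) : exists c c', difference_poly c c' = p /\
  Posz (sumn c + sumn c') = \sum_(i < size p) `|p`_i| /\ forall j, 0 < p`_j -> Posz (nth 0%N c j) = p`_j.
Proof.
pose pos (z : int) := if z is Posz n then n else 0%N.
pose neg (z : int) := if z is Negz n then n.+1 else 0%N.
have np i : nth 0%N (map pos p) i = pos p`_i.
  by have [lt|le] := ltnP i (size p); [rewrite (nth_map 0)|rewrite !nth_default // size_map].
have nn i : nth 0%N (map neg p) i = neg p`_i.
  by have [lt|le] := ltnP i (size p); [rewrite (nth_map 0)|rewrite !nth_default // size_map].
exists (map pos p), (map neg p); split; [|split].
- apply/polyP => i; rewrite coef_difference_poly np nn.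
  by case: (p`_i) => n; rewrite /= ?subr0 // sub0r -NegzE.
- rewrite PoszD -(big_mkord xpredT (fun i => `|p`_i|)) -(big_nth 0 xpredT (fun z => `|z|)).
  elim: (p : seq int) => [|z s IH]; first by rewrite big_nil.
  rewrite big_cons.
  have -> : `|z| = Posz (pos z) + Posz (neg z).
    by case: z => n; rewrite /= ?addr0 ?add0r // NegzE normrN.
  by rewrite -IH !PoszD; ring.
- by move=> j; rewrite np; case: (p`_j).
Qed.

Lemma dominated_sum (x : nat -> int) (c c' : seq nat) j (M : int) :
  (forall i, `|x i| <= M) -> `|x j| = M -> 0 < M ->
  (sumn c + sumn c' < 2 * nth 0%N c j)%N ->
  \sum_(i < size (difference_poly c c')) (difference_poly c c')`_i * x i != 0.
Proof.
move=> hM xj M0 dom; pose m := maxn (maxn (size c) (size c')) (maxn (size (difference_poly c c')) j.+1).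
have -> : \sum_(i < size (difference_poly c c')) (difference_poly c c')`_i * x i = \sum_(i < m) (difference_poly c c')`_i * x i.
  apply: (sum_widen (F := fun i => (difference_poly c c')`_i * x i)) => [|i h].
    by rewrite /m !leq_max leqnn !orbT.
  by rewrite nth_default ?mul0r.
have sum_nth s : (size s <= m)%N -> Posz (sumn s) = \sum_(i < m) Posz (nth 0%N s i).
  move=> sm; rewrite sumnE (big_nth 0%N) big_mkord (big_morph Posz PoszD (erefl _)).
  by apply: (sum_widen (F := fun i => Posz (nth 0%N s i)) sm) => i h; rewrite nth_default.
have jm : (j < m)%N by rewrite /m; lia.
apply/eqP => e.
have e2 : Posz (nth 0%N c j) * x j = - \sum_(i < m | i != Ordinal jm) Posz (nth 0%N c i) * x i + \sum_(i < m) Posz (nth 0%N c' i) * x i.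
  have : \sum_(i < m) Posz (nth 0%N c i) * x i - \sum_(i < m) Posz (nth 0%N c' i) * x i = 0.
    rewrite -sumrB -[RHS]e; apply: eq_bigr => i _; rewrite coef_difference_poly; ring.
  rewrite (bigD1 (Ordinal jm)) //=; set s1 := \sum_(i < m | _) _; set s2 := \sum_(i < m) _.
  by clearbody s1 s2; move: (_ * _) => z e3; clear - e3; lia.
have n1 : Posz (nth 0%N c j) * M <= \sum_(i < m | i != Ordinal jm) Posz (nth 0%N c i) * M + \sum_(i < m) Posz (nth 0%N c' i) * M.
  rewrite -xj -[X in X * _]ger0_norm // -normrM e2; apply: le_trans (ler_normD _ _) _; rewrite normrN xj.
  by apply: lerD; apply: le_trans (ler_norm_sum _ _ _) _; apply: ler_sum => i _; rewrite normrM ler_wpM2l //.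
rewrite -!mulr_suml -mulrDl ler_pM2r // in n1.
have s1 := sum_nth c; have s2 := sum_nth c'.
have {}s1 := s1 ltac:(rewrite /m; lia); have {}s2 := s2 ltac:(rewrite /m; lia).
rewrite (bigD1 (Ordinal jm)) //= in s1; rewrite -s2 in n1.
move: n1 s1 dom; set y := \sum_(i < m | _) _; lia.
Qed.

(** A cobounding polynomial annihilates the periodic sequence of [torsion_case].
    Where the dominant coefficient meets a term of maximal modulus, all other terms
    together are too small to cancel it. *)
Lemma dominated_not_torsion c c' j : cobounding sigma (difference_poly c c') ->
  (sumn c + sumn c' < 2 * nth 0%N c j)%N -> ~ torsion_case sigma.
Proof.
move=> cr dom [t [q [h [q0 lh th ct]]]].
pose x n := pairing sigma t (siter sigma n h).
have per n : x (n + q)%N = x n.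
  have := ct _ (loop_siter n lh); rewrite mulrBl mul1r pairingB mulrC pairing_mulXn -siterD => /eqP.
  by rewrite subr_eq0 addnC => /eqP.
have perm n m : x (n + m * q)%N = x n by elim: m => [|m IH]; rewrite ?addn0 // mulSn addnCA addnC per.
pose M : nat := (\max_(i < q) absz (x i))%N.
have xq n : x n = x (n %% q)%N by rewrite {1}(divn_eq n q) addnC perm.
have hM n : `|x n| <= Posz M.
  rewrite xq -abszE lez_nat.
  exact: (leq_bigmax (F := fun i : 'I_q => absz (x i)) (Ordinal (ltn_pmod n q0))).
have M0 : 0 < Posz M.
  apply: lt_le_trans (hM 0%N); rewrite normr_gt0; exact: th.
have [i0 hi0] : exists i0 : 'I_q, M = absz (x i0).
  by have [|i0 _ e] := @eq_bigmax_cond _ xpredT (fun i : 'I_q => absz (x i)); [rewrite card_ord|exists i0].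
(* [n + j] is congruent to [i0] modulo [q] *)
pose n := (i0 + (q * j - j))%N.
have nj : (n + j = i0 + j * q)%N by rewrite /n; nia.
have xj : `|x (n + j)%N| = Posz M by rewrite nj perm -abszE hi0.
have /eqP := @dominated_sum (fun i => x (n + i)%N) c c' j (Posz M) (fun i => hM (n + i)%N) xj M0 dom; apply.
have := cobounding_mul t cr (loop_siter n lh); rewrite mulrC pairing_mul => e.
rewrite -[RHS]e; apply: eq_bigr => i _.
by rewrite -siterD /x addnC.
Qed.

End Certificates.

End CertificateExistence.

(** * Computable functions *)

Section Computable.
Implicit Types (v : seq nat) (f g h : seq nat -> nat).

(** A function of [n] arguments is applied to the list of their values, which lets
    bound variables be added in front of the list. *)
Definition computable n f := exists p : murec n, forall v : n.-tuple nat, murec_eval p v (f v).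

Lemma computable_ext n f g : (forall v : n.-tuple nat, f v = g v) -> computable n f -> computable n g.
Proof. by move=> fg [p hp]; exists p => v; rewrite -fg. Qed.

Lemma computable_var n k : k < n -> computable n (nth 0 ^~ k).
Proof. by move=> kn; exists (MuProj (Ordinal kn)) => v /=; rewrite (tnth_nth 0). Qed.

Lemma computable_comp m n f (gs : seq (seq nat -> nat)) : size gs = m -> computable m f ->
  (forall i, i < m -> computable n (nth (fun _ => 0) gs i)) ->
  computable n (fun v => f [seq g v | g <- gs]).
Proof.
move=> sg [p hp] hg; have /choice[q hq] : forall i : 'I_m, exists q : murec n,
    forall v : n.-tuple nat, murec_eval q v (nth (fun _ => 0) gs i v).
  by move=> i; have [q hq] := hg i (ltn_ord i); exists q.
exists (MuComp p q) => v /=.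
have sz : size [seq g v | g <- gs] == m by rewrite size_map sg.
exists (Tuple sz); split; last exact: (hp (Tuple sz)).
by move=> i; rewrite (tnth_nth 0) /= (nth_map (fun _ => 0)) ?sg //; exact: hq.
Qed.

Lemma computable_succ n f : computable n f -> computable n (fun v => (f v).+1).
Proof.
move=> cf; have c1 : computable 1 (fun v => (nth 0 v 0).+1).
  by exists MuSucc => v /=; rewrite /thead (tnth_nth 0).
by apply: (@computable_comp 1 n (fun v => (nth 0 v 0).+1) [:: f]) => // -[].
Qed.

Lemma computable_const n c : computable n (fun _ => c).
Proof. by elim: c => [|c IH]; [exists (MuZero n)|exact: computable_succ]. Qed.

Definition fn1 (h : nat -> nat) := computable 1 (fun v => h (nth 0 v 0)).
Definition fn2 (h : nat -> nat -> nat) := computable 2 (fun v => h (nth 0 v 0) (nth 0 v 1)).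
Definition fn3 (h : nat -> nat -> nat -> nat) :=
  computable 3 (fun v => h (nth 0 v 0) (nth 0 v 1) (nth 0 v 2)).

Lemma computable1 (h1 : nat -> nat) n f : fn1 h1 -> computable n f -> computable n (fun v => h1 (f v)).
Proof. by move=> ch cf; apply: (computable_comp (gs := [:: f]) _ ch) => // -[]. Qed.

Lemma computable2 (h2 : nat -> nat -> nat) n f g : fn2 h2 -> computable n f -> computable n g ->
  computable n (fun v => h2 (f v) (g v)).
Proof. by move=> ch cf cg; apply: (computable_comp (gs := [:: f; g]) _ ch) => // -[|[]]. Qed.

Lemma computable3 (h3 : nat -> nat -> nat -> nat) n f g h : fn3 h3 -> computable n f -> computable n g -> computable n h ->
  computable n (fun v => h3 (f v) (g v) (h v)).
Proof. by move=> ch cf cg chh; apply: (computable_comp (gs := [:: f; g; h]) _ ch) => // -[|[|[]]]. Qed.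

Definition primrec f (step : seq nat -> nat) (k : seq nat -> nat) v :=
  nat_rect (fun _ => nat) (f v) (fun i acc => step [:: i, acc & v]) (k v).

Lemma computable_primrec n f step k : computable n f -> computable n.+2 step -> computable n k ->
  computable n (primrec f step k).
Proof.
move=> [p hp] [q hq] ck.
have c : computable n.+1 (fun v => nat_rect (fun _ => nat) (f (behead v)) (fun i acc => step [:: i, acc & behead v]) (head 0 v)).
  exists (MuPrim p q) => V.
  have -> : head 0 V = thead V by case/tupleP: V => x v; rewrite theadE.
  rewrite /=; elim: (thead V) => [|x IH]; first exact: (hp [tuple of behead V]).
  by eexists; split; [exact: IH|exact: (hq [tuple of x :: _ :: behead V])].
apply: (computable_ext _ (computable_comp (gs := k :: [seq (nth 0 ^~ i) | i <- iota 0 n]) _ c _)).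
- move=> v /=; rewrite -map_comp /primrec.
  have -> : [seq (((@^~ v) \o (fun i => nth 0 ^~ i)) i) | i <- iota 0 n] = v.
    apply: (@eq_from_nth _ 0); rewrite size_map size_iota ?size_tuple // => i lt.
    by rewrite (nth_map 0) ?size_iota // nth_iota.
  by [].
- by rewrite /= size_map size_iota.
- case=> [|i] //=; rewrite ltnS => lt; rewrite (nth_map 0) ?size_iota // nth_iota //.
  exact: computable_var.
Qed.

Notation var k n := (computable_var (isT : k < n)).

(** Unbounded search, for a function that is known to be total. *)
Lemma computable_min n g f : computable n.+1 g ->
  (forall v, g (f v :: v) = 0 /\ forall k, k < f v -> 0 < g (k :: v)) -> computable n f.
Proof.
move=> [p hp] h; exists (MuMin p) => v /=; have [h1 h2] := h v; split.
  by have := hp [tuple of f v :: v]; rewrite h1.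
move=> k /h2; have := hp [tuple of k :: v] => /=.
by case: (g (k :: v)) => // z hz _; exists z.
Qed.

Lemma fn_pred : fn1 predn.
Proof.
apply: (computable_ext _ (computable_primrec (computable_const 1 0) (var 0 3) (var 0 1))).
by move=> v; rewrite /primrec; case: (nth 0 v 0).
Qed.

Lemma fn_add : fn2 addn.
Proof.
apply: (computable_ext _ (computable_primrec (var 0 2) (computable_succ (var 1 4)) (var 1 2))).
by move=> v; rewrite /primrec; elim: (nth 0 v 1) => [|k IH] /=; rewrite ?addn0 // IH addnS.
Qed.

Lemma fn_sub : fn2 subn.
Proof.
apply: (computable_ext _ (computable_primrec (var 0 2) (computable1 fn_pred (var 1 4)) (var 1 2))).
by move=> v; rewrite /primrec; elim: (nth 0 v 1) => [|k IH] /=; rewrite ?subn0 // IH subnS.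
Qed.

Lemma fn_mul : fn2 muln.
Proof.
apply: (computable_ext _ (computable_primrec (computable_const 2 0) (computable2 fn_add (var 2 4) (var 1 4)) (var 1 2))).
by move=> v; rewrite /primrec; elim: (nth 0 v 1) => [|k IH] /=; rewrite ?muln0 // IH mulnS.
Qed.

Lemma fn_exp : fn2 expn.
Proof.
apply: (computable_ext _ (computable_primrec (computable_const 2 1) (computable2 fn_mul (var 2 4) (var 1 4)) (var 1 2))).
by move=> v; rewrite /primrec; elim: (nth 0 v 1) => [|k IH] /=; rewrite ?expn0 // IH expnS.
Qed.

Lemma fn_not : fn1 (fun x => (x == 0) : nat).
Proof.
apply: (computable_ext _ (computable2 fn_sub (computable_const 1 1) (var 0 1))).
by move=> v; case: (nth 0 v 0).
Qed.

Lemma fn_leq : fn2 (fun x y => (x <= y) : nat).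
Proof.
apply: (computable_ext _ (computable1 fn_not (computable2 fn_sub (var 0 2) (var 1 2)))).
by move=> v; rewrite subn_eq0.
Qed.

Lemma fn_eq : fn2 (fun x y => (x == y) : nat).
Proof.
apply: (computable_ext _ (computable2 fn_mul (computable2 fn_leq (var 0 2) (var 1 2))
  (computable2 fn_leq (var 1 2) (var 0 2)))).
by move=> v; rewrite mulnb eqn_leq.
Qed.

End Computable.

(** * Lists coded by natural numbers *)

Section Lists.
Implicit Types (v : seq nat) (f g h : seq nat -> nat).
Notation decode := CodeSeq.decode.
Notation code := CodeSeq.code.
Notation var k n := (computable_var (isT : k < n)).

(** Discards the accumulator of a primitive recursion. *)
Lemma computable_skip n P : computable n.+1 P ->
  computable n.+2 (fun w => P (head 0 w :: behead (behead w))).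
Proof.
move=> cP; apply: (computable_ext _ (computable_comp (gs := (nth 0 ^~ 0) :: [seq (nth 0 ^~ i.+2) | i <- iota 0 n]) _ cP _)).
- move=> v; case/tupleP: v => x v; case/tupleP: v => y v /=; congr (P (_ :: _)).
  rewrite -map_comp; apply: (@eq_from_nth _ 0); rewrite size_map size_iota ?size_tuple // => i lt.
  by rewrite (nth_map 0) ?size_iota // nth_iota.
- by rewrite /= size_map size_iota.
- case=> [|i] /=; first by move=> _; exact: computable_var.
  rewrite ltnS => lt; rewrite (nth_map 0) ?size_iota // nth_iota //; exact: computable_var.
Qed.

Definition bounded_all k P v : nat := all (fun i => P (i :: v) != 0) (iota 0 (k v)).
Definition bounded_has k P v : nat := has (fun i => P (i :: v) != 0) (iota 0 (k v)).

Lemma fn_bool : fn1 (fun x => (x != 0) : nat).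
Proof.
apply: (computable_ext _ (computable1 fn_not (computable1 fn_not (var 0 1)))).
by move=> v; case: (nth 0 v 0).
Qed.

Lemma computable_all n k P : computable n k -> computable n.+1 P -> computable n (bounded_all k P).
Proof.
move=> ck cP; have cs := computable2 fn_mul (var 1 n.+2) (computable1 fn_bool (computable_skip cP)).
apply: (computable_ext _ (computable_primrec (computable_const n 1) cs ck)) => v.
rewrite /primrec /bounded_all; elim: (k v) => [|m IH] //.
by rewrite [LHS]/= IH -[m.+1]addn1 iotaD all_cat /= andbT mulnb.
Qed.

Lemma computable_has n k P : computable n k -> computable n.+1 P -> computable n (bounded_has k P).
Proof.
move=> ck cP; have := computable1 fn_not (computable_all ck (computable1 fn_not cP)).
apply: computable_ext => v; rewrite /bounded_all /bounded_has -[has _ _]negbK -all_predC.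
rewrite (eq_all (a2 := predC (fun i => P (i :: v) != 0))); first by case: (all _ _).
by move=> i /=; case: (P _).
Qed.

Definition c_hd s := head 0 (decode s).
Definition c_tl s := code (behead (decode s)).
Definition c_cons x s := code (x :: decode s).
Definition c_drop i s := code (drop i (decode s)).
Definition c_nth s i := nth 0 (decode s) i.
Definition c_size s := size (decode s).

(** Arithmetic on codes: the head is the exponent of 2 and the tail comes from the
    odd part. *)
Lemma c_consE x s : c_cons x s = 2 ^ x * (s + s).+1.
Proof. by rewrite /c_cons /= CodeSeq.decodeK addnn. Qed.

Lemma c_hd_tl s : 0 < s -> s = 2 ^ c_hd s * (c_tl s + c_tl s).+1.
Proof.
move=> s0; rewrite -c_consE /c_cons /c_tl CodeSeq.codeK /c_hd.
case e : (decode s) => [|x t]; last by rewrite -[X in X = _]CodeSeq.decodeK e.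
by move: s0; rewrite -(CodeSeq.decodeK s) e.
Qed.

Lemma fn_cons : fn2 c_cons.
Proof.
apply: (computable_ext _ (computable2 fn_mul (computable2 fn_exp (computable_const 2 2) (var 0 2))
  (computable_succ (computable2 fn_add (var 1 2) (var 1 2))))).
by move=> v; rewrite c_consE.
Qed.

(** The head is the exponent of 2: the least [k] such that [2 ^ k.+1] does not
    divide the code. *)
Lemma fn_hd : fn1 c_hd.
Proof.
have c := computable2 fn_mul (var 1 2)
  (computable_has (computable_succ (var 1 2))
    (computable2 fn_eq (computable2 fn_mul (var 0 3)
       (computable2 fn_exp (computable_const 3 2) (computable_succ (var 1 3)))) (var 2 3))).
apply: (computable_min c) => v; rewrite /bounded_has; set I := iota 0.
have memI m q : (q \in I m) = (q < m) by rewrite mem_iota.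
clearbody I; rewrite /=; set s := nth 0 v 0; have [->|s0] := posnP s; first by rewrite mul0n; split => // k; rewrite /c_hd.
have es := c_hd_tl s0; split.
  apply/eqP; rewrite muln_eq0 (gtn_eqF s0) /= eqb0; apply/hasPn => q _; rewrite eqb0 negbK.
  apply/eqP => e; move: es; rewrite -{1}e expnS mulnA [q * 2]mulnC mulnC mulnA.
  rewrite -!mulnA => /eqP; rewrite eqn_pmul2l ?expn_gt0 // => /eqP.
  by move=> e2; lia.
move=> k lt; rewrite muln_gt0 s0 lt0b; apply/hasP.
pose q := 2 ^ (c_hd s - k.+1) * (c_tl s + c_tl s).+1.
have eq : q * 2 ^ k.+1 = s by rewrite /q mulnAC -expnD subnK // -es.
exists q; last by rewrite eq eqxx.
rewrite memI ltnS -eq leq_pmulr // expn_gt0 //.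
Qed.

Lemma fn_tl : fn1 c_tl.
Proof.
have c := computable2 fn_sub (var 1 2)
  (computable2 fn_mul (computable2 fn_exp (computable_const 2 2) (computable1 fn_hd (var 1 2)))
    (computable_succ (computable2 fn_add (var 0 2) (var 0 2)))).
apply: (computable_min c) => v /=; set s := nth 0 v 0.
have [->|s0] := posnP s; first by split.
have es := c_hd_tl s0; have p0 : 0 < 2 ^ c_hd s by rewrite expn_gt0.
split; first by rewrite {1}es subnn.
move=> k lt; rewrite subn_gt0 {2}es ltn_pmul2l //; lia.
Qed.

Lemma fn_drop : fn2 c_drop.
Proof.
apply: (computable_ext _ (computable_primrec (var 1 2) (computable1 fn_tl (var 1 4)) (var 0 2))).
move=> v; rewrite /primrec; elim: (nth 0 v 0) => [|i IH] /=.
  by rewrite /c_drop drop0 CodeSeq.decodeK.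
by rewrite IH /c_tl /c_drop CodeSeq.codeK -drop1 drop_drop.
Qed.

Lemma fn_nth : fn2 c_nth.
Proof.
apply: (computable_ext _ (computable1 fn_hd (computable2 fn_drop (var 1 2) (var 0 2)))).
by move=> v; rewrite /c_hd /c_drop /c_nth CodeSeq.codeK -nth0 nth_drop addn0.
Qed.

Lemma code_eq0 s : (code s == 0) = (s == [::]).
Proof. by rewrite -(inj_eq (can_inj CodeSeq.codeK)). Qed.

Lemma fn_size : fn1 c_size.
Proof.
apply: (computable_min (computable2 fn_drop (var 0 2) (var 1 2))) => v /=.
split; first by rewrite /c_drop /c_size drop_size.
move=> k lt; rewrite lt0n code_eq0 -size_eq0 size_drop subn_eq0 -ltnNge; exact: lt.
Qed.

(** The recursion runs through the list from its end; the last argument of [h2] is a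
    parameter. *)
Lemma fn_foldr (h2 : nat -> nat -> nat -> nat) : fn3 h2 ->
  fn3 (fun s b p => foldr (fun x acc => h2 x acc p) b (decode s)).
Proof.
move=> ch.
have c := computable3 ch (computable2 fn_nth (var 2 5)
   (computable2 fn_sub (computable1 fn_size (var 2 5)) (computable_succ (var 0 5))))
   (var 1 5) (var 4 5).
apply: (computable_ext _ (computable_primrec (var 1 3) c (computable1 fn_size (var 0 3)))).
move=> v; rewrite /primrec /= /c_size; set s := nth 0 v 0.
suff H k : k <= size (decode s) -> nat_rect (fun _ => nat) (nth 0 v 1) (fun i acc => h2 (c_nth s (size (decode s) - i.+1)) acc (nth 0 v 2)) k
   = foldr (fun x acc => h2 x acc (nth 0 v 2)) (nth 0 v 1) (drop (size (decode s) - k) (decode s)).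
  by rewrite H // subnn drop0.
elim: k => [|k IH] lt; first by rewrite subn0 drop_size.
rewrite /= IH ?(ltnW lt) // [in RHS](drop_nth 0); last by lia.
by rewrite /= /c_nth; congr (h2 _ (foldr _ _ (drop _ _)) _); lia.
Qed.

Definition c_cat s t := code (decode s ++ decode t).

Lemma fn_cat : fn2 c_cat.
Proof.
have c3 : fn3 (fun x acc _ => c_cons x acc) by exact: computable2 fn_cons (var 0 3) (var 1 3).
apply: (computable_ext _ (computable3 (fn_foldr c3) (var 0 2) (var 1 2) (computable_const 2 0))).
move=> v; rewrite /c_cat; elim: (decode (nth 0 v 0)) => [|x s IH] /=; first by rewrite CodeSeq.decodeK.
by rewrite IH /c_cons CodeSeq.codeK.
Qed.

Definition c_sum s := sumn (decode s).

Lemma fn_sum : fn1 c_sum.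
Proof.
have c3 : fn3 (fun x acc _ => x + acc) by exact: computable2 fn_add (var 0 3) (var 1 3).
exact: (computable3 (fn_foldr c3) (var 0 1) (computable_const 1 0) (computable_const 1 0)).
Qed.

(** [S] codes the list of the images of the letters, each image being coded itself. *)
Definition c_sub S w := foldr (fun b acc => c_cat (c_nth S b) acc) 0 (decode w).

Lemma fn_sub_word : fn2 c_sub.
Proof.
have c3 : fn3 (fun b acc S => c_cat (c_nth S b) acc).
  exact: computable2 fn_cat (computable2 fn_nth (var 2 3) (var 0 3)) (var 1 3).
exact: (computable3 (fn_foldr c3) (var 1 2) (computable_const 2 0) (var 0 2)).
Qed.

Definition c_iter S m w := iter m (c_sub S) w.

Lemma fn_iter : fn3 c_iter.
Proof.
apply: (computable_ext _ (computable_primrec (var 2 3) (computable2 fn_sub_word (var 2 5) (var 1 5)) (var 1 3))).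
by move=> v; rewrite /primrec /c_iter; elim: (nth 0 v 1) => //= m ->.
Qed.

Definition c_val S c w := \sum_(j < c_size c) c_nth c j * c_size (c_iter S j w).

Lemma fn_val : fn3 c_val.
Proof.
have cs := computable2 fn_add (var 1 5) (computable2 fn_mul
  (computable2 fn_nth (var 3 5) (var 0 5))
  (computable1 fn_size (computable3 fn_iter (var 2 5) (var 0 5) (var 4 5)))).
apply: (computable_ext _ (computable_primrec (computable_const 3 0) cs (computable1 fn_size (var 1 3)))).
move=> v; rewrite /primrec /c_val; elim: (c_size _) => [|k IH] /=; first by rewrite big_ord0.
by rewrite big_ord_recr /= IH.
Qed.

End Lists.

(** * Computable tests *)

Section Tests.
Implicit Types (f g : seq nat -> nat).
Notation var k n := (computable_var (isT : k < n)).

Lemma computable_weaken n f : computable n f -> computable n.+1 (fun w => f (behead w)).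
Proof.
move=> cf; apply: (computable_ext _ (computable_comp (gs := [seq (nth 0 ^~ i.+1) | i <- iota 0 n]) _ cf _)).
- move=> v; case/tupleP: v => x v /=; congr (f _).
  rewrite -map_comp; apply: (@eq_from_nth _ 0); rewrite size_map size_iota ?size_tuple // => i lt.
  by rewrite (nth_map 0) ?size_iota // nth_iota.
- by rewrite size_map size_iota.
- by move=> i lt; rewrite (nth_map 0) ?size_iota // nth_iota //; exact: computable_var.
Qed.

Lemma computable_head n : computable n.+1 (head 0).
Proof. by apply: (computable_ext _ (var 0 n.+1)) => v; rewrite nth0. Qed.

Lemma computable_and n (b1 b2 : seq nat -> bool) : computable n b1 -> computable n b2 ->
  computable n (fun v => b1 v && b2 v).
Proof.
move=> c1 c2; apply: (computable_ext _ (computable2 fn_mul c1 c2)) => v /=.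
by rewrite mulnb.
Qed.

Lemma computable_negb n (b : seq nat -> bool) : computable n b -> computable n (fun v => ~~ b v).
Proof. by move=> c; apply: (computable_ext _ (computable1 fn_not c)) => v /=; case: (b v). Qed.

Lemma computable_or n (b1 b2 : seq nat -> bool) : computable n b1 -> computable n b2 ->
  computable n (fun v => b1 v || b2 v).
Proof.
move=> c1 c2; apply: (computable_ext _ (computable_negb (computable_and (computable_negb c1) (computable_negb c2)))) => v /=.
by rewrite negb_and !negbK.
Qed.

Lemma computable_eqn n f g : computable n f -> computable n g -> computable n (fun v => f v == g v).
Proof. exact: computable2 fn_eq. Qed.

Lemma computable_forall n k (b : nat -> seq nat -> bool) : computable n k ->
  computable n.+1 (fun w => b (head 0 w) (behead w)) ->
  computable n (fun v => all (b ^~ v) (iota 0 (k v))).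
Proof.
move=> ck cb; apply: (computable_ext _ (computable_all ck cb)) => v.
by rewrite /bounded_all; congr nat_of_bool; apply: eq_all => i /=; case: (b i v).
Qed.

Lemma computable_exists n k (b : nat -> seq nat -> bool) : computable n k ->
  computable n.+1 (fun w => b (head 0 w) (behead w)) ->
  computable n (fun v => has (b ^~ v) (iota 0 (k v))).
Proof.
move=> ck cb; apply: (computable_ext _ (computable_has ck cb)) => v.
by rewrite /bounded_has; congr nat_of_bool; apply: eq_has => i /=; case: (b i v).
Qed.

(** Minimization finds the first certificate, and [B] reads the answer from it. *)
Lemma computable_search (T B : nat -> nat -> bool) : fn2 T -> fn2 B -> exists p : murec 1,
  forall S, (exists y, T y S) -> exists2 y, T y S & murec_eval p [tuple S] (B y S).
Proof.
move=> cT [pB hB].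
have [pT hT] := computable_negb (b := fun v => T (nth 0 v 0) (nth 0 v 1)) cT.
exists (MuComp pB (fun i : 'I_2 => if i == ord0 then MuMin pT else MuProj ord0)) => S exT.
have [Y TY minY] := ex_minnP exT; exists Y => //.
exists [tuple Y; S]; split; last exact: (hB [tuple Y; S]).
move=> i; case: (unliftP ord0 i) => [j ->|->] /=; first by rewrite ord1 /= (tnth_nth 0).
split; first by have := hT [tuple Y; S]; rewrite /= TY.
move=> k kY; exists 0; have := hT [tuple k; S]; rewrite /=.
by case: (boolP (T k S)) => // /minY; rewrite leqNgt kY.
Qed.

(** Natural numbers have no subtraction: this is the part of
    [('X^q - e) * (sum of (c_i - c'_i) 'X^i)] that contributes positively, and the
    other part is obtained by exchanging [c] and [c']; see [pairing_lin]. *)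
Definition c_lin S q e c c' w := c_val S c (c_iter S q w) + e * c_val S c' w.

Definition c_cob S q e c c' u := all (fun i => all (fun j =>
    (c_nth u i != c_nth u j) ||
    (c_lin S q e c c' (c_drop i u) + c_lin S q e c' c (c_drop j u) ==
     c_lin S q e c c' (c_drop j u) + c_lin S q e c' c (c_drop i u)))
  (iota 0 (c_size u))) (iota 0 (c_size u)).

Definition c_closed S u :=
  all (fun a => has (fun i => c_nth u i == a) (iota 0 (c_size u))) (iota 0 (c_size S)) &&
  all (fun i => has (fun j => (c_nth u j == c_nth (c_sub S u) i) && (c_nth u j.+1 == c_nth (c_sub S u) i.+1))
    (iota 0 (c_size u).-1)) (iota 0 (c_size (c_sub S u)).-1).

Section Composition.
Variables (n : nat) (S q e c c' u : seq nat -> nat).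
Hypotheses (cS : computable n S) (cq : computable n q) (ce : computable n e)
  (cc : computable n c) (cc' : computable n c') (cu : computable n u).

Lemma computable_lin : computable n (fun v => c_lin (S v) (q v) (e v) (c v) (c' v) (u v)).
Proof.
exact: computable2 fn_add (computable3 fn_val cS cc (computable3 fn_iter cS cq cu))
  (computable2 fn_mul ce (computable3 fn_val cS cc' cu)).
Qed.

End Composition.

Lemma computable_cob n S q e c c' u : computable n S -> computable n q -> computable n e ->
  computable n c -> computable n c' -> computable n u ->
  computable n (fun v => c_cob (S v) (q v) (e v) (c v) (c' v) (u v)).
Proof.
move=> cS cq ce cc cc' cu.
have W f : computable n f -> computable n.+2 (fun w => f (behead (behead w))).
  by move=> cf; exact: computable_weaken (computable_weaken cf).
have ci := computable_weaken (computable_head n); have cj := computable_head n.+1.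
have di := computable2 fn_drop ci (W _ cu); have dj := computable2 fn_drop cj (W _ cu).
have size_u := computable1 fn_size cu.
apply: (computable_forall (b := fun i v => all (fun j =>
    (c_nth (u v) i != c_nth (u v) j) ||
    (c_lin (S v) (q v) (e v) (c v) (c' v) (c_drop i (u v)) + c_lin (S v) (q v) (e v) (c' v) (c v) (c_drop j (u v)) ==
     c_lin (S v) (q v) (e v) (c v) (c' v) (c_drop j (u v)) + c_lin (S v) (q v) (e v) (c' v) (c v) (c_drop i (u v))))
  (iota 0 (c_size (u v)))) size_u).
apply: (computable_forall (b := fun j w => 
    (c_nth (u (behead w)) (head 0 w) != c_nth (u (behead w)) j) || _) (computable_weaken size_u)).
apply: computable_or.
  by apply: computable_negb; apply: computable_eqn; apply: (computable2 fn_nth) => //; exact: W cu.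
by apply: computable_eqn; apply: (computable2 fn_add); apply: computable_lin => //; exact: W.
Qed.

Lemma computable_closed n S u : computable n S -> computable n u ->
  computable n (fun v => c_closed (S v) (u v)).
Proof.
move=> cS cu.
have W f : computable n f -> computable n.+2 (fun w => f (behead (behead w))).
  by move=> cf; exact: computable_weaken (computable_weaken cf).
have ci := computable_weaken (computable_head n); have cj := computable_head n.+1.
have csub := computable2 fn_sub_word cS cu.
have size_u := computable1 fn_size cu.
apply: computable_and.
  apply: (computable_forall (b := fun a v => has _ _) (computable1 fn_size cS)).
  apply: (computable_exists (b := fun i w => c_nth (u (behead w)) i == head 0 w) (computable_weaken size_u)).
  by apply: computable_eqn => //; apply: (computable2 fn_nth) => //; exact: W.
apply: (computable_forall (b := fun i v => has _ _) (computable1 fn_pred (computable1 fn_size csub))).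
apply: (computable_exists (b := fun j w => (c_nth (u (behead w)) j == c_nth (c_sub (S (behead w)) (u (behead w))) (head 0 w)) &&
  (c_nth (u (behead w)) j.+1 == c_nth (c_sub (S (behead w)) (u (behead w))) (head 0 w).+1)) (computable_weaken (computable1 fn_pred size_u))).
apply: computable_and; apply: computable_eqn; apply: (computable2 fn_nth) => //;
  by [exact: W | exact: (W _ csub) | exact: computable_succ].
Qed.

(** [c_cons 0 0] codes the word whose only letter is the letter of rank 0. *)
Definition c_word S y := c_iter S (c_nth y 0) (c_cons 0 0).

(** [y] codes an iterate, the period [q], and the positive and negative parts of
    the polynomial [t] of [torsion_case].  The word shows that [('X^q - 1) * t] is
    cobounding and that [t] is not. *)
Definition torsion_cert y S := let u := c_word S y in
  [&& 0 < c_nth y 1, c_closed S u, c_cob S (c_nth y 1) 1 (c_nth y 2) (c_nth y 3) u &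
      ~~ c_cob S 0 0 (c_nth y 2) (c_nth y 3) u].

(** The second entry of [y] is now the index of the dominant coefficient of the
    cobounding polynomial. *)
Definition cobounding_cert y S := let u := c_word S y in
  [&& c_closed S u, c_cob S 0 0 (c_nth y 2) (c_nth y 3) u &
      c_sum (c_nth y 2) + c_sum (c_nth y 3) < 2 * c_nth (c_nth y 2) (c_nth y 1)].

Lemma computable_certs : fn2 torsion_cert /\ fn2 cobounding_cert.
Proof.
have cy := var 0 2; have cS := var 1 2.
have cn k := computable2 fn_nth cy (computable_const 2 k).
have cu : computable 2 (fun v => c_word (nth 0 v 1) (nth 0 v 0)).
  exact: computable3 fn_iter cS (cn 0) (computable_const 2 (c_cons 0 0)).
have clt f g : computable 2 f -> computable 2 g -> computable 2 (fun v => f v < g v).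
  by move=> cf cg; exact: computable2 fn_leq (computable_succ cf) cg.
have c0 k := computable_const 2 k.
split.
  apply: computable_and; first exact: (clt _ _ (c0 0) (cn 1)).
  apply: computable_and; first exact: (computable_closed cS cu).
  apply: computable_and; first exact: (computable_cob cS (cn 1) (c0 1) (cn 2) (cn 3) cu).
  exact: (computable_negb (computable_cob cS (c0 0) (c0 0) (cn 2) (cn 3) cu)).
apply: computable_and; first exact: (computable_closed cS cu).
apply: computable_and; first exact: (computable_cob cS (c0 0) (c0 0) (cn 2) (cn 3) cu).
apply: clt; first exact: computable2 fn_add (computable1 fn_sum (cn 2)) (computable1 fn_sum (cn 3)).
exact: computable2 fn_mul (c0 2) (computable2 fn_nth (cn 2) (cn 1)).
Qed.

End Tests.

(** * Correctness of the algorithm *)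

Section Encoding.
Variables (A : finType) (sigma : substitution A).
Implicit Types (a b : A) (u v w : seq A).
Notation sw := (subst_word sigma).
Notation decode := CodeSeq.decode.
Notation code := CodeSeq.code.
Let rk a : nat := enum_rank a.
Let enc w := code (map rk w).
Let S := subst_code sigma.

Let rk_inj : injective rk.
Proof. by move=> a b /ord_inj/enum_rank_inj. Qed.

Lemma decode_enc w : decode (enc w) = map rk w.
Proof. exact: CodeSeq.codeK. Qed.

Lemma c_nth_code a : c_nth S (rk a) = enc (sigma a).
Proof.
rewrite /c_nth /S /subst_code CodeSeq.codeK (nth_map a) -?cardE ?ltn_ord //.
by rewrite nth_enum_rank.
Qed.

Lemma c_size_code : c_size S = #|A|.
Proof. by rewrite /c_size /S /subst_code CodeSeq.codeK size_map -cardE. Qed.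

Lemma c_sub_enc w : c_sub S (enc w) = enc (sw w).
Proof.
rewrite /c_sub decode_enc; elim: w => [|a w IH] //=.
by rewrite IH c_nth_code /c_cat !decode_enc -map_cat.
Qed.

Lemma c_iter_enc m w : c_iter S m (enc w) = enc (siter sigma m w).
Proof. by elim: m => //= m; rewrite /c_iter /= -/(c_iter _ _ _) => ->; rewrite c_sub_enc. Qed.

Lemma c_size_enc w : c_size (enc w) = size w.
Proof. by rewrite /c_size decode_enc size_map. Qed.

Lemma c_drop_enc i w : c_drop i (enc w) = enc (drop i w).
Proof. by rewrite /c_drop decode_enc -map_drop. Qed.

Lemma c_nth_enc x0 i w : i < size w -> c_nth (enc w) i = rk (nth x0 w i).
Proof. by move=> iw; rewrite /c_nth decode_enc (nth_map x0). Qed.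

Lemma c_val_enc c w : Posz (c_val S c (enc w)) = (\sum_(j < size (decode c)) (Posz (nth 0 (decode c) j) * (size (siter sigma j w))%:R))%R.
Proof.
rewrite /c_val (big_morph Posz PoszD (erefl _)); apply: eq_bigr => j _.
by rewrite c_iter_enc c_size_enc PoszM natz.
Qed.

Lemma pairing_difference c c' w :
  pairing sigma (difference_poly (decode c) (decode c')) w = (Posz (c_val S c (enc w)) - Posz (c_val S c' (enc w)))%R.
Proof.
have H s : pairing sigma (Poly (map Posz (decode s))) w = Posz (c_val S s (enc w)).
  rewrite c_val_enc (pairingE sigma (n := size (decode s))); last by rewrite (leq_trans (size_Poly _)) // size_map.
  by apply: eq_bigr => j _; rewrite coef_Poly (nth_map 0).
by rewrite /difference_poly pairingB !H.
Qed.

Lemma pairing_lin q e c c' w :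
  pairing sigma (('X^q - e%:R%:P) * difference_poly (decode c) (decode c'))%R w =
  (Posz (c_lin S q e c c' (enc w)) - Posz (c_lin S q e c' c (enc w)))%R.
Proof.
rewrite mulrBl pairingB [('X^q * _)%R]mulrC pairing_mulXn mul_polyC pairingZ !pairing_difference.
by rewrite /c_lin c_iter_enc !PoszD !PoszM natz; ring.
Qed.

(** Sums from the beginning of [u] and sums to its end add up to a constant. *)
Lemma cob_on_drop p u : cob_on sigma p u <-> forall i j x0, i < size u -> j < size u ->
  nth x0 u i = nth x0 u j -> pairing sigma p (drop i u) = pairing sigma p (drop j u).
Proof.
have t i : pairing sigma p (drop i u) = (pairing sigma p u - pairing sigma p (take i u))%R.
  by rewrite -{2}(cat_take_drop i u) pairing_cat addrAC subrr add0r.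
split=> h i j x0 iu ju e; have := h i j x0 iu ju e; first by rewrite !t => ->.
by rewrite !t => /addrI/oppr_inj.
Qed.

Lemma c_cobP q e c c' u : c_cob S q e c c' (enc u) <->
  cob_on sigma (('X^q - e%:R%:P) * difference_poly (decode c) (decode c'))%R u.
Proof.
rewrite cob_on_drop /c_cob c_size_enc.
have key i j x0 : i < size u -> j < size u -> ((c_nth (enc u) i != c_nth (enc u) j) ||
    (c_lin S q e c c' (c_drop i (enc u)) + c_lin S q e c' c (c_drop j (enc u)) ==
     c_lin S q e c c' (c_drop j (enc u)) + c_lin S q e c' c (c_drop i (enc u)))) <->
   (nth x0 u i = nth x0 u j -> pairing sigma (('X^q - e%:R%:P) * difference_poly (decode c) (decode c'))%R (drop i u) =
     pairing sigma (('X^q - e%:R%:P) * difference_poly (decode c) (decode c'))%R (drop j u)).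
  move=> iu ju; rewrite !(c_nth_enc x0) // (inj_eq rk_inj) !c_drop_enc !pairing_lin.
  move: (c_lin _ _ _ _ _ _) (c_lin _ _ _ _ _ _) (c_lin _ _ _ _ _ _) (c_lin _ _ _ _ _ _) => x y z t.
  case: eqP => [e0|ne] /=; last by split.
  by split=> [/eqP h _|h]; [lia|apply/eqP; have := h e0; lia].
split=> [/allP h i j x0 iu ju|h].
  apply/(key i j x0 iu ju).
  by have /allP := h i ltac:(by rewrite mem_iota); apply; rewrite mem_iota.
apply/allP => i; rewrite mem_iota /= add0n => iu; apply/allP => j; rewrite mem_iota /= add0n => ju.
case: u iu ju h key => // a u iu ju h key.
by apply/(key i j a iu ju); exact: h.
Qed.

Lemma infix_pairP x0 a b u : infix [:: a; b] u <->
  exists i, [/\ i < (size u).-1, nth x0 u i = a & nth x0 u i.+1 = b].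
Proof.
split=> [/infixP[s [t ->]]|[i [iu ia ib]]].
  exists (size s); rewrite !size_cat /= !nth_cat ltnn subnn (ltnNge _.+1) leqW // subSnn; split=> //; lia.
apply/infixP; exists (take i u), (drop i.+2 u).
rewrite -[LHS](cat_take_drop i) (drop_nth x0) ?(drop_nth x0 (n := i.+1)) ?ia ?ib //; lia.
Qed.

Lemma c_closedP u : c_closed S (enc u) <-> closed_word sigma u.
Proof.
rewrite /c_closed c_sub_enc !c_size_enc c_size_code.
split.
  case/andP => /allP h1 /allP h2; split.
    move=> a; have ra : rk a \in iota 0 #|A| by rewrite mem_iota; exact: ltn_ord.
    have /hasP[ i] := h1 _ ra.
    rewrite mem_iota /= add0n => iu; rewrite (c_nth_enc a) // (inj_eq rk_inj) => /eqP <-.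
    exact: mem_nth.
  move=> a b /(infix_pairP a)[i [iu ia ib]].
  have im : i \in iota 0 (size (sw u)).-1 by rewrite mem_iota.
  have /hasP[j] := h2 _ im.
  rewrite mem_iota /= add0n => ju; rewrite !(c_nth_enc a) ?(inj_eq rk_inj) ?ia ?ib; try lia.
  by case/andP => /eqP ja /eqP jb; apply/(infix_pairP a); exists j.
move=> [h1 h2]; apply/andP; split; apply/allP => i; rewrite mem_iota /= add0n => iA; apply/hasP.
  pose a := enum_val (Ordinal iA); have ia : i = rk a by rewrite /rk enum_valK.
  exists (index a u); first by rewrite mem_iota /= add0n index_mem.
  by rewrite (c_nth_enc a) ?index_mem // nth_index // ia.
case e : (sw u) iA => [|x0 s] // iA; rewrite -e in iA *.
have /h2/(infix_pairP x0)[j [ju ja jb]] : infix [:: nth x0 (sw u) i; nth x0 (sw u) i.+1] (sw u).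
  by apply/(infix_pairP x0); exists i; split => //; rewrite e.
exists j; first by rewrite mem_iota.
by rewrite !(c_nth_enc x0) ?ja ?jb ?eqxx //; lia.
Qed.

Lemma c_word_enc a0 y : rk a0 = 0 -> c_word S y = enc (siter sigma (c_nth y 0) [:: a0]).
Proof. by move=> r0; rewrite /c_word -c_iter_enc /enc /= r0. Qed.

Lemma subst_one : ('X^0 - 0%:R%:P)%R = 1%R :> {poly int}.
Proof. by rewrite expr0 subr0. Qed.

Variable a0 : A.
Hypothesis rk0 : rk a0 = 0.

Lemma torsion_cert_sound y : torsion_cert y S -> torsion_case sigma.
Proof.
rewrite /torsion_cert (c_word_enc y rk0) => /and4P[q0 /c_closedP cu /c_cobP cq /negP nc].
set p := difference_poly _ _ in cq.
have {}nc : ~ cob_on sigma p (siter sigma (c_nth y 0) [:: a0]).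
  by move=> h; apply: nc; apply/c_cobP; rewrite subst_one mul1r.
have [h lh ph] := not_cob_on (lang_siter _ (lang1 sigma a0)) nc.
by exists p, (c_nth y 1), h; split => //; exact: cob_on_cobounding cu cq.
Qed.

Lemma cobounding_cert_sound y : cobounding_cert y S -> ~ torsion_case sigma.
Proof.
rewrite /cobounding_cert (c_word_enc y rk0) => /and3P[/c_closedP cu /c_cobP cq dom].
rewrite subst_one mul1r in cq.
exact: dominated_not_torsion (cob_on_cobounding cu cq) dom.
Qed.

Hypothesis prim : primitive_substitution sigma.

Lemma cobounding_cob_on p u : lang sigma u -> cobounding sigma p -> cob_on sigma p u.
Proof.
move=> lu cp; apply: contrapT => /(not_cob_on lu)[h /cp ->].
by rewrite eqxx.
Qed.

(** A late iterate of the first letter is a closed word and contains the loop of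
    [torsion_case]. *)
Lemma torsion_cert_complete : torsion_case sigma -> exists y, torsion_cert y S.
Proof.
move=> [t [q [h [q0 lh th ct]]]].
have [n1 h1] := closed_word_siter prim.
have [a [v [eh lv]]] := lh.
have [n2 h2] := lang_eventually prim lv.
have [c [c' [e _]]] := difference_polyP t.
pose m := maxn n1 n2; exists (code [:: m; q; code c; code c']).
rewrite /torsion_cert (c_word_enc _ rk0) /c_nth CodeSeq.codeK /=.
have lu := lang_siter m (lang1 sigma a0).
apply/and4P; split=> //.
- by apply/c_closedP; apply: h1; rewrite leq_maxl.
- by apply/c_cobP; rewrite !CodeSeq.codeK e; exact: cobounding_cob_on.
- apply/negP => /c_cobP; rewrite subst_one mul1r !CodeSeq.codeK e => co.
  move: (h2 m a0 (leq_maxr _ _)) co => /infixP[s [w ->]] /(_ (size s) (size s + size h) a).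
  have sz : size (s ++ rcons h a ++ w) = size s + (size h).+1 + size w by rewrite !size_cat size_rcons addnA.
  rewrite sz => /(_ ltac:(lia) ltac:(lia)).
  have -> : nth a (s ++ rcons h a ++ w) (size s) = a by rewrite nth_cat ltnn subnn nth_cat size_rcons /= eh.
  have -> : nth a (s ++ rcons h a ++ w) (size s + size h) = a.
    by rewrite nth_cat ltnNge leq_addr /= addKn nth_cat size_rcons ltnSn nth_rcons ltnn eqxx.
  rewrite take_size_cat // -cats1 -!catA catA take_size_cat ?size_cat // pairing_cat => /(_ erefl)/esym/eqP.
  by rewrite -subr_eq0 addrAC subrr add0r (negPf th).
Qed.

Lemma cobounding_cert_complete (r : {poly int}) j : cobounding sigma r ->
  (\sum_(i < size r) `|(r`_i)%R| < 2 * r`_j)%R -> exists y, cobounding_cert y S.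
Proof.
move=> cr dom; have [n1 h1] := closed_word_siter prim.
have [c [c' [e [es ec]]]] := difference_polyP r.
exists (code [:: n1; j; code c; code c']).
rewrite /cobounding_cert (c_word_enc _ rk0) /c_nth /c_sum CodeSeq.codeK /= !CodeSeq.codeK.
apply/and3P; split.
- by apply/c_closedP; exact: h1.
- apply/c_cobP; rewrite subst_one mul1r !CodeSeq.codeK e.
  by apply: cobounding_cob_on => //; exact: lang_siter (lang1 sigma a0).
- have r0 : (0 < r`_j)%R by rewrite -es in dom; lia.
  by rewrite -es -(ec _ r0) in dom; lia.
Qed.

End Encoding.

Section Main.
Variables (R : realType) (A : finType) (sigma : substitution A) (beta : R) (d : nat).
Hypothesis wip : weakly_irreducible_pisot R sigma.
Hypothesis pb : perron_eigenvalue sigma beta.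
Hypothesis db : has_degree beta d.+1.

Lemma first_letter : exists a : A, (enum_rank a : nat) = 0.
Proof.
have [w [_ ]] := lang_unbounded wip pb db 1; case: w => // a _ _.
have A0 : 0 < #|A| by apply/card_gt0P; exists a.
by exists (enum_val (Ordinal A0)); rewrite enum_valK.
Qed.

(** By [degree_gt0] the torus has positive dimension, which excludes the trivial
    translation. *)
Lemma exclusive_cases : finite_extension_of_minimal_translation R d sigma ->
  ~ only_root_of_unity_eigenvalues R sigma.
Proof.
have [P [gs [N [q [[b1 sP mP P0] fP _ _ _]]]]] := weakly_irreducible_structure wip pb db.
have := degree_gt0 b1 sP mP P0 fP; case: d => // d' _.
exact: finite_extension_irrational.
Qed.

End Main.

(** The two kinds of certificates cannot coexist and one of them exists, so that the
    first one that is found is conclusive. *)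
Lemma torsion_cert_decides (p : murec 1) :
  (forall S, (exists y, torsion_cert y S || cobounding_cert y S) ->
    exists2 y, torsion_cert y S || cobounding_cert y S & murec_eval p [tuple S] (torsion_cert y S)) ->
  forall (R : realType) (A : finType) (sigma : substitution A) (beta : R) (d : nat),
       weakly_irreducible_pisot R sigma ->
       perron_eigenvalue sigma beta ->
       has_degree beta d.+1 ->
       exists b : bool,
         [/\ murec_eval p [tuple subst_code sigma] (b : nat),
             b <-> only_root_of_unity_eigenvalues R sigma &
             ~~ b <-> finite_extension_of_minimal_translation R d sigma].
Proof.
move=> hp R A sigma beta d wip pb db.
have prim : primitive_substitution sigma by case: wip.
have [a0 rk0] := first_letter wip pb db.
have excl := exclusive_cases wip pb db.
have ext : ~ torsion_case sigma -> finite_extension_of_minimal_translation R d sigma.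
  have [//|[P [gs [N [[b1 sP mP P0] fP gs1 cP]]]] _] := torsion_or_cobounding wip pb db.
  exact: (cobounding_extension wip pb db b1 sP mP P0 fP gs1 cP).
have rou := torsion_case_eigenvalues wip pb db.
have [|y hy ev] := hp (subst_code sigma).
  have [t|[P [gs [N [[b1 sP mP P0] fP gs1 cP]]]]] := torsion_or_cobounding wip pb db.
    by have [y hy] := torsion_cert_complete rk0 prim t; exists y; rewrite hy.
  have [r [j [cr dom]]] := cobounding_dominated b1 fP gs1 cP.
  by have [y hy] := cobounding_cert_complete rk0 prim cr dom; exists y; rewrite hy orbT.
exists (torsion_cert y (subst_code sigma)); split=> //.
  split=> [/(torsion_cert_sound rk0)/rou //|r].
  case/orP: hy => // /(cobounding_cert_sound rk0)/ext/excl; exact.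
split=> [n|fe].
  by move: hy; rewrite (negPf n) => /(cobounding_cert_sound rk0)/ext.
by apply/negP => /(torsion_cert_sound rk0)/rou; exact: excl.
Qed.

Theorem theorem1p3 (R : realType) :
  (forall (A : finType) (sigma : substitution A) (beta : R) (d : nat),
     weakly_irreducible_pisot R sigma ->
     perron_eigenvalue sigma beta ->
     has_degree beta d.+1 ->
     only_root_of_unity_eigenvalues R sigma \/
     finite_extension_of_minimal_translation R d sigma)
  /\
  (exists p : murec 1,
     forall (A : finType) (sigma : substitution A) (beta : R) (d : nat),
       weakly_irreducible_pisot R sigma ->
       perron_eigenvalue sigma beta ->
       has_degree beta d.+1 ->
       exists b : bool,
         [/\ murec_eval p [tuple subst_code sigma] (b : nat),
             b <-> only_root_of_unity_eigenvalues R sigma &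
             ~~ b <-> finite_extension_of_minimal_translation R d sigma]).
Proof.
have [c1 c2] := computable_certs.
have [p hp] := computable_search (T := fun y S => torsion_cert y S || cobounding_cert y S)
  (computable_or (b1 := fun v => torsion_cert (nth 0 v 0) (nth 0 v 1))
     (b2 := fun v => cobounding_cert (nth 0 v 0) (nth 0 v 1)) c1 c2) c1.
have H := torsion_cert_decides hp.
split; last by exists p => A sigma beta d; exact: H.
move=> A sigma beta d wip pb db; have [[] [_ h1 h2]] := H R A sigma beta d wip pb db.
  by left; apply/h1.
by right; apply/h2.
Qed.
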